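(* Let $(X,\mu)$ be a standard non-atomic probability space, let $G$ be a spatial closed subgroup of $\mathrm{Aut}(X,\mu)$, and denote by $g\cdot x$ the corresponding action of $G$ on $X$. Consider the diagonal action of $G$ on $X^{\mathbb N}$ given by $g\cdot (x_n) = (g\cdot x_n)$, which preserves the product measure $\mu^{\mathbb N}$. Then there is a $G$-invariant Borel set $Y\subseteq X^{\mathbb N}$ with $\mu^{\mathbb N}(Y)=1$ such that $G$ acts freely on $Y$. In particular, if $G$ is non-locally compact, then $E_Y^G$ is not essentially countable.
   Context: $\mathrm{Aut}(X,\mu)$ is the Polish group of all automorphisms of $(X,\mu)$ (measure preserving Borel bijections, identified when equal $\mu$-almost everywhere) with the weak topology. If $G$ is a closed subgroup of $\mathrm{Aut}(X,\mu)$, the identity map gives a Boolean action of $G$ on $(X,\mu)$. $G$ is called spatial if this Boolean action has a spatial realization, i.e., it comes from a Borel action $(g,x)\mapsto g\cdot x$ of $G$ on $X$ which preserves $\mu$ (so that for each $g\in G$, the map $x\mapsto g\cdot x$ represents the automorphism $g$, i.e., agrees with it $\mu$-a.e.); this is the corresponding action. An action of $G$ on a set $Y$ is free if $g\cdot y\neq y$ for all $g\neq 1$ and all $y\in Y$. The orbit equivalence relation $E^G_Y$ on a Borel $G$-space $Y$ (standard Borel space with a Borel action of $G$) is the relation of having the same $G$-orbit. For analytic equivalence relations $E$, $F$ on standard Borel spaces $X$, $Y$, $E\leq_B F$ means that there is a Borel map $f\colon X\to Y$ such that $x\,E\,x' \iff f(x)\,F\,f(x')$. A Borel equivalence relation is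 countable if each of its classes is countable. $E$ is essentially countable if $E\leq_B F$ for some countable Borel equivalence relation $F$ (on a standard Borel space). *)

(* Defs.v *)
From HB Require Import structures.
From mathcomp Require Import all_boot all_order all_algebra.
From mathcomp Require Import all_classical all_reals all_analysis.

Set Implicit Arguments.
Unset Strict Implicit.
Unset Printing Implicit Defensive.

Import Order.TTheory GRing.Theory Num.Theory.

Local Open Scope quotient_scope.
Local Open Scope classical_set_scope.
Local Open Scope ring_scope.

Definition separable_space (T : topologicalType) : Prop :=
  exists2 D : set T, countable D & dense D.

(* A complete Hausdorff pseudometric space is a complete metric space, so P
   ranges over the Polish spaces with a chosen complete metric. *)
Definition standard_borel (R : realType) d (T : measurableType d) : Prop :=
  exists (P : completePseudoMetricType R) (f : T -> P),
    [/\ hausdorff_space P, separable_space P, bijective f &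
        forall A : set T, measurable A <-> <<s (@open P) >> (f @` A)].

Definition non_atomic (R : realType) d (T : measurableType d)
    (mu : {measure set T -> \bar R}) : Prop :=
  forall A, measurable A -> (0 < mu A)%E ->
    exists B, [/\ measurable B, B `<=` A, (0 < mu B)%E & (mu B < mu A)%E].

Definition measure_preserving (R : realType) d (T : measurableType d)
    (mu : {measure set T -> \bar R}) (f : T -> T) : Prop :=
  measurable_fun setT f /\
  forall A, measurable A -> mu (f @^-1` A) = mu A.

(* On a standard Borel space the inverse of a Borel bijection is Borel, so
   requiring measurability of the inverse does not restrict mpbij there. *)
Record mpbij (R : realType) d (T : measurableType d)
    (mu : {measure set T -> \bar R}) : Type := MPBij {
  mpfun :> T -> T;
  mpinv : T -> T;
  mpfunK : cancel mpfun mpinv;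
  mpinvK : cancel mpinv mpfun;
  mpfun_preserving : measure_preserving mu mpfun;
  measurable_mpinv : measurable_fun setT mpinv }.

Section mpbij.
Context (R : realType) d (T : measurableType d).
Variable mu : {measure set T -> \bar R}.

HB.instance Definition _ := gen_eqMixin (mpbij mu).
HB.instance Definition _ := gen_choiceMixin (mpbij mu).

Lemma measure_preserving_id : measure_preserving mu id.
Proof. by split => //; exact: measurable_id. Qed.

Lemma measure_preserving_comp f g : measure_preserving mu f ->
  measure_preserving mu g -> measure_preserving mu (f \o g).
Proof.
move=> [mf pf] [mg pg]; split; first exact: measurableT_comp.
by move=> A mA; rewrite comp_preimage pg ?pf// -[X in measurable X]setTI; exact: mf.
Qed.

Lemma mpinv_preserving (f : mpbij mu) : measure_preserving mu (mpinv f).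
Proof.
split; first exact: measurable_mpinv.
move=> A mA; rewrite -(mpfun_preserving f).2; last first.
  by rewrite -[X in measurable X]setTI; exact: measurable_mpinv.
by rewrite -comp_preimage; congr (mu _); apply/seteqP; split => x /=;
  rewrite mpfunK.
Qed.

Definition mpid : mpbij mu :=
  @MPBij _ _ _ mu id id (fun=> erefl) (fun=> erefl) measure_preserving_id
    (@measurable_id _ _ setT).

Definition mpcomp (f g : mpbij mu) : mpbij mu :=
  @MPBij _ _ _ mu (f \o g) (mpinv g \o mpinv f)
    (can_comp (mpfunK f) (mpfunK g)) (can_comp (mpinvK g) (mpinvK f))
    (measure_preserving_comp (mpfun_preserving f) (mpfun_preserving g))
    (measurableT_comp (measurable_mpinv g) (measurable_mpinv f)).

Definition mpsym (f : mpbij mu) : mpbij mu :=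
  @MPBij _ _ _ mu (mpinv f) f (mpinvK f) (mpfunK f) (mpinv_preserving f)
    (mpfun_preserving f).1.

Lemma ae_preserving (g : T -> T) (P : T -> Prop) : measure_preserving mu g ->
  {ae mu, forall x, P x} -> {ae mu, forall x, P (g x)}.
Proof.
move=> [mg pg] [N [mN N0 PN]]; exists (g @^-1` N); split.
- by rewrite -[X in measurable X]setTI; exact: mg.
- by rewrite pg.
- by move=> x /= Pgx; exact: PN.
Qed.

Definition mp_ae_eq (f g : mpbij mu) : bool :=
  `[< {ae mu, forall x, f x = g x} >].

Lemma mp_ae_eqP (f g : mpbij mu) :
  reflect {ae mu, forall x, f x = g x} (mp_ae_eq f g).
Proof. exact: asboolP. Qed.

Let mp_ae_eq_refl : reflexive mp_ae_eq.
Proof. by move=> f; apply/mp_ae_eqP; exact: aeW. Qed.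

Let mp_ae_eq_sym : symmetric mp_ae_eq.
Proof.
by move=> f g; apply/mp_ae_eqP/mp_ae_eqP; apply: filterS => x ->.
Qed.

Let mp_ae_eq_trans : transitive mp_ae_eq.
Proof.
move=> g f h /mp_ae_eqP fg /mp_ae_eqP gh; apply/mp_ae_eqP.
by apply: filterS2 fg gh => x -> ->.
Qed.

Canonical mp_ae_eq_equiv :=
  EquivRel mp_ae_eq mp_ae_eq_refl mp_ae_eq_sym mp_ae_eq_trans.

Definition Aut : Type := {eq_quot mp_ae_eq}.
HB.instance Definition _ := Choice.on Aut.
HB.instance Definition _ := EqQuotient.on Aut.

(* an arbitrarily chosen representative, well defined up to a null set *)
Definition Aut_to_fun (g : Aut) : T -> T := mpfun (repr g).
Coercion Aut_to_fun : Aut >-> Funclass.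

Lemma pi_ae (f : mpbij mu) :
  {ae mu, forall x, (\pi_Aut f : Aut) x = f x}.
Proof. by apply/mp_ae_eqP; rewrite -eqmodE reprK. Qed.

Lemma Aut_eqP (g h : Aut) : g = h <-> {ae mu, forall x, g x = h x}.
Proof.
split=> [->|gh]; first exact: aeW.
by rewrite -[g]reprK -[h]reprK; apply/eqP; rewrite eqmodE; exact/mp_ae_eqP.
Qed.

Definition Aut_one : Aut := \pi_Aut mpid.
Definition Aut_mul (g h : Aut) : Aut := \pi_Aut (mpcomp (repr g) (repr h)).
Definition Aut_inv (g : Aut) : Aut := \pi_Aut (mpsym (repr g)).

Lemma Aut_preserving (g : Aut) : measure_preserving mu g.
Proof. exact: mpfun_preserving. Qed.

Lemma Aut_oneE : {ae mu, forall x, Aut_one x = x}.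
Proof. exact: (pi_ae mpid). Qed.

Lemma Aut_mulE g h : {ae mu, forall x, Aut_mul g h x = g (h x)}.
Proof. exact: (pi_ae (mpcomp (repr g) (repr h))). Qed.

Lemma Aut_invE g : {ae mu, forall x, Aut_inv g x = mpinv (repr g) x}.
Proof. exact: (pi_ae (mpsym (repr g))). Qed.

Let Aut_mulA : associative Aut_mul.
Proof.
move=> f g h; apply/Aut_eqP; near=> x.
have -> : Aut_mul f (Aut_mul g h) x = f (Aut_mul g h x).
  by near: x; exact: Aut_mulE.
have -> : Aut_mul g h x = g (h x) by near: x; exact: Aut_mulE.
have -> : Aut_mul (Aut_mul f g) h x = Aut_mul f g (h x).
  by near: x; exact: Aut_mulE.
have -> // : Aut_mul f g (h x) = f (g (h x)).
by near: x; apply: (ae_preserving (Aut_preserving h) (Aut_mulE f g)).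
Unshelve. all: by end_near. Qed.

Let Aut_mul1 : left_id Aut_one Aut_mul.
Proof.
move=> g; apply/Aut_eqP; near=> x.
have -> : Aut_mul Aut_one g x = Aut_one (g x) by near: x; exact: Aut_mulE.
by near: x; apply: (ae_preserving (Aut_preserving g) Aut_oneE).
Unshelve. all: by end_near. Qed.

Let Aut_mulr1 : right_id Aut_one Aut_mul.
Proof.
move=> g; apply/Aut_eqP; near=> x.
have -> : Aut_mul g Aut_one x = g (Aut_one x) by near: x; exact: Aut_mulE.
by congr (_ _); near: x; exact: Aut_oneE.
Unshelve. all: by end_near. Qed.

Let Aut_mulV : left_inverse Aut_one Aut_inv Aut_mul.
Proof.
move=> g; apply/Aut_eqP; near=> x.
have -> : Aut_mul (Aut_inv g) g x = Aut_inv g (g x).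
  by near: x; exact: Aut_mulE.
have -> : Aut_one x = x by near: x; exact: Aut_oneE.
rewrite -[RHS](mpfunK (repr g)).
by near: x; apply: (ae_preserving (Aut_preserving g) (Aut_invE g)).
Unshelve. all: by end_near. Qed.

Let Aut_mulrV : right_inverse Aut_one Aut_inv Aut_mul.
Proof.
move=> g; apply/Aut_eqP; near=> x.
have -> : Aut_mul g (Aut_inv g) x = g (Aut_inv g x).
  by near: x; exact: Aut_mulE.
have -> : Aut_one x = x by near: x; exact: Aut_oneE.
have -> : Aut_inv g x = mpinv (repr g) x by near: x; exact: Aut_invE.
exact: mpinvK.
Unshelve. all: by end_near. Qed.

HB.instance Definition _ :=
  isGroup.Build Aut Aut_mulA Aut_mul1 Aut_mulr1 Aut_mulV Aut_mulrV.
HB.instance Definition _ := isPointed.Build Aut Aut_one.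

(* The weak topology is the coarsest one making g |-> g(A), from Aut to the
   measure algebra with the distance mu (A + B), continuous for every Borel A.
   It is generated by the following sets. *)
Definition weak_subbase : set (set Aut) :=
  [set U | exists (A : set T) (h : Aut) (e : R),
    [/\ measurable A, 0 < e &
        U = [set g : Aut | (mu ((g @` A) `+` (h @` A)) < e%:E)%E]]].

HB.instance Definition _ := isSubBaseTopological.Build Aut weak_subbase id.

End mpbij.

Arguments Aut {R d T} mu.

(* An action of the subgroup G is given by a map on the whole ambient group,
   of which only the restriction to G is relevant. *)
Definition is_action_on (gT : groupType) (G : set gT) (T : Type)
    (act : gT -> T -> T) : Prop :=
  (forall x, act 1%g x = x) /\
  (forall g h x, G g -> G h -> act (g * h)%g x = act g (act h x)).

Definition orbit_rel_on (gT : groupType) (G : set gT) (T : Type)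
    (act : gT -> T -> T) (x y : T) : Prop :=
  exists2 g, G g & y = act g x.

Definition free_on (gT : groupType) (G : set gT) (T : Type)
    (act : gT -> T -> T) (Y : set T) : Prop :=
  forall g y, G g -> g <> 1%g -> Y y -> act g y <> y.

Definition invariant_under (gT : groupType) (G : set gT) (T : Type)
    (act : gT -> T -> T) (Y : set T) : Prop :=
  forall g y, G g -> Y y -> Y (act g y).

Definition closed_subgroup (R : realType) d (T : measurableType d)
    (mu : {measure set T -> \bar R}) (G : set (Aut mu)) : Prop :=
  closed G /\ group_closed [in G].

Definition borel (T : ptopologicalType) : Type := g_sigma_algebraType (@open T).
HB.instance Definition _ (T : ptopologicalType) :=
  Measurable.on (borel T).

Definition spatial_realization (R : realType) d (T : measurableType d)
    (mu : {measure set T -> \bar R}) (G : set (Aut mu))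
    (act : Aut mu -> T -> T) : Prop :=
  [/\ is_action_on G act,
      measurable_fun ((G : set (borel (Aut mu))) `*` [set: T])
        (fun p : borel (Aut mu) * T => act p.1 p.2),
      (forall g, G g -> measure_preserving mu (act g)) &
      (forall g, G g -> {ae mu, forall x, act g x = g x})].

Definition cylinders1 d (T : measurableType d) : set (set (nat -> T)) :=
  [set C | exists (n : nat) (A : set T),
     measurable A /\ C = [set x | A (x n)]].

Definition seq_space d (T : measurableType d) : Type :=
  g_sigma_algebraType (@cylinders1 d T).
HB.instance Definition _ d (T : measurableType d) :=
  Measurable.on (seq_space T).

(* This determines muN uniquely, the rectangles being a generating pi-system. *)
Definition is_product_measure (R : realType) d (T : measurableType d)
    (mu : probability T R) (muN : probability (seq_space T) R) : Prop :=
  forall (n : nat) (A : nat -> set T), (forall i, measurable (A i)) ->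
    muN [set x : seq_space T | forall i, (i < n)%N -> A i (x i)] =
    (\prod_(i < n) mu (A i))%E.

Definition diag_act (gT : Type) d (T : measurableType d) (act : gT -> T -> T)
    (g : gT) (x : seq_space T) : seq_space T := fun n => act g (x n).

(* Reducibility of the restriction of E to D. *)
Definition borel_reducible_on d1 d2 (T1 : measurableType d1)
    (T2 : measurableType d2) (D : set T1) (E : T1 -> T1 -> Prop)
    (F : T2 -> T2 -> Prop) : Prop :=
  exists2 f : T1 -> T2, measurable_fun D f &
    forall x y, D x -> D y -> (E x y <-> F (f x) (f y)).

Definition countable_borel_equivalence d (T : measurableType d)
    (F : T -> T -> Prop) : Prop :=
  [/\ (forall x, F x x), (forall x y, F x y -> F y x),
      (forall x y z, F x y -> F y z -> F x z),
      measurable [set p : T * T | F p.1 p.2] &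
      forall x, countable [set y | F x y]].

Definition essentially_countable_on (R : realType) d (T : measurableType d)
    (D : set T) (E : T -> T -> Prop) : Prop :=
  exists (d' : measure_display) (Z : measurableType d') (F : Z -> Z -> Prop),
    [/\ standard_borel R Z, countable_borel_equivalence F &
        borel_reducible_on D E F].

(* Main.v *)
Require Import Defs.
From HB Require Import structures.
From mathcomp Require Import all_boot all_order all_algebra.
From mathcomp Require Import all_classical all_reals all_analysis.
From mathcomp Require Import lra.

(** Freeness. By taking Vaught transforms of a countable family of Borel sets
    that separates the points of X one gets a countable family b of Borel sets
    that is closed under finite unions and intersections, and is the basis of a
    regular topology, separating points, for which every group element acts by
    homeomorphisms (vaught_invariant_basis). The set Y consists of the
    sequences that visit every b i of positive measure; almost every sequence
    does. As a translate of b i is a union of sets b j, the set Y is invariant.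
    If y is in Y and no n satisfies y n in b i and g (y n) in b j, then the
    intersection of b i with the preimage of b j under g is null: otherwise it
    would contain a set b k of positive measure, which y visits
    (basis_dense_miss). So a single sequence of Y decides which of these
    intersections are null. In particular, if g fixes y, then almost no x is
    separated from g x by two disjoint sets of the basis; since the topology is
    regular and separates points, g x = x almost everywhere
    (basis_dense_fixed).

    Local compactness. Let f reduce the orbit equivalence relation of Y to a
    countable relation. On each orbit f takes countably many values, so, the
    group being Polish, f (t y) is the same for all t in a comeager part of
    some basic open set. Hence on a set of positive measure one open set U j
    works for all y, and then there are an open set U w and a neighborhood N of
    the identity such that U w works for every translate of y by an element of
    N, with the same generic value. Points with the same generic value
    are in the same orbit, and this relation between points is given by
    countably many measurable sets, so off a set of small measure there is a
    measurable selection of a representative s y of the class of y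
    (code_section). If y = t (s y), then t is
    determined by y, because the action is free, and since s y decides
    nullness, a countable measurable label of y records, up to any prescribed
    error, the sets into which t pulls back finitely many given Borel sets.
    For sufficiently many elements of N, the pigeonhole principle for measures
    gives two of them, g and h, and a point y such that g y and h y have
    the same label; they also have the same representative, so g and h are
    close to each other (totally_bounded_nbhd). Thus N is totally bounded for a
    one-sided uniformity, and its intersection with its inverse for the
    two-sided one. The two-sided uniformity of Aut(X, mu), hence of a closed
    subgroup, is complete (Aut_complete, subgroup_complete_balls), and so the
    group is locally compact (locally_compact_nbhd).

    Wherever the classical argument uses compact subsets of a Polish space, a
    point is replaced by its code, the sequence of its answers to countably
    many membership questions, and compactness by the requirement that codes
    realized up to every finite stage be realized. A standard Borel space with a
    probability, and its countable power, have separating sequences for which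
    such compact sets exist with measure close to 1 (standard_coding,
    product_coding), and one such sequence suffices to find compact sets for
    any other sequence of Borel sets (code_lusin), which is the form that
    Lusin's theorem takes here. *)

Set Implicit Arguments.
Unset Strict Implicit.
Unset Printing Implicit Defensive.

Import Order.TTheory GRing.Theory Num.Theory.
Import numFieldNormedType.Exports.

Local Open Scope classical_set_scope.
Local Open Scope ring_scope.

(** * Probabilities as real numbers *)

Ltac mset := repeat first [ assumption | apply: measurableI | apply: measurableU
  | apply: measurableD | apply: measurableC | exact: measurable0
  | exact: measurableT ].

Section prob.
Context (R : realType) d (T : measurableType d) (mu : probability T R).
Implicit Types A B C : set T.

Definition pr A : R := fine (mu A).

Lemma prE A : measurable A -> mu A = (pr A)%:E.
Proof. by move=> mA; rewrite fineK// fin_num_measure. Qed.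

Lemma pr_ge0 A : 0 <= pr A.
Proof. exact: fine_ge0. Qed.

Lemma pr0 : pr set0 = 0.
Proof. by rewrite /pr measure0. Qed.

Lemma prT : pr setT = 1.
Proof. by rewrite /pr probability_setT. Qed.

Lemma le_pr A B : measurable A -> measurable B -> A `<=` B -> pr A <= pr B.
Proof.
by move=> mA mB AB; rewrite -lee_fin -!prE//; apply: le_measure; rewrite ?inE.
Qed.

Lemma pr_le1 A : measurable A -> pr A <= 1.
Proof. by move=> mA; rewrite -prT; apply: le_pr. Qed.

Lemma prC A : measurable A -> pr (~` A) = 1 - pr A.
Proof.
move=> mA; apply: EFin_inj; rewrite EFinB -!prE//; last exact: measurableC.
exact: probability_setC.
Qed.

Lemma prU_le A B : measurable A -> measurable B -> pr (A `|` B) <= pr A + pr B.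
Proof.
move=> mA mB; rewrite -lee_fin EFinD -!prE//; last exact: measurableU.
exact: measureU2.
Qed.

Lemma pr_le_D A B : measurable A -> measurable B -> pr A <= pr B + pr (A `\` B).
Proof.
move=> mA mB; apply: le_trans (prU_le mB _); last exact: measurableD.
by apply: le_pr; mset => x Ax; have [Bx|nBx] := pselect (B x); [left|right].
Qed.

Lemma prD A B : measurable A -> measurable B -> B `<=` A ->
  pr (A `\` B) = pr A - pr B.
Proof.
move=> mA mB BA; have mD := measurableD mA mB.
have : (mu A = mu (A `\` B) + mu (A `&` B))%E by exact: measureDI.
by rewrite setIidr// !prE// -EFinD => -[->]; rewrite addrK.
Qed.

Lemma pr_bigcup_le (F : nat -> set T) (e : R) : (forall n, measurable (F n)) ->
  (forall n, pr (F n) <= e / (2 ^ n.+1)%:R) -> pr (\bigcup_n F n) <= e.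
Proof.
move=> mF Fe; have mU : measurable (\bigcup_n F n) by exact: bigcupT_measurable.
have e0 : 0 <= e.
  by have := le_trans (pr_ge0 _) (Fe 0%N); rewrite pmulr_lge0 ?invr_gt0 ?ltr0n.
rewrite -lee_fin -prE//.
apply: le_trans (measure_sigma_subadditive mu mF mU _) _ => //.
apply: le_trans (epsilon_trick0 xpredT e0).
by apply: lee_nneseries => // n _; have := Fe n; rewrite -lee_fin -prE.
Qed.

Lemma pr_bigcup0 (F : nat -> set T) : (forall n, measurable (F n)) ->
  (forall n, pr (F n) = 0) -> pr (\bigcup_n F n) = 0.
Proof.
move=> mF F0; apply/eqP; rewrite eq_le pr_ge0 andbT.
by apply: pr_bigcup_le => // n; rewrite F0 mul0r.
Qed.

Lemma pr_nd_approx (F : nat -> set T) (e : R) : (forall n, measurable (F n)) ->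
  nondecreasing_seq F -> 0 < e -> exists n, pr (\bigcup_n F n) < pr (F n) + e.
Proof.
move=> mF ndF e0; have mU : measurable (\bigcup_n F n) by exact: bigcupT_measurable.
have /fine_cvgP[_ c] : mu \o F @ \oo --> (pr (\bigcup_n F n))%:E.
  by rewrite -prE//; exact: nondecreasing_cvg_mu.
have [n _ Hn] : \forall n \near \oo, pr (\bigcup_n F n) - e < pr (F n).
  by apply: (cvgr_gt (pr (\bigcup_n F n)) c); rewrite ltrBlDr ltrDl.
by exists n; rewrite -ltrBlDr; apply: Hn => /=.
Qed.

Lemma pr_ni_approx (F : nat -> set T) (e : R) : (forall n, measurable (F n)) ->
  nonincreasing_seq F -> 0 < e -> exists n, pr (F n) < pr (\bigcap_n F n) + e.
Proof.
move=> mF niF e0; have mI : measurable (\bigcap_n F n) by exact: bigcapT_measurable.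
have [||n] := @pr_nd_approx (fun n => ~` F n) e _ _ e0.
- by move=> n; exact: measurableC.
- by move=> m n mn; apply/subsetPset/subsetC/subsetPset/niF.
rewrite -setC_bigcap !prC// => H.
by exists n; lra.
Qed.

Lemma pr_bigcup_approx (F : nat -> set T) (e : R) : (forall n, measurable (F n)) ->
  0 < e -> exists n, pr (\bigcup_n F n) < pr (\bigcup_(k < n) F k) + e.
Proof.
move=> mF e0; have [||n] := @pr_nd_approx (fun n => \bigcup_(k < n) F k) e _ _ e0.
- by move=> n; exact: bigcup_measurable.
- move=> m n mn; apply/subsetPset => x [k /= km Fx].
  by exists k => //=; exact: leq_trans mn.
set U := \bigcup_n _ => H.
exists n; suff -> : \bigcup_n F n = U by [].
apply/seteqP; split=> x; first by move=> [m _ Fm]; exists m.+1 => //; exists m => /=.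
by move=> [m _ [k _ Fk]]; exists k.
Qed.

(** The metric of the measure algebra. *)
Definition md A B : R := pr (A `+` B).

Lemma measurableY A B : measurable A -> measurable B -> measurable (A `+` B).
Proof. by move=> mA mB; rewrite setY_def; mset. Qed.

Lemma md_ge0 A B : 0 <= md A B. Proof. exact: pr_ge0. Qed.

Lemma mdxx A : md A A = 0. Proof. by rewrite /md setYK pr0. Qed.

Lemma mdC A B : md A B = md B A. Proof. by rewrite /md setYC. Qed.

Lemma setY_trans A B C : A `+` C `<=` (A `+` B) `|` (B `+` C).
Proof.
move=> x; rewrite !setY_def => -[[Ax nCx]|[Cx nAx]];
  by have [Bx|nBx] := pselect (B x); [by [right; left|left; right]|
    by [left; left|right; right]].
Qed.

Lemma md_le A B C : measurable A -> measurable B -> measurable C ->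
  A `+` B `<=` C -> md A B <= pr C.
Proof. by move=> *; apply: le_pr => //; exact: measurableY. Qed.

Lemma md_trans B A C : measurable A -> measurable B -> measurable C ->
  md A C <= md A B + md B C.
Proof.
move=> mA mB mC; have mAB := measurableY mA mB; have mBC := measurableY mB mC.
apply: le_trans (prU_le mAB mBC); apply: md_le => //; first exact: measurableU.
exact: setY_trans.
Qed.

Lemma pr_le_md A B : measurable A -> measurable B -> pr A <= pr B + md A B.
Proof.
move=> mA mB; apply: le_trans (pr_le_D mA mB) _; rewrite lerD2l.
apply: le_pr; [exact: measurableD|exact: measurableY|].
by move=> x ABx; rewrite setY_def; left.
Qed.

Lemma md_ae A B : measurable A -> measurable B ->
  {ae mu, forall x, A x <-> B x} -> md A B = 0.
Proof.
move=> mA mB [N [mN N0 NP]]; apply/eqP; rewrite eq_le md_ge0 andbT.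
have <- : pr N = 0 by rewrite /pr N0.
apply: md_le => // x ABx; apply: NP => /= -[h1 h2]; rewrite setY_def in ABx.
by case: ABx => -[] /=; tauto.
Qed.

Lemma mdE0 A A' B B' : measurable A -> measurable A' -> measurable B ->
  measurable B' -> md A A' = 0 -> md B B' = 0 -> md A B = md A' B'.
Proof.
move=> mA mA' mB mB' AA' BB'; apply/eqP; rewrite eq_le; apply/andP; split.
- apply: le_trans (md_trans mA mA' mB) _; rewrite AA' add0r.
  by apply: le_trans (md_trans mA' mB' mB) _; rewrite (mdC B') BB' addr0.
- apply: le_trans (md_trans mA' mA mB') _; rewrite (mdC A') AA' add0r.
  by apply: le_trans (md_trans mA mB mB') _; rewrite BB' addr0.
Qed.

Lemma pr_eq0_ae A : measurable A -> pr A = 0 -> {ae mu, forall x, ~ A x}.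
Proof.
move=> mA A0; exists A; split => //; first by rewrite prE// A0.
by move=> x /= /contrapT.
Qed.

Lemma md_preim (f : T -> T) A B : measure_preserving mu f ->
  measurable A -> measurable B -> md (f @^-1` A) (f @^-1` B) = md A B.
Proof.
move=> [mf pf] mA mB; rewrite /md /pr; congr fine.
by rewrite -(pf (A `+` B))//; exact: measurableY.
Qed.

End prob.

Lemma sigma_ind (T : Type) (G K : set (set T)) : K set0 ->
  (forall A, K A -> K (~` A)) ->
  (forall F : nat -> set T, (forall n, K (F n)) -> K (\bigcup_n F n)) ->
  G `<=` K -> <<s G >> `<=` K.
Proof.
move=> K0 KC KU GK; apply: smallest_sub => //; split => // A KA.
by rewrite setTD; exact: KC.
Qed.

(** Preimages need to be compared only on a generating pi-system, because the
    sets on which the two measures agree form a Dynkin class. *)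
Lemma preserving_pi (R : realType) d (T : measurableType d)
    (mu : probability T R) (f : T -> T) (G : set (set T)) :
  measurable = <<s G >> -> setI_closed G ->
  (forall A, measurable A -> measurable (f @^-1` A)) ->
  (forall A, G A -> mu (f @^-1` A) = mu A) ->
  measure_preserving mu f.
Proof.
move=> mG GI mf fG; split; first by move=> _ A mA; rewrite setTI; exact: mf.
move=> A mA; rewrite mG in mA.
apply: (dynkin_induction (P := fun A => mu (f @^-1` A) = mu A) mG GI) mA => //.
- move=> {}A mA fA; rewrite preimage_setC !probability_setC ?fA//; exact: mf.
- move=> F mF tF fF; rewrite preimage_bigcup.
  rewrite !measure_semi_bigcup//.
  + by apply: eq_eseriesr => n _; exact: fF.
  + exact: bigcupT_measurable.
  + by move=> n; exact: mf.
  + by move=> i j _ _ [x [/= ix jx]]; apply: tF => //; exists (f x).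
  + by apply: bigcupT_measurable => n; exact: mf.
Qed.

Section disjoint.
Context (R : realType) d (T : measurableType d) (mu : probability T R).

Lemma prU_disj (A B : set T) : measurable A -> measurable B -> A `&` B = set0 ->
  pr mu (A `|` B) = pr mu A + pr mu B.
Proof.
move=> mA mB AB0; have := prD mu (measurableU _ _ mA mB) mB (@subsetUr _ A B).
rewrite setDUl setDv setU0 (_ : A `\` B = A); first lra.
by apply/seteqP; split=> [x []//|x Ax]; split=> // Bx; rewrite -[False]/(set0 x) -AB0.
Qed.

Lemma sum_pr_disj (B : nat -> set T) n : (forall i, measurable (B i)) ->
  (forall i j, (i < j < n)%N -> B i `&` B j = set0) ->
  \sum_(i < n) pr mu (B i) <= 1.
Proof.
move=> mB dB; have mU k : measurable (\bigcup_(i < k) B i) by exact: bigcup_measurable.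
suff -> : \sum_(i < n) pr mu (B i) = pr mu (\bigcup_(i < n) B i) by exact: pr_le1.
elim: n dB => [|n IH] dB; first by rewrite big_ord0 bigcup_mkord big_ord0 pr0.
rewrite big_ord_recr /= IH; last first.
  by move=> i j /andP[ij jn]; apply: dB; rewrite ij (ltn_trans jn).
rewrite -prU_disj//.
  by congr pr; rewrite !bigcup_mkord big_ord_recr.
apply/seteqP; split=> // x [[i /= iN Bi] Bn].
by have : (B i `&` B n) x by []; rewrite dB// iN ltnSn.
Qed.

Lemma pr_bigcup_le_sum (F : nat -> set T) n : (forall k, measurable (F k)) ->
  pr mu (\bigcup_(k < n) F k) <= \sum_(k < n) pr mu (F k).
Proof.
move=> mF; have mU m : measurable (\bigcup_(k < m) F k) by exact: bigcup_measurable.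
elim: n => [|n IH]; first by rewrite bigcup_mkord !big_ord0 pr0.
rewrite bigcup_mkord !big_ord_recr /= -bigcup_mkord.
by apply: le_trans (prU_le mu (mU n) (mF n)) _; rewrite lerD2r.
Qed.

(** The pigeonhole principle: otherwise, for each p < n, the sets B i p with i < M
    would be disjoint and have total measure at most 1. *)
Lemma pigeonhole_pr (n M : nat) (c : R) (B : nat -> nat -> set T) :
  (forall i p, measurable (B i p)) ->
  (forall i, (i < M)%N -> c <= pr mu (\bigcup_(p < n) B i p)) ->
  n%:R < M%:R * c ->
  exists i j p x, [/\ (i < j)%N, (j < M)%N, (p < n)%N, B i p x & B j p x].
Proof.
move=> mB cB; apply: contraPP => none; apply/negP; rewrite -leNgt.
have dB p i j : (p < n)%N -> (i < j < M)%N -> B i p `&` B j p = set0.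
  move=> pn /andP[ij jM]; apply/seteqP; split=> // x [Bi Bj].
  by apply: none; exists i, j, p, x.
have -> : n%:R = \sum_(p < n) (1 : R) by rewrite sumr_const card_ord.
apply: (@le_trans _ _ (\sum_(p < n) \sum_(i < M) pr mu (B i p))); last first.
  apply: ler_sum => p _; apply: (sum_pr_disj (B := fun i => B i p)) => [i //|i j].
  exact: dB.
rewrite exchange_big /=.
have -> : M%:R * c = \sum_(i < M) c by rewrite sumr_const card_ord mulr_natl.
apply: ler_sum => i _; apply: le_trans (cB i (ltn_ord i)) _.
exact: pr_bigcup_le_sum.
Qed.

End disjoint.

Lemma measurable_bigcup_countType d (T : measurableType d) (I : countType)
    (F : I -> set T) : (forall i, measurable (F i)) ->
  measurable (\bigcup_i F i).
Proof.
move=> mF; rewrite (_ : \bigcup_i F i =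
    \bigcup_n (if unpickle n is Some i then F i else set0)).
  by apply: bigcupT_measurable => n; case: unpickle.
apply/seteqP; split=> [x [i _ Fx]|x [n _]].
  by exists (pickle i) => //; rewrite pickleK.
by case: unpickle => // i Fx; exists i.
Qed.

Lemma halve_pow (R : realType) n : (2 ^ n.+1)%:R^-1 + (2 ^ n.+1)%:R^-1 = (2 ^ n)%:R^-1 :> R.
Proof.
by rewrite expnSr natrM invfM -mulrDr -[X in X + X]mul1r -splitr mulr1.
Qed.

Lemma inv_pow_lt (R : realType) (e : R) : 0 < e -> exists n, forall m, (n <= m)%N ->
  (2 ^ m)%:R^-1 < e.
Proof.
move=> e0; have [n ne] := ltr_add_invr e0; rewrite add0r in ne.
exists n => m nm; apply: le_lt_trans ne.
rewrite lef_pV2 ?posrE ?ltr0n ?expn_gt0// ler_nat.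
exact: leq_ltn_trans nm (ltn_expl _ _).
Qed.

Lemma nbhs_forall_lt (T : topologicalType) (t : T) (P : nat -> set T) n :
  (forall k, nbhs t (P k)) -> nbhs t [set s | forall k, (k < n)%N -> P k s].
Proof.
move=> nP; elim: n => [|n IH]; first exact: filterS filterT.
by apply: filterS2 IH (nP n) => s ns Ps k; rewrite ltnS leq_eqVlt => /orP[/eqP->|/ns].
Qed.

(** * Codes of points in the Cantor space *)

Section code.
Context (T : Type).
Implicit Types (A : nat -> set T) (K : set T) (x : T).

Definition code A x : nat -> bool := fun k => `[< A k x >].

Lemma codeP A x k : reflect (A k x) (code A x k).
Proof. exact: asboolP. Qed.

Lemma eq_code A x y k : code A x k = code A y k -> (A k x <-> A k y).
Proof. by move=> e; split=> /codeP; [rewrite e|rewrite -e] => /codeP. Qed.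

(** The set of codes of the points of K is closed in the Cantor space, hence
    compact. *)
Definition code_compact A K := forall c : nat -> bool,
  (forall n, exists2 x, K x & forall k, (k < n)%N -> code A x k = c k) ->
  exists2 x, K x & code A x = c.

(** K is closed in the topology in which every A k is clopen. *)
Definition code_closed A K := forall x,
  (forall n, exists2 y, K y & forall k, (k < n)%N -> code A y k = code A x k) ->
  K x.

(** Compactness of the Cantor space: c' is the limit of the sequence c along a
    nonprincipal ultrafilter. *)
Lemma cluster_code (c : nat -> nat -> bool) : exists c', forall n,
  exists2 m, (n <= m)%N & forall k, (k < n)%N -> c m k = c' k.
Proof.
have [U [UU Uoo]] := ultraFilterLemma eventually_filter.
pose c' k := `[< U [set m | c m k] >].
have Uc k : U [set m | c m k = c' k].
  rewrite /c'; have [Uk|nUk] := pselect (U [set m | c m k]).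
    by rewrite asboolT.
  rewrite asboolF//; have [//|] := in_ultra_setVsetC [set m | c m k] UU.
  by apply: filterS => m /= /negP/negbTE.
exists c' => n; have : U [set m | forall k, (k < n)%N -> c m k = c' k].
  elim: n => [|n IH]; first exact: filterS filterT.
  apply: filterS2 IH (Uc n) => m mn /= cmn k.
  by rewrite ltnS leq_eqVlt => /orP[/eqP->//|]; exact: mn.
move=> Un; have /filter_ex[m [mn nm]] : U ([set m | forall k, (k < n)%N ->
    c m k = c' k] `&` [set m | (n <= m)%N]).
  by apply: filterI => //; apply: Uoo; exists n.
by exists m.
Qed.

Lemma code_closed_bigcap A (I : Type) (D : set I) (F : I -> set T) :
  (forall i, D i -> code_closed A (F i)) -> code_closed A (\bigcap_(i in D) F i).
Proof.
move=> cF x Hx i Di; apply: cF => // n.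
by have [y Fy xy] := Hx n; exists y => //; exact: Fy.
Qed.

Lemma code_closedU A F1 F2 : code_closed A F1 -> code_closed A F2 ->
  code_closed A (F1 `|` F2).
Proof.
move=> c1 c2 x Hx; apply: contrapT => /not_orP[n1 n2].
have /existsNP[m1 m1P] := contra_not (c1 x) n1.
have /existsNP[m2 m2P] := contra_not (c2 x) n2.
have [y [F1y|F2y] xy] := Hx (maxn m1 m2).
- by apply: m1P; exists y => // k km; apply: xy; rewrite leq_max km.
- by apply: m2P; exists y => // k km; apply: xy; rewrite leq_max km orbT.
Qed.

Lemma code_closed0 A : code_closed A set0.
Proof. by move=> x /(_ 0%N)[]. Qed.

Lemma code_closed_bigcup A (F : nat -> set T) n : (forall i, code_closed A (F i)) ->
  code_closed A (\bigcup_(i < n) F i).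
Proof.
move=> cF; rewrite bigcup_mkord; elim: n => [|n IH].
  by rewrite big_ord0; exact: code_closed0.
by rewrite big_ord_recr /=; apply: code_closedU.
Qed.

End code.

Section measurable_code.
Context d (T : measurableType d).

Lemma measurable_mkseq_code (B : nat -> set T) (mB : forall k, measurable (B k))
    n (Q : seq bool -> Prop) :
  measurable [set x | Q (mkseq (code B x) n)].
Proof.
elim: n B mB Q => [|n IH] B mB Q.
  have [Q0|Q0] := pselect (Q [::]).
    by rewrite (_ : mkset _ = setT)//; apply/seteqP; split.
  by rewrite (_ : mkset _ = set0)//; apply/seteqP; split.
have iotaS m : iota 1 m = map S (iota 0 m) by rewrite -[1%N]addn0 iotaDl.
rewrite (_ : mkset _ =
  (B 0%N `&` [set x | Q (true :: mkseq (code (B \o S) x) n)]) `|`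
  (~` B 0%N `&` [set x | Q (false :: mkseq (code (B \o S) x) n)])).
  have mb b := IH (B \o S) (fun k => mB k.+1) (fun s => Q (b :: s)).
  have mB0 := mB 0%N; apply: measurableU; apply: measurableI; mset.
  - exact: (mb true).
  - exact: (mb false).
apply/seteqP; split => x; rewrite /mkset /mkseq /= iotaS -map_comp.
- have [Bx|nBx] := pselect (B 0%N x).
    by rewrite {1}/code asboolT// => ?; left.
  by rewrite {1}/code asboolF// => ?; right.
- by move=> [] []; rewrite {2}/code => Bx; [rewrite asboolT|rewrite asboolF].
Qed.

End measurable_code.

Section coding.
Context (R : realType) d (T : measurableType d) (mu : probability T R).

(** The topology in which every G k is clopen serves as a Polish topology: it
    generates the sigma-algebra, separates points, and makes mu tight. *)
Record tight_coding (G : nat -> set T) : Prop := TightCoding {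
  coding_meas : forall k, measurable (G k);
  coding_gen : forall A : set T, measurable A -> <<s range G>> A;
  coding_inj : forall x y, code G x = code G y -> x = y;
  coding_tight : forall e : R, 0 < e -> exists K : set T,
    [/\ measurable K, code_compact G K & 1 - e < pr mu K] }.

Variable G : nat -> set T.
Hypothesis tG : tight_coding G.

(** Inner regularity of A and of its complement at the same time, so that the
    property passes to complements. *)
Definition code_regular A := forall e : R, 0 < e -> exists F F' : set T,
  [/\ measurable F /\ measurable F', code_closed G F /\ code_closed G F',
      F `<=` A, F' `<=` ~` A & pr mu (~` (F `|` F')) < e].

(** The sets G k are clopen, and regularity passes to countable unions: finitely
    many of the closed sets approximating the terms from inside nearly exhaust
    the union, and the closed sets approximating their complements may be
    intersected without loss of closedness. *)
Lemma code_regularP A : measurable A -> code_regular A.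
Proof.
move=> mA; apply: (sigma_ind _ _ _ _ (coding_gen tG mA)).
- move=> e e0; exists set0, setT; split => //.
  + by split=> //; exact: code_closed0.
  + by move=> x _ [].
  + by rewrite set0U setCT pr0.
- move=> {mA}A + e e0 => /(_ e e0)[F [F' [[mF mF'] [cF cF'] FA F'A small]]].
  by exists F', F; split => //; rewrite ?setCK// setUC.
- move=> {mA}A rA e e0.
  have e2 n : 0 < e / 2 / (2 ^ n.+2)%:R by rewrite !divr_gt0// ltr0n expn_gt0.
  have := fun n => rA n _ (e2 n).
  move=> /choice[F] /choice[F'] FF'.
  have mF n : measurable (F n) by have [[]] := FF' n.
  have mF' n : measurable (F' n) by have [[]] := FF' n.
  have [N HN] := pr_bigcup_approx mu mF (divr_gt0 e0 (ltr0n _ 2)).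
  have mU : measurable (\bigcup_(k < N) F k) by exact: bigcup_measurable.
  have mI : measurable (\bigcap_n F' n) by exact: bigcapT_measurable.
  have mUT : measurable (\bigcup_n F n) by exact: bigcupT_measurable.
  have mN n : measurable (~` (F n `|` F' n)) by mset.
  have mNT : measurable (\bigcup_n ~` (F n `|` F' n)) by exact: bigcupT_measurable.
  (* The errors of the terms sum to at most e / 2; the other half of e pays for
     the truncation at N. *)
  exists (\bigcup_(k < N) F k), (\bigcap_n F' n); split => //.
  + split; first by apply: code_closed_bigcup => i; have [_ []] := FF' i.
    by apply: code_closed_bigcap => i _; have [_ []] := FF' i.
  + by move=> x [k _ Fx]; exists k => //; have [_ _ + _ _] := FF' k; exact.
  + by move=> x F'x [k _ Ax]; have [_ _ _ + _] := FF' k => /(_ x (F'x k I)).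
  have sub : ~` (\bigcup_(k < N) F k `|` \bigcap_n F' n) `<=`
      (\bigcup_n F n `\` \bigcup_(k < N) F k) `|` \bigcup_n ~` (F n `|` F' n).
    move=> x /not_orP[nF /existsNP[n /not_implyP[_ nF']]].
    by have [Fx|nFx] := pselect (F n x); [left; split=> //; exists n|
      right; exists n => // -[]].
  apply: le_lt_trans (le_pr _ _ _ sub) _; [mset|mset|].
  apply: le_lt_trans (prU_le _ _ _) _; [mset|mset|].
  have UN : \bigcup_(k < N) F k `<=` \bigcup_n F n.
    by move=> x [k _ Fk]; exists k.
  rewrite [ltRHS](splitr e); apply: ltr_leD; first by rewrite prD// ltrBlDl.
  apply: pr_bigcup_le => // n; have [_ _ _ _ /ltW small] := FF' n.
  apply: (le_trans small); rewrite ler_pM2l ?divr_gt0// lef_pV2 ?posrE ?ltr0n ?expn_gt0//.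
  by rewrite ler_nat leq_exp2l.
- move=> _ [k _ <-] e e0; exists (G k), (~` G k); split => //.
  + by split; [exact: coding_meas|apply: measurableC; exact: coding_meas].
  + split=> x /(_ k.+1)[y Gy yx].
      exact: (eq_code (yx k (ltnSn k))).1 Gy.
    by move=> Gx; apply: Gy; exact: (eq_code (yx k (ltnSn k))).2 Gx.
  + by rewrite setUCr setCT pr0.
Qed.

(** Lusin's theorem. Up to a small set, each A k agrees with a set that is closed
    with closed complement relative to a G-closed set L, so the A-code is a
    continuous function of the G-code on a compact set, and its range is
    compact. *)
Theorem code_lusin (A : nat -> set T) (e : R) : (forall k, measurable (A k)) ->
  0 < e -> exists K, [/\ measurable K, code_compact A K & 1 - e < pr mu K].
Proof.
move=> mA e0; have e20 : 0 < e / 2 by rewrite divr_gt0.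
have [K0 [mK0 cK0 K0e]] := coding_tight tG e20.
have e2 n : 0 < e / 2 / (2 ^ n.+1)%:R by rewrite !divr_gt0// ltr0n expn_gt0.
have := fun n => code_regularP (mA n) (e2 n).
move=> /choice[F] /choice[F'] FF'.
have mF n : measurable (F n) by have [[]] := FF' n.
have mF' n : measurable (F' n) by have [[]] := FF' n.
pose L := \bigcap_n (F n `|` F' n).
have mL : measurable L by apply: bigcapT_measurable => n; mset.
have cL : code_closed G L.
  by apply: code_closed_bigcap => n _; apply: code_closedU; have [_ []] := FF' n.
exists (K0 `&` L); split; first by mset.
- move=> c cK; have {cK} : forall n, exists x, (K0 `&` L) x /\
      forall k, (k < n)%N -> code A x k = c k.
    by move=> n; have [x ? ?] := cK n; exists x.
  move=> /choice[x xP]; have Kx n := (xP n).1; have xc n := (xP n).2.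
  have [c' c'P] := cluster_code (fun n => code G (x n)).
  have /cK0[z Kz zc'] : forall n, exists2 x, K0 x & forall k, (k < n)%N ->
      code G x k = c' k.
    by move=> n; have [m _ xm] := c'P n; exists (x m) => //; have [] := Kx m.
  have close H : code_closed G H -> (exists n, forall m, (n <= m)%N -> H (x m)) ->
      H z.
    move=> cH [n nH]; apply: cH => l; have [m lm xm] := c'P (maxn n l).
    exists (x m); first by apply: nH; exact: leq_trans (leq_maxl _ _) lm.
    by move=> k kl; rewrite zc' xm// leq_max kl orbT.
  have Lz : L z by apply: close => //; exists 0%N => m _; have [] := Kx m.
  exists z => //; apply/funext => k; have [_ [cF cF'] FA F'A _] := FF' k.
  have [Fz|F'z] := Lz k I.
  + rewrite /code asboolT; last exact: FA.
    apply/esym; apply/negPn/negP => /negbTE ck.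
    have /F'A : F' k z.
      apply: close => //; exists k.+1 => m km.
      have [_ /(_ k I)[/FA/codeP|//]] := Kx m.
      by rewrite xc// ck.
    by apply; exact: FA.
  + rewrite /code asboolF; last exact: F'A.
    apply/esym; apply/negP => ck; apply: (F'A _ F'z); apply: FA.
    apply: close => //; exists k.+1 => m km.
    have [_ /(_ k I)[//|/F'A nA]] := Kx m.
    by exfalso; apply: nA; apply/codeP; rewrite xc.
- have -> : K0 `&` L = K0 `\` (~` L) by rewrite setDE setCK.
  have := pr_le_D mu mK0 (measurableC mL).
  suff : pr mu (~` L) <= e / 2 by lra.
  rewrite setC_bigcap; apply: pr_bigcup_le => n; first by mset.
  by have [_ _ _ _ /ltW] := FF' n.
Qed.

(** The Boolean algebra generated by a separating sequence is dense in the measure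
    algebra. On a set that is compact for A and all the B k together, x -> code B x
    is an injection of a compact space, so the relatively clopen set A is the
    preimage of a clopen set of codes, which involves finitely many coordinates. *)
Lemma code_approx (B : nat -> set T) (A : set T) (e : R) :
  (forall k, measurable (B k)) -> (forall x y, code B x = code B y -> x = y) ->
  measurable A -> 0 < e ->
  exists n (L : seq (seq bool)), md mu A [set x | mkseq (code B x) n \in L] < e.
Proof.
move=> mB iB mA e0.
pose E k := if k is k'.+1 then B k' else A.
have mE k : measurable (E k) by case: k.
have [K [mK cK Ke]] := code_lusin mE e0.
have [n nP] : exists n, forall x y, K x -> K y ->
    (forall k, (k < n)%N -> code B x k = code B y k) -> A x -> A y.
  apply: contrapT => /forallNP bad.
  have {bad} : forall n, exists xy : T * T, [/\ K xy.1, K xy.2,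
      (forall k, (k < n)%N -> code B xy.1 k = code B xy.2 k), A xy.1 & ~ A xy.2].
    move=> n; have := bad n; apply: contra_notP => /forallNP H x y Kx Ky xy Ax.
    by apply: contrapT => nAy; apply: (H (x, y)).
  move=> /choice[xy xyP].
  have [c cP] := cluster_code (fun n => code B (xy n).1).
  (* The limits of the pairs (x_n, y_n) have the same B-code, but the first lies in
     A and the second does not. *)
  have [x Kx xc] : exists2 x, K x & code E x = (fun k => if k is k'.+1 then c k' else true).
    apply: cK => n; have [m nm mc] := cP n; have [Kx _ _ Ax _] := xyP m.
    exists (xy m).1 => // -[_|k kn]; first by rewrite /code asboolT.
    by rewrite -mc// ltnW.
  have [y Ky yc] : exists2 x, K x & code E x = (fun k => if k is k'.+1 then c k' else false).
    apply: cK => n; have [m nm mc] := cP n; have [_ Ky xym _ nAy] := xyP m.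
    exists (xy m).2 => // -[_|k kn]; first by rewrite /code asboolF.
    by rewrite -mc ?(ltnW kn)// xym// (leq_trans (ltnW kn)).
  have exy : x = y.
    apply: iB; apply/funext => k.
    by have := congr1 (@^~ k.+1) xc; have := congr1 (@^~ k.+1) yc; rewrite /code /= => -> ->.
  by have := congr1 (@^~ 0%N) xc; rewrite exy yc.
pose P (s : seq bool) := exists x, [/\ K x, A x & mkseq (code B x) n = s].
pose L := map (@tval n bool) (seq.filter (fun t : n.-tuple bool => `[< P t >])
  (enum {: n.-tuple bool})).
exists n, L; set C := mkset _.
have mC : measurable C by exact: (@measurable_mkseq_code _ _ B mB n (fun s => s \in L)).
have mKC := measurableC mK.
suff sub : A `+` C `<=` ~` K.
  by apply: le_lt_trans (md_le mu mA mC mKC sub) _; rewrite prC//; lra.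
have CP x : C x <-> P (mkseq (code B x) n).
  split=> [/mapP[t]|Px]; first by rewrite mem_filter => /andP[/asboolP ? _] ->.
  apply/mapP; exists (tcast (size_mkseq _ _) (in_tuple (mkseq (code B x) n))).
    by rewrite mem_filter mem_enum andbT val_tcast; apply/asboolP.
  by rewrite val_tcast.
move=> x ACx Kx; rewrite setY_def in ACx; case: ACx => -[].
  by move=> Ax /CP; apply; exists x.
move=> /CP[y [Ky Ay yx]]; apply; apply: (nP y) => // k kn.
have := congr1 (fun s => nth false s k) yx.
by rewrite !nth_mkseq.
Qed.

End coding.

Lemma half_leq k : (k./2 <= k)%N.
Proof. by rewrite -{2}(odd_double_half k) -addnn addnA leq_addl. Qed.

Section mix.
Context (T : Type).
Implicit Types A B : nat -> set T.

(** Coding with mix E G puts two coding sequences on a par, so that one compact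
    set controls both. *)
Definition mix (X : Type) (A B : nat -> X) k := if odd k then B k./2 else A k./2.

Lemma code_mix A B x : code (mix A B) x = mix (code A x) (code B x).
Proof. by apply/funext => k; rewrite /code /mix; case: odd. Qed.

Lemma mix_inj (X : Type) (a b a' b' : nat -> X) :
  mix a b = mix a' b' -> a = a' /\ b = b'.
Proof.
move=> e; split; apply/funext => k.
  by have := congr1 (@^~ k.*2) e; rewrite /mix odd_double doubleK.
by have := congr1 (@^~ k.*2.+1) e; rewrite /mix /= odd_double /= uphalf_double.
Qed.

End mix.

Section least_point.
Context (R : realType) d (T : measurableType d) (mu : probability T R).
Variables (G E : nat -> set T).
Hypotheses (tG : tight_coding mu G) (mE : forall k, measurable (E k)).
Variable K : set T.
Hypotheses (mK : measurable K) (cK : code_compact (mix E G) K).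

Let ext (w : nat -> bool) (b : seq bool) :=
  exists y, [/\ K y, code E y = w & mkseq (code G y) (size b) = b].

(** By compactness, whether a finite G-prefix extends to a point with E-code w is
    decided by all finite prefixes of w; this makes it a measurable property of a
    point with E-code w. *)
Let extP w b : ext w b <-> forall n, exists y,
  [/\ K y, mkseq (code E y) n = mkseq w n & mkseq (code G y) (size b) = b].
Proof.
split=> [[y [Ky <- yb]] n|]; first by exists y.
move=> /choice[y yP].
have [c cP] := cluster_code (fun n => code G (y n)).
have [|z Kz] := cK (c := mix w c).
  move=> n; have [m nm mc] := cP n; have [Km mw _] := yP m; exists (y m) => // k kn.
  rewrite code_mix /mix; have k2 : (k./2 < n)%N by exact: leq_ltn_trans (half_leq k) kn.
  case: odd; first exact: mc.
  have := congr1 (fun s => nth false s k./2) mw.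
  by rewrite !nth_mkseq// (leq_trans k2).
rewrite code_mix => /mix_inj[zw zc]; exists z; split => //.
have [m bm mc] := cP (size b); have [_ _ <-] := yP m.
rewrite size_mkseq; apply: (@eq_from_nth _ false); rewrite !size_mkseq// => i ib.
by rewrite !nth_mkseq// zc mc.
Qed.

(** The prefixes of the lexicographically first G-code of a point of K with E-code
    w, where true comes before false. *)
Fixpoint least_prefix (w : nat -> bool) n : seq bool :=
  if n is n'.+1 then
    rcons (least_prefix w n') `[< ext w (rcons (least_prefix w n') true) >]
  else [::].

Let size_prefix w n : size (least_prefix w n) = n.
Proof. by elim: n => //= n IH; rewrite size_rcons IH. Qed.

Let least_code w n := nth false (least_prefix w n.+1) n.

Let least_codeE w n : least_code w n = `[< ext w (rcons (least_prefix w n) true) >].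
Proof. by rewrite /least_code /= nth_rcons size_prefix ltnn eqxx. Qed.

Let mkseq_least w n : mkseq (least_code w) n = least_prefix w n.
Proof. by elim: n => // n IH; rewrite mkseqS IH least_codeE. Qed.

Let ext_least x n : K x -> ext (code E x) (least_prefix (code E x) n).
Proof.
move=> Kx; elim: n => [|n IH] /=; first by exists x.
case: asboolP => // nt; have [y [Ky yE yb]] := IH.
exists y; split => //; rewrite size_rcons mkseqS yb; congr rcons.
rewrite size_prefix; apply/negP => yn; apply: nt; exists y; split => //.
by rewrite size_rcons mkseqS yb size_prefix yn.
Qed.

Definition least_pt x : T := xget x [set y | K y /\ code (mix E G) y =
  mix (code E x) (least_code (code E x))].

Let least_ptP x : K x -> K (least_pt x) /\ code (mix E G) (least_pt x) =
  mix (code E x) (least_code (code E x)).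
Proof.
move=> Kx; rewrite /least_pt; case: xgetP => [y _ //|].
have [y [Ky yE yc]] : exists y, [/\ K y, code E y = code E x &
    code G y = least_code (code E x)].
  have /choice[y yP] := fun n => ext_least n Kx.
  have [|z Kz] := cK (c := mix (code E x) (least_code (code E x))).
    move=> n; have [Ky yE yG] := yP n; exists (y n) => // k kn.
    rewrite code_mix /mix; have k2 : (k./2 < n)%N by exact: leq_ltn_trans (half_leq k) kn.
    case: odd; last by rewrite yE.
    have := congr1 (fun s => nth false s k./2) yG.
    by rewrite -mkseq_least size_mkseq !nth_mkseq.
  by rewrite code_mix => /mix_inj[zE zG]; exists z.
by move=> /(_ y) []; rewrite /= code_mix yE yc.
Qed.

Lemma least_pt_mem x : K x -> K (least_pt x).
Proof. by move=> /least_ptP[]. Qed.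

Lemma least_pt_code x : K x -> code E (least_pt x) = code E x.
Proof. by move=> /least_ptP[_]; rewrite code_mix => /mix_inj[]. Qed.

Lemma least_pt_eq x y : K x -> K y -> code E x = code E y ->
  least_pt x = least_pt y.
Proof.
move=> /least_ptP[_]; rewrite code_mix => /mix_inj[_ xG].
move=> /least_ptP[_]; rewrite code_mix => /mix_inj[_ yG] xy.
by apply: (coding_inj tG); rewrite xG yG xy.
Qed.

Let measurable_ext b : measurable [set x | ext (code E x) b].
Proof.
rewrite (_ : mkset _ = \bigcap_n [set x | exists y,
  [/\ K y, mkseq (code E y) n = mkseq (code E x) n &
      mkseq (code G y) (size b) = b]]); last first.
  apply/seteqP; split=> x /=; first by move=> /extP xb n _; exact: xb.
  by move=> xb; apply/extP => n; exact: xb.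
apply: bigcapT_measurable => n.
exact: (@measurable_mkseq_code _ _ E mE n (fun s => exists y,
  [/\ K y, mkseq (code E y) n = s & mkseq (code G y) (size b) = b])).
Qed.

Let measurable_prefix n b : measurable [set x | least_prefix (code E x) n = b].
Proof.
elim: n b => [|n IH] b /=.
  case: b => [|a b]; first by rewrite (_ : mkset _ = setT)//; apply/seteqP; split.
  by rewrite (_ : mkset _ = set0)//; apply/seteqP; split.
case/lastP: b => [|b t].
  rewrite (_ : mkset _ = set0)//; apply/seteqP; split => x //=.
  by case: least_prefix.
rewrite (_ : mkset _ = [set x | least_prefix (code E x) n = b] `&`
  (if t then [set x | ext (code E x) (rcons b true)]
   else ~` [set x | ext (code E x) (rcons b true)])).
  by apply: measurableI => //; case: t; mset.
apply/seteqP; split=> x /=.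
  move=> /rcons_inj[xb]; rewrite xb => xt; split => //.
  by case: t xt => /asboolP.
move=> [xb]; rewrite xb; case: t => xt; first by rewrite asboolT.
by rewrite asboolF.
Qed.

Lemma measurable_least_pt A : measurable A -> measurable (K `&` least_pt @^-1` A).
Proof.
move=> mA; apply: (sigma_ind (K := fun A => measurable (K `&` least_pt @^-1` A))
  _ _ _ _ (coding_gen tG mA)).
- by rewrite preimage_set0 setI0.
- move=> {mA}A mA; rewrite (_ : _ `&` _ = K `\` (K `&` least_pt @^-1` A)); first by mset.
  by rewrite preimage_setC setDIr setDv set0U setDE.
- move=> F mF; rewrite preimage_bigcup setI_bigcupr.
  exact: bigcupT_measurable.
- move=> _ [k _ <-].
  rewrite (_ : _ `&` _ = K `&` \bigcup_(b in [set: seq bool])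
     ([set x | least_prefix (code E x) k = b] `&`
      [set x | ext (code E x) (rcons b true)])).
    apply: measurableI => //; apply: measurable_bigcup_countType => b.
    exact: measurableI.
  apply/seteqP; split=> x [Kx]; have [_] := least_ptP Kx;
    rewrite code_mix => /mix_inj[_] /(congr1 (@^~ k)); rewrite least_codeE => e.
    move=> /codeP; rewrite e => /asboolP xt; split => //.
    by exists (least_prefix (code E x) k).
  by move=> [b _ [/= xb xt]]; split => //; apply/codeP; rewrite e xb; apply/asboolP.
Qed.

End least_point.

(** A measurable selector for the relation of having the same E-code, defined off a
    set of small measure: on a set that is compact for the E- and G-codes
    jointly, each class contains a lexicographically first G-code, and its
    coordinates depend measurably on the E-code. *)
Theorem code_section (R : realType) d (T : measurableType d)
    (mu : probability T R) (G E : nat -> set T) (e : R) :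
  tight_coding mu G -> (forall k, measurable (E k)) -> 0 < e ->
  exists (K : set T) (s : T -> T), [/\ measurable K, 1 - e < pr mu K,
    (forall x, K x -> K (s x) /\ code E (s x) = code E x),
    (forall x y, K x -> K y -> code E x = code E y -> s x = s y) &
    forall A, measurable A -> measurable (K `&` s @^-1` A)].
Proof.
move=> tG mE e0.
have mM k : measurable (mix E G k).
  by rewrite /mix; case: odd => //; exact: coding_meas tG _.
have [K [mK cK Ke]] := code_lusin tG mM e0.
exists K, (least_pt G E K); split => //.
- by move=> x Kx; split; [exact: least_pt_mem|exact: least_pt_code].
- by move=> x y; exact: (least_pt_eq tG).
- by move=> A; exact: (measurable_least_pt tG).
Qed.

(** * Standard Borel spaces and their countable powers are tightly coded *)

Section standard_coding.
Context (R : realType) d (T : measurableType d).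
Variables (P : completePseudoMetricType R) (f : T -> P).
Hypotheses (hP : hausdorff_space P) (sP : separable_space P) (bf : bijective f).
Hypothesis fP : forall A : set T, measurable A <-> <<s (@open P) >> (f @` A).

Let preimK B : f @` (f @^-1` B) = B.
Proof.
by case: bf => g gK fK; apply/seteqP; split=> [_ [x Bx <-]//|y By];
  exists (g y); rewrite /= ?fK.
Qed.

Let open_meas O : open O -> measurable (f @^-1` O).
Proof. by move=> oO; apply/fP; rewrite preimK; exact: sub_sigma_algebra. Qed.

Let closed_meas B : closed B -> measurable (f @^-1` B).
Proof.
move=> /closed_openC /open_meas /measurableC.
by rewrite -preimage_setC setCK.
Qed.

Let dense_seq : exists p : nat -> P, forall O : set P, open O -> O !=set0 ->
  exists i, O (p i).
Proof.
have [D cD dD] := sP.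
have [D0|[p]] := pfcard_geP cD.
  have [] := dD setT _ openT; first by exists (f point).
  by rewrite D0 => x [_ []].
exists p => O oO O0; have [x [Ox Dx]] := dD O O0 oO.
by have [i _ pi_] := 'surj_p Dx; exists i; rewrite pi_.
Qed.

Let p := sval (cid dense_seq).
Let pP O : open O -> O !=set0 -> exists i, O (p i).
Proof. exact: (svalP (cid dense_seq)). Qed.

Let nbhs_int (x : P) B : nbhs x B -> B° x.
Proof. by move=> /nbhs_interior /nbhs_singleton. Qed.

Let O (im : nat * nat) : set P := (ball (p im.1) (im.2.+1%:R^-1))°.

Let O_cover m x : exists i, O (i, m) x.
Proof.
pose r : R := m.+1%:R^-1; have r2 : 0 < r / 2 by rewrite divr_gt0 ?invr_gt0 ?ltr0n.
have [i /interior_subset ip] : exists i, (ball x (r / 2))° (p i).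
  apply: pP; first exact: open_interior.
  by exists x; apply: nbhs_int; exact: (nbhsx_ballx x _ r2).
exists i; apply: nbhs_int; apply: filterS (nbhsx_ballx x _ r2) => y xy /=.
rewrite -/r [r]splitr; apply: ball_triangle xy; exact: ball_sym.
Qed.

Let O_basis x B : open B -> B x -> exists im, O im x /\ O im `<=` B.
Proof.
move=> oB Bx; have /nbhs_ballP[e /= e0 eB] : nbhs x B by exact: open_nbhs_nbhs.
have [m me] := ltr_add_invr (divr_gt0 e0 (ltr0n _ 2)); rewrite add0r in me.
have [i Oi] := O_cover m x; exists (i, m); split=> // y /interior_subset /= py.
apply: eB; have := ball_triangle (ball_sym (interior_subset Oi)) py.
by apply: le_ball; rewrite (splitr e) lerD// ltW.
Qed.

(** Closed sets that exhaust the open set B from inside. *)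
Let C (l : nat) (B : set P) := closure [set x | ball x (l.+1%:R^-1) `<=` B].

Let C_sub l B : C l B `<=` B.
Proof.
move=> x Cx; have r0 : (0 : R) < l.+1%:R^-1 by rewrite invr_gt0 ltr0n.
have [y [yB xy]] := Cx _ (nbhsx_ballx x _ r0).
by apply: yB; exact: ball_sym.
Qed.

Let C_cover B : open B -> \bigcup_l C l B = B.
Proof.
move=> oB; apply/seteqP; split=> [x [l _ /C_sub]//|x Bx].
have /nbhs_ballP[e /= e0 eB] : nbhs x B by exact: open_nbhs_nbhs.
have [m me] := ltr_add_invr e0; rewrite add0r in me.
by exists m => //; apply: subset_closure => y /= xy; apply: eB; exact: le_ball (ltW me) _ _.
Qed.

Let C_nd B : nondecreasing_seq (fun l => C l B).
Proof.
move=> l m lm; apply/subsetPset; apply: closure_subset => x /= xB y xy; apply: xB.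
by apply: le_ball xy; rewrite lef_pV2 ?posrE ?ltr0n// ler_nat.
Qed.

Let G k : set T := if unpickle k is Some im then f @^-1` O im else set0.

Let GE im : G (pickle im) = f @^-1` O im.
Proof. by rewrite /G pickleK. Qed.

Let mG k : measurable (G k).
Proof.
by rewrite /G; case: unpickle => // im; apply: open_meas; exact: open_interior.
Qed.

(** Ulam's argument: a totally bounded set is cut out by finitely many balls of
    each radius. On it, every G j is moreover required to agree with a closed set
    H j, so that membership in G j, and not only nonmembership, passes to
    limits; a limit of points with converging codes then has the limit code. *)
Let tightG (mu : probability T R) e : 0 < e -> exists K : set T,
    [/\ measurable K, code_compact G K & 1 - e < pr mu K].
Proof.
move=> e0; have e3 : 0 < e / 3 by rewrite divr_gt0.
have e2 n : 0 < e / 3 / (2 ^ n.+1)%:R by rewrite !divr_gt0// ltr0n expn_gt0.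
have coverT m : \bigcup_i f @^-1` O (i, m) = setT.
  by apply/seteqP; split=> x // _; have [i Oi] := O_cover m (f x); exists i.
have mO im : measurable (f @^-1` O im) by apply: open_meas; exact: open_interior.
have mC l B : measurable (f @^-1` C l B) by apply: closed_meas; exact: closed_closure.
have /choice[J JP] m : exists J, 1 - e / 3 / (2 ^ m.+1)%:R <
    pr mu (\bigcup_(i < J) f @^-1` O (i, m)).
  have [J] := pr_bigcup_approx mu (fun i => mO (i, m)) (e2 m).
  by rewrite coverT prT => JP; exists J; lra.
have /choice[l lP] j : exists l, pr mu (G j) - e / 3 / (2 ^ j.+1)%:R <
    pr mu (if unpickle j is Some im then f @^-1` (C l (O im)) else set0).
  rewrite /G; case: unpickle => [im|]; last by exists 0%N; rewrite pr0; have := e2 j; lra.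
  have [||l] := @pr_nd_approx _ _ _ mu (fun l => f @^-1` C l (O im)) _ _ _ (e2 j).
  - by move=> l; exact: mC.
  - move=> l m lm; apply/subsetPset => x /=; exact: (subsetPset _ _ (C_nd (O im) lm)).
  by rewrite -preimage_bigcup C_cover; [exists l; lra|exact: open_interior].
pose H j := if unpickle j is Some im then f @^-1` (C (l j) (O im)) else set0.
have mH j : measurable (H j) by rewrite /H; case: unpickle.
have HG j : H j `<=` G j.
  by rewrite /H /G; case: unpickle => // im x; exact: C_sub.
pose U m := \bigcup_(i < J m) f @^-1` O (i, m).
have mU m : measurable (U m) by exact: bigcup_measurable.
have mHG j : measurable (H j `|` ~` G j) by mset.
exists ((\bigcap_m U m) `&` \bigcap_j (H j `|` ~` G j)); split.
- by apply: measurableI; exact: bigcapT_measurable.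
- move=> c cK; have {cK} : forall n, exists x,
    ((\bigcap_m U m) `&` \bigcap_j (H j `|` ~` G j)) x /\
      forall k, (k < n)%N -> code G x k = c k.
    by move=> n; have [x ? ?] := cK n; exists x.
  move=> /choice[x xP].
  have Ux n m : U m (x n) by have [[/(_ m I)]] := xP n.
  have Hx n j : (H j `|` ~` G j) (x n) by have [[_ /(_ j I)]] := xP n.
  have xc n k : (k < n)%N -> code G (x n) k = c k by have [_] := xP n; exact.
  have c_ball m : exists2 i, (i < J m)%N & c (pickle (i, m)).
    pose N := (\max_(i < J m) pickle (val i, m)).+1.
    have [i iJ Oi] := Ux N m; exists i => //; rewrite -(xc N).
      by apply/codeP; rewrite GE.
    by rewrite ltnS; apply: (leq_bigmax (Ordinal iJ)).
  have cG n k : (k < n)%N -> c k -> G k (x n) by move=> kn ck; apply/codeP; rewrite xc.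
  have cGn n k : (k < n)%N -> ~~ c k -> ~ G k (x n).
    by move=> kn ck; apply/codeP; rewrite xc.
  have : cauchy (f (x n) @[n --> \oo]).
    apply: cauchy_exP => r /= r0; have [m mr] := ltr_add_invr r0; rewrite add0r in mr.
    have [i _ ci] := c_ball m; exists (p i); exists (pickle (i, m)).+1 => // n /= mn.
    have := cG _ _ mn ci; rewrite GE => /interior_subset /=.
    by move=> Ob; exact: (le_ball (ltW mr) Ob).
  move=> /cauchy_cvg /cvg_ex[z fz].
  have [x0 x0z] : exists x0, f x0 = z by case: bf => g gK fK; exists (g z).
  have Hx0 j : c j -> H j x0.
    move=> cj; have : forall n, (j < n)%N -> H j (x n).
      by move=> n jn; have [//|] := Hx n j; have := cG n j jn cj.
    rewrite /H; case: unpickle => [im|/(_ j.+1 (leqnn _))//] HC.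
    rewrite /= x0z; apply: (closed_cvg _ _ _ _ fz); first exact: closed_closure.
    by exists j.+1 => // n /= jn; exact: HC.
  have x0c : code G x0 = c.
    apply/funext => k; rewrite /code; case: (boolP (c k)) => ck.
      exact/asboolT/HG/Hx0.
    apply: asboolF; have := fun n kn => cGn n k kn ck.
    rewrite /G; case: unpickle => [im nG|_ []] /=; rewrite x0z.
    apply: (closed_cvg (fun y => ~ O im y) _ _ _ fz).
      by apply: open_closedC; exact: open_interior.
    by exists k.+1 => // n /= kn; exact: nG.
  exists x0 => //; split.
    move=> m _; have [i iJ ci] := c_ball m; exists i => //.
    by rewrite -GE; apply/codeP; rewrite x0c.
  move=> j _; case: (boolP (c j)) => cj; first by left; exact: Hx0.
  by right => Gx; move: cj; rewrite -x0c => /codeP.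
- set A := \bigcap_m U m; set B := \bigcap_j _.
  have mA : measurable A by exact: bigcapT_measurable.
  have mB : measurable B by exact: bigcapT_measurable.
  have AB : A `&` B = ~` (~` A `|` ~` B) by rewrite setCU !setCK.
  rewrite AB prC; last by mset.
  have := prU_le mu (measurableC mA) (measurableC mB).
  suff [] : pr mu (~` A) <= e / 3 /\ pr mu (~` B) <= e / 3 by lra.
  split; rewrite /A /B setC_bigcap; apply: pr_bigcup_le => n; try by mset.
    by rewrite prC//; have := JP n; rewrite -/(U n); lra.
  have -> : ~` (H n `|` ~` G n) = G n `\` H n by rewrite setCU setCK setIC setDE.
  by rewrite prD//; have := lP n; rewrite -/(H n); lra.
Qed.

Lemma standard_coding_of :
  exists G : nat -> set T, forall mu : probability T R, tight_coding mu G.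
Proof.
exists G => mu; split; [exact: mG| | |exact: tightG].
- move=> A /fP mA; have <- : f @^-1` (f @` A) = A.
    case: bf => g gK fK; apply/seteqP; split=> [x [y Ay fyx]|x Ax].
      by rewrite -(gK x) -fyx gK.
    by exists x.
  apply: (sigma_ind (K := fun B => <<s range G>> (f @^-1` B))) mA.
  + by rewrite preimage_set0; exact: sigma_algebra0.
  + by move=> B; rewrite preimage_setC -setTD; exact: sigma_algebraCD.
  + by move=> F HF; rewrite preimage_bigcup; exact: sigma_algebra_bigcup.
  + move=> B oB; rewrite (_ : _ @^-1` _ =
       \bigcup_k (if `[< G k `<=` f @^-1` B >] then G k else set0)).
      apply: sigma_algebra_bigcup => k; case: asboolP => _.
        by apply: sub_sigma_algebra; exists k.
      exact: sigma_algebra0.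
    apply/seteqP; split=> [x /= Bx|x [k _]]; last by case: asboolP => // + Gx; exact.
    have [im [Ox OB]] := O_basis oB Bx; exists (pickle im) => //.
    by rewrite asboolT GE// => y Oy; exact: OB.
- move=> x y xy; case: bf => g gK fK; rewrite -(gK x) -(gK y); congr g.
  apply: contrapT => nxy.
  have cy : closed [set f y] by exact/accessible_closed_set1/hausdorff_accessible.
  have [im [Ox OB]] := O_basis (closed_openC cy) nxy.
  have Gx : G (pickle im) x by rewrite GE.
  have := (eq_code (congr1 (@^~ (pickle im)) xy)).1 Gx.
  by rewrite GE => /OB; apply.
Qed.

End standard_coding.

(** The sequence of basic open sets codes the space for all probabilities at once;
    only the compact sets depend on the probability. *)
Lemma standard_coding (R : realType) d (T : measurableType d) :
  standard_borel R T ->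
  exists G : nat -> set T, forall mu : probability T R, tight_coding mu G.
Proof. by move=> [P [f [hP sP bf fP]]]; exact: standard_coding_of fP. Qed.

Section product_coding.
Context (R : realType) d (X : measurableType d) (mu : probability X R)
  (muN : probability (seq_space X) R).
Hypothesis muN_prod : is_product_measure mu muN.

Lemma measurable_coord n (A : set X) : measurable A ->
  measurable [set x : seq_space X | A (x n)].
Proof. by move=> mA; apply: sub_sigma_algebra; exists n, A. Qed.

Lemma measurable_rect n (A : nat -> set X) : (forall i, measurable (A i)) ->
  measurable [set x : seq_space X | forall i, (i < n)%N -> A i (x i)].
Proof.
move=> mA; rewrite (_ : mkset _ = \bigcap_(i < n) [set x : seq_space X | A i (x i)]).
  by apply: bigcap_measurableType => // i _; exact: measurable_coord.
by apply/seteqP; split.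
Qed.

Lemma pr_coord n (A : set X) : measurable A ->
  pr muN [set x : seq_space X | A (x n)] = pr mu A.
Proof.
move=> mA; pose B i := if i == n then A else setT.
have := @muN_prod n.+1 B; rewrite /pr => H; congr fine.
rewrite (_ : mkset _ = [set x : seq_space X | forall i, (i < n.+1)%N -> B i (x i)]).
  rewrite H; last by move=> i; rewrite /B; case: eqP.
  rewrite big_ord_recr /= big1 ?mul1e ?/B ?eqxx// => i _.
  by rewrite ltn_eqF//; exact: probability_setT.
apply/seteqP; split=> x /=; last by move=> /(_ n (ltnSn n)); rewrite /B eqxx.
by move=> Ax i _; rewrite /B; case: eqP => // ->.
Qed.

(** A product of code-compact sets is code-compact, and the n-th factor may be
    chosen to lose at most the fraction 2^-(n+2) of the allowed measure. *)
Lemma product_coding (G : nat -> set X) : tight_coding mu G ->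
  exists GN : nat -> set (seq_space X), tight_coding muN GN.
Proof.
move=> tG.
pose GN j : set (seq_space X) :=
  if unpickle j is Some nk then [set x | G nk.2 (x nk.1)] else set0.
have GNE nk : GN (pickle nk) = [set x | G nk.2 (x nk.1)] by rewrite /GN pickleK.
have codeGN (x : seq_space X) n k : code GN x (pickle (n, k)) = code G (x n) k.
  by rewrite /code GNE.
have mG := coding_meas tG.
have mGN k : measurable (GN k).
  by rewrite /GN; case: unpickle => // nk; exact: measurable_coord.
exists GN; split => //.
- move=> A; apply: (sigma_ind (K := <<s range GN>>)).
  + exact: sigma_algebra0.
  + by move=> B; rewrite -setTD; exact: sigma_algebraCD.
  + by move=> F; exact: sigma_algebra_bigcup.
  + move=> _ [n [B [mB ->]]].
    apply: (sigma_ind (K := fun B => <<s range GN>> [set x | B (x n)]) _ _ _ _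
      (coding_gen tG mB)).
    * exact: sigma_algebra0.
    * move=> {mB}B HB; rewrite (_ : mkset _ = setT `\` [set x | B (x n)]).
        exact: sigma_algebraCD.
      by rewrite setTD.
    * move=> F HF; rewrite (_ : mkset _ = \bigcup_k [set x | F k (x n)]).
        exact: sigma_algebra_bigcup.
      by apply/seteqP; split.
    * move=> _ [k _ <-]; apply: sub_sigma_algebra; exists (pickle (n, k)) => //.
- move=> x y xy; apply/funext => n; apply: (coding_inj tG); apply/funext => k.
  by rewrite -!codeGN xy.
- move=> e e0.
  have e2 n : 0 < e / 2 / (2 ^ n.+1)%:R by rewrite !divr_gt0// ltr0n expn_gt0.
  have /choice[K KP] n := coding_tight tG (e2 n).
  have mK n : measurable (K n) by have [] := KP n.
  have cK n : code_compact G (K n) by have [] := KP n.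
  exists (\bigcap_n [set x : seq_space X | K n (x n)]); split.
  + by apply: bigcapT_measurable => n; exact: measurable_coord.
  + move=> c Hc.
    have /choice[y yP] n : exists y, K n y /\ forall k, code G y k = c (pickle (n, k)).
      have [N|y Ky yc] := cK n (fun k => c (pickle (n, k))).
        have [x Kx xc] := Hc (\max_(k < N) pickle (n, val k)).+1.
        exists (x n); first exact: Kx.
        move=> k kN; rewrite -xc; last first.
          by rewrite ltnS; apply: (leq_bigmax (Ordinal kN)).
        by rewrite codeGN.
      by exists y; rewrite yc.
    exists y; first by move=> n _; have [] := yP n.
    apply/funext => j.
    case Ej : (unpickle j : option (nat * nat)) => [[n k]|].
      have [x Kx xc] := Hc (maxn j (pickle (n, k))).+1.
      have jE z : code GN z j = code GN z (pickle (n, k)).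
        by rewrite /code GNE /GN Ej.
      rewrite jE codeGN (yP n).2 -xc; last by rewrite ltnS leq_maxr.
      by rewrite -jE xc// ltnS leq_maxl.
    by have [x Kx xc] := Hc j.+1; rewrite -xc// /code /GN Ej.
  + have mc n : measurable [set x : seq_space X | K n (x n)] by exact: measurable_coord.
    rewrite -[X in pr _ X]setCK prC; last first.
      by apply: measurableC; exact: bigcapT_measurable.
    suff : pr muN (~` (\bigcap_n [set x : seq_space X | K n (x n)])) <= e / 2 by lra.
    rewrite setC_bigcap; apply: pr_bigcup_le => n; first exact: measurableC.
    rewrite prC// (pr_coord n (mK n)); have [_ _] := KP n; lra.
Qed.

End product_coding.

(** * Baire category and the Borel complexity of category quantifiers *)

Section category.
Context (T : topologicalType).
Implicit Types A B C D M O V W : set T.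

Definition meager M := exists2 Q : nat -> set T,
  (forall n, open (Q n) /\ dense (Q n)) & M `<=` \bigcup_n ~` Q n.

Lemma meager_sub A B : A `<=` B -> meager B -> meager A.
Proof. by move=> AB [Q QP BQ]; exists Q => //; exact: subset_trans BQ. Qed.

Lemma meager0 : meager set0.
Proof. by exists (fun=> setT) => // n; split; [exact: openT|move=> B B0 _; rewrite setIT]. Qed.

Lemma meager_bigcup (I : countType) (F : I -> set T) :
  (forall i, meager (F i)) -> meager (\bigcup_i F i).
Proof.
move=> mF; have /choice[Q QP] i : exists Q : nat -> set T,
    (forall n, open (Q n) /\ dense (Q n)) /\ F i `<=` \bigcup_n ~` Q n.
  by have [Q ? ?] := mF i; exists Q.
exists (fun k => if unpickle k is Some p then Q p.1 p.2 else setT).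
  move=> k; case: unpickle => [[i n]|]; first exact: (QP i).1.
  by split; [exact: openT|move=> B B0 _; rewrite setIT].
move=> x [i _ Fx]; have [n _ nQ] := (QP i).2 x Fx.
by exists (pickle (i, n)) => //; rewrite pickleK.
Qed.

Lemma meagerU A B : meager A -> meager B -> meager (A `|` B).
Proof.
move=> mA mB; apply: (@meager_sub _ (\bigcup_(b in [set: bool]) if b then A else B)).
  by move=> x [Ax|Bx]; [exists true|exists false].
by apply: meager_bigcup => -[].
Qed.

Lemma meager_open_dense Q : open Q -> dense Q -> meager (~` Q).
Proof. by move=> oQ dQ; exists (fun=> Q) => // x; exists 0%N. Qed.

(** A local form of the Baire property: up to a meager set, membership is settled
    somewhere inside every open set. *)
Definition baire_decided D := forall W, open W -> W !=set0 -> exists V,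
  [/\ open V, V !=set0, V `<=` W & meager (V `&` D) \/ meager (V `&` ~` D)].

Lemma baire_decidedC D : baire_decided D -> baire_decided (~` D).
Proof.
move=> bD W oW W0; have [V [oV V0 VW VD]] := bD W oW W0.
by exists V; split => //; rewrite setCK; case: VD; [right|left].
Qed.

Lemma baire_decided_open D : open D -> baire_decided D.
Proof.
move=> oD W oW W0; have [[x [Wx Dx]]|/set0P/negP] := pselect (W `&` D !=set0).
  exists (W `&` D); split; [exact: openI|by exists x|exact: subIsetl|right].
  by rewrite -setIA setICr setI0; exact: meager0.
by rewrite negbK => /eqP WD; exists W; split => //; left; rewrite WD; exact: meager0.
Qed.

Context (J : countType) (U : J -> set T).
Definition countable_base := (forall j, open (U j)) /\
  forall x O, open O -> O x -> exists j, U j x /\ U j `<=` O.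
Hypothesis bU : countable_base.

Let oU j : open (U j). Proof. exact: bU.1. Qed.

(** The Banach category theorem. The basic open sets in which D is meager fill W up
    to a nowhere dense set, and there are countably many of them. *)
Lemma locally_meager W D : open W ->
  (forall V, open V -> V !=set0 -> V `<=` W -> exists V',
    [/\ open V', V' !=set0, V' `<=` V & meager (V' `&` D)]) ->
  meager (W `&` D).
Proof.
move=> oW loc.
pose Q := \bigcup_(j in [set j | meager (U j `&` D)]) U j `|` ~` closure W.
apply: (@meager_sub _ ((\bigcup_j (if `[< meager (U j `&` D) >] then U j `&` D else set0))
    `|` ~` Q)); last first.
  apply: meagerU.
    apply: meager_bigcup => j; case: asboolP => // _; exact: meager0.
  apply: meager_open_dense.
    apply: openU; first by apply: bigcup_open => j _.
    by apply: closed_openC; exact: closed_closure.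
  move=> V [x Vx] oV; have [[y [Vy Wy]]|nVW] := pselect (V `&` W !=set0).
    have [||V' [oV' [z V'z] V'VW mV']] := loc _ (openI oV oW).
    - by exists y.
    - exact: subIsetr.
    have [j [jz jV']] := bU.2 _ _ oV' V'z.
    exists z; split; first by have [] := V'VW _ V'z.
    left; exists j => //=; apply: meager_sub mV'; exact: setSI.
  exists x; split => //; right => cWx; apply: nVW.
  by have [y [Wy Vy]] := cWx V (open_nbhs_nbhs (conj oV Vx)); exists y.
move=> x [Wx Dx]; have [[[j mj jx]|nW]|nQx] := pselect (Q x).
- by left; exists j => //; rewrite asboolT.
- by exfalso; apply: nW; exact: subset_closure.
- by right.
Qed.

Lemma nonmeager_decided D W : baire_decided D -> open W -> ~ meager (W `&` D) ->
  exists j, [/\ U j !=set0, U j `<=` W & meager (U j `&` ~` D)].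
Proof.
move=> bD oW; apply: contra_notP => /forallNP nj; apply: locally_meager => // V oV V0 VW.
have [V' [oV' V'0 V'V [?|mV']]] := bD V oV V0; first by exists V'.
have [x V'x] := V'0; have [j [jx jV']] := bU.2 _ _ oV' V'x.
exfalso; apply: (nj j); split; first by exists x.
  by apply: subset_trans jV' _; exact: subset_trans VW.
by apply: meager_sub mV'; exact: setSI.
Qed.

Lemma nonmeager_base D W : open W -> ~ meager (W `&` D) ->
  exists j, U j `<=` W /\ ~ meager (U j `&` D).
Proof.
move=> oW; apply: contra_notP => /forallNP nj.
apply: (@meager_sub _ (\bigcup_j (if `[< U j `<=` W >] then U j `&` D else set0))).
  move=> x [Wx Dx]; have [j [jx jW]] := bU.2 _ _ oW Wx.
  by exists j => //; rewrite asboolT.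
apply: meager_bigcup => j; case: asboolP => [jW|_]; last exact: meager0.
by apply: contrapT => nm; apply: (nj j).
Qed.

Lemma baire_decided_bigcup (D : nat -> set T) : (forall n, baire_decided (D n)) ->
  baire_decided (\bigcup_n D n).
Proof.
move=> bD W oW W0.
have [mW|] := pselect (forall n, meager (W `&` D n)).
  exists W; split => //; left; rewrite setI_bigcupr; exact: meager_bigcup.
move=> /existsNP[n nm]; have [j [j0 jW mj]] := nonmeager_decided (bD n) oW nm.
exists (U j); split => //; right; apply: meager_sub mj => x [jx nD]; split => //.
by move=> Dx; apply: nD; exists n.
Qed.

Definition baire := forall W, open W -> W !=set0 -> ~ meager W.
Hypothesis bT : baire.

Lemma baire_nonmeager D W : open W -> W !=set0 -> meager (W `&` ~` D) ->
  ~ meager (W `&` D).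
Proof.
move=> oW W0 m1 m2; apply: (bT oW W0).
apply: meager_sub (meagerU m1 m2) => x Wx.
by have [Dx|nDx] := pselect (D x); [right|left].
Qed.

Section vaught.
Context d (X : measurableType d).
Implicit Types S : set (T * X).

(** The class of sets for which category quantification over the first variable
    yields measurable sets (Montgomery and Novikov). *)
Definition vaught S := (forall x, baire_decided [set t | S (t, x)]) /\
  forall j, measurable [set x | ~ meager (U j `&` [set t | S (t, x)])].

(** For a set that is decided, being nonmeager in U j means being comeager in some
    nonempty basic open subset of U j; a countable union over such subsets
    thus exchanges a set and its complement. *)
Lemma vaughtC S : vaught S -> vaught (~` S).
Proof.
move=> [bS mS]; split=> [x|j]; first exact: baire_decidedC (bS x).
have [j0|j0] := pselect (U j !=set0); last first.
  rewrite (_ : mkset _ = set0)//; apply/seteqP; split=> // x /=; apply.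
  suff -> : U j = set0 by rewrite set0I; exact: meager0.
  by apply/seteqP; split=> // y Uy; apply: j0; exists y.
rewrite (_ : mkset _ = ~` (\bigcap_k (if `[< U k !=set0 /\ U k `<=` U j >]
  then [set x | ~ meager (U k `&` [set t | S (t, x)])] else setT))).
  apply: measurableC.
  rewrite -[\bigcap_k _]setCK setC_bigcap; apply: measurableC.
  apply: measurable_bigcup_countType => k; apply: measurableC.
  by case: ifP => // _; exact: mS.
apply/seteqP; split=> x /=.
  move=> nm all; have [k [k0 kj mk]] := nonmeager_decided (baire_decidedC (bS x)) (oU j) nm.
  have := all k I; rewrite asboolT//=; apply.
  by apply: meager_sub mk => t [kt St]; split => // /=; apply.
move=> nall m; apply: nall => k _; case: asboolP => // -[k0 kj] /=.
by apply: baire_nonmeager => //; apply: meager_sub m; exact: setSI.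
Qed.

Lemma vaught_bigcup (S : nat -> set (T * X)) : (forall n, vaught (S n)) ->
  vaught (\bigcup_n S n).
Proof.
move=> vS; split=> [x|j].
  rewrite (_ : mkset _ = \bigcup_n [set t | S n (t, x)]); last first.
    by apply/seteqP; split=> t.
  by apply: baire_decided_bigcup => n; exact: (vS n).1.
rewrite (_ : mkset _ = \bigcup_n [set x | ~ meager (U j `&` [set t | S n (t, x)])]).
  by apply: bigcupT_measurable => n; exact: (vS n).2.
apply/seteqP; split=> x /=.
  apply: contra_notP => nm.
  apply: (@meager_sub _ (\bigcup_n (U j `&` [set t | S n (t, x)]))).
    by move=> t [jt [n _ St]]; exists n.
  apply: meager_bigcup => n; by apply: contrapT => nmn; apply: nm; exists n.
move=> [n _] nm; apply: contra_not nm; apply: meager_sub => t [jt St].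
by split => //; exists n.
Qed.

Lemma vaught0 : vaught set0.
Proof.
split=> [x|j].
  by apply: baire_decided_open; rewrite (_ : mkset _ = set0); [exact: open0|apply/seteqP; split].
rewrite (_ : mkset _ = set0)//; apply/seteqP; split=> x //=; apply.
by rewrite (_ : _ `&` _ = set0); [exact: meager0|apply/seteqP; split=> t // -[]].
Qed.

Lemma vaught_rect O (B : set X) : open O -> measurable B -> vaught (O `*` B).
Proof.
move=> oO mB; split=> [x|j].
  have [Bx|nB] := pselect (B x).
    rewrite (_ : mkset _ = O); first exact: baire_decided_open.
    by apply/seteqP; split=> t //= -[].
  rewrite (_ : mkset _ = set0); first by apply: baire_decided_open; exact: open0.
  by apply/seteqP; split=> t //= -[].
rewrite (_ : mkset _ = if `[< meager (U j `&` O) >] then set0 else B).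
  by case: ifP.
apply/seteqP; split=> x /=; case: asboolP => mO.
- apply; apply: meager_sub mO => t [jt [Ot _]]; split => //.
- move=> nm; apply: contrapT => nB; apply: nm.
  by apply: meager_sub meager0 => t [_ []].
- by [].
- move=> Bx; apply: contra_not mO; apply: meager_sub => t [jt Ot]; split => //.
Qed.

End vaught.
End category.

Record topgroup (T : topologicalType) := TopGroup {
  tmul : T -> T -> T;
  tinv : T -> T;
  tone : T;
  tmulA : associative tmul;
  tmul1 : right_id tone tmul;
  tmulV : right_inverse tone tinv tmul;
  tmul1l : left_id tone tmul;
  tmulVl : left_inverse tone tinv tmul;
  tmul_cont : continuous (fun p : T * T => tmul p.1 p.2);
  tinv_cont : continuous tinv }.

Section topgroup.
Context (T : topologicalType) (H : topgroup T).
Local Notation "a * b" := (tmul H a b).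
Local Notation "a ^-1" := (tinv H a).

Lemma tmulK g : cancel ((tmul H)^~ g) ((tmul H)^~ (g^-1)).
Proof. by move=> t; rewrite -tmulA tmulV tmul1. Qed.

Lemma tmulVK g : cancel ((tmul H)^~ (g^-1)) ((tmul H)^~ g).
Proof. by move=> t; rewrite -tmulA tmulVl tmul1. Qed.

Lemma tmul_open a b O : open O -> O (a * b) -> exists A B,
  [/\ open A, open B, A a, B b & forall a' b', A a' -> B b' -> O (a' * b')].
Proof.
move=> oO Oab; have /(_ O)[] := @tmul_cont T H (a, b); first exact: open_nbhs_nbhs.
move=> -[A B] [/= nA nB] AB; exists A°, B°; split; [exact: open_interior|
  exact: open_interior|by apply: nbhs_singleton; exact: nbhs_interior|
  by apply: nbhs_singleton; exact: nbhs_interior|].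
move=> a' b' /interior_subset Aa /interior_subset Bb; exact: (AB (a', b')).
Qed.

Lemma tinv_open O : open O -> open [set t | O (t^-1)].
Proof. by move=> oO; apply: open_comp => // t _; exact: tinv_cont. Qed.

Lemma tmulr_open g O : open O -> open [set t | O (t * g)].
Proof.
move=> oO; rewrite openE => t /= /(tmul_open oO)[A [B [oA oB At Bg AB]]].
apply: nbhs_singleton; apply: nbhs_interior.
by apply: filterS (open_nbhs_nbhs (conj oA At)) => s As; exact: AB.
Qed.

Lemma meager_mulr g M : meager M -> meager [set t | M (t * g)].
Proof.
move=> [Q QP MQ]; exists (fun n => [set t | Q n (t * g)]).
  move=> n; have [oQ dQ] := QP n; split; first exact: tmulr_open.
  move=> W [x Wx] oW.
  have [|y [Wy Qy]] := dQ _ _ (@tmulr_open (g^-1) _ oW).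
    by exists (x * g); rewrite /= tmulK.
  by exists (y * g^-1); split => //=; rewrite tmulVK.
by move=> t /MQ[n _ nQ]; exists n.
Qed.

End topgroup.

(** * An invariant basis from Vaught transforms *)

(** The b i form the basis of a topology in which every group element acts
    continuously (ib_act), which is regular (ib_reg) and separates points
    (ib_sep); regularity refers to the closed sets that are complements of
    basic sets. *)
Record invariant_basis (T : Type) d (X : measurableType d) (act : T -> X -> X)
    (I : countType) (b : I -> set X) : Prop := InvariantBasis {
  ib_meas : forall i, measurable (b i);
  ib_0 : exists i, b i = set0;
  ib_T : exists i, b i = setT;
  ib_U : forall i j, exists k, b k = b i `|` b j;
  ib_I : forall i j, exists k, b k = b i `&` b j;
  ib_act : forall g i x, b i (act g x) ->
    exists j, b j x /\ b j `<=` act g @^-1` b i;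
  ib_reg : forall i x, b i x ->
    exists j k, [/\ b j x, b j `<=` ~` b k & ~` b k `<=` b i];
  ib_sep : forall x y, (forall i, b i x <-> b i y) -> x = y }.

Section vaught_basis.
Context (T : topologicalType) (H : topgroup T) (J : countType) (U : J -> set T).
Hypotheses (bU : countable_base U) (bT : baire T).
Context d (X : measurableType d) (act : T -> X -> X).
Hypotheses (act1 : forall x, act (tone H) x = x)
  (actM : forall s t x, act (tmul H s t) x = act s (act t x)).
Hypothesis act_vaught : forall C : set X, measurable C ->
  vaught U [set p : T * X | C (act p.1 p.2)].
Local Notation "a * b" := (tmul H a b).
Local Notation "a ^-1" := (tinv H a).

Let oU j : open (U j). Proof. exact: bU.1. Qed.

Let actV t x : act (t^-1) (act t x) = x.
Proof. by rewrite -actM tmulVl act1. Qed.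

(** The Vaught transforms: t x lies in C for nonmeagerly many, resp. comeagerly
    many, t in W. *)
Definition vdelta (C : set X) (W : set T) : set X :=
  [set x | ~ meager (W `&` [set t | C (act t x)])].

Definition vstar (C : set X) (W : set T) : set X := ~` vdelta (~` C) W.

Lemma vstarE C W x : vstar C W x <-> meager (W `&` [set t | ~ C (act t x)]).
Proof. by split=> [/contrapT|m] //; apply. Qed.

Lemma measurable_vdelta C j : measurable C -> measurable (vdelta C (U j)).
Proof. by move=> mC; have [_ +] := act_vaught mC; exact. Qed.

Lemma measurable_vstar C j : measurable C -> measurable (vstar C (U j)).
Proof. by move=> mC; apply: measurableC; apply: measurable_vdelta; exact: measurableC. Qed.

(** The transform at W of C contains g x if and only if the one at W g contains x,
    and a set is nonmeager in W g if and only if it is nonmeager in some basic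
    open subset of W g. *)
Lemma vdelta_act C j g x : vdelta C (U j) (act g x) ->
  exists k, vdelta C (U k) x /\ vdelta C (U k) `<=` act g @^-1` vdelta C (U j).
Proof.
move=> nm; pose W := [set t | U j (t * g^-1)].
have oW : open W by exact: tmulr_open.
have shift z : meager (U j `&` [set t | C (act t (act g z))]) ->
    meager (W `&` [set t | C (act t z)]).
  move=> /(@meager_mulr _ H (g^-1)); apply: meager_sub => t [Wt Ct]; split => //=.
  by rewrite -actM -tmulA tmulVl tmul1.
have shiftV z : meager (W `&` [set t | C (act t z)]) ->
    meager (U j `&` [set t | C (act t (act g z))]).
  move=> /(@meager_mulr _ H g); apply: meager_sub => t [jt Ct]; split => /=.
    by rewrite /W/= -tmulA tmulV tmul1.
  by rewrite actM.
have [|k [kW nk]] := @nonmeager_base _ _ _ bU [set t | C (act t x)] _ oW.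
  by move=> /shiftV.
exists k; split => // z nz /shift mz; apply: nz.
by apply: meager_sub mz; exact: setSI.
Qed.

(** If t x is in C for nonmeagerly many t in U j, this holds for comeagerly many
    t in some U k. Continuity of the product gives U w, a neighborhood U n of the
    identity, and U w' inside U k such that (U w)(U n) lies in U k and
    (U w')(U n)^-1 in U w: the first inclusion yields the membership of x, the
    second the passage from U w to U w'. *)
Lemma vdelta_reg C j x : measurable C -> vdelta C (U j) x ->
  exists w n w', [/\ vdelta (vstar C (U w)) (U n) x,
    vdelta (vstar C (U w)) (U n) `<=` vstar C (U w') &
    vstar C (U w') `<=` vdelta C (U j)].
Proof.
move=> mC nm; have [bC _] := act_vaught mC.
have [k [[v kv] kj mk]] := nonmeager_decided bU (bC x) (oU j) nm.
have kv1 : U k (v * tone H) by rewrite tmul1.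
have [A [B [oA oB Av B1 AB]]] := tmul_open (oU k) kv1.
(* U w is a neighborhood of v with (U w) B inside U k, and U n will be one of
   the identity. *)
have [w [wv wA]] := bU.2 _ _ oA Av.
have wv1 : U w (v * tone H) by rewrite tmul1.
have [A' [B' [oA' oB' A'v B'1 AB']]] := tmul_open (oU w) wv1.
have [w' [w'v w'A]] := bU.2 _ _ (openI oA' (oU k)) (conj A'v kv).
have one_inv : (tone H)^-1 = tone H by rewrite -[LHS](tmul1l H) tmulV.
have oB'' : open (B `&` [set t | B' (t^-1)]).
  by apply: openI => //; exact: tinv_open.
have B''1 : (B `&` [set t | B' (t^-1)]) (tone H) by split=> //=; rewrite one_inv.
have [n [n1 nB]] := bU.2 _ _ oB'' B''1.
exists w, n, w'; split.
- apply: (@baire_nonmeager _ bT) => //; first by exists (tone H).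
  rewrite (_ : _ `&` _ = set0); first exact: meager0.
  apply/seteqP; split=> // h [nh]; apply; apply/vstarE.
  apply: meager_sub (meager_mulr H h mk) => t [wt nC]; split.
    by apply: AB; [exact: wA|have [] := nB _ nh].
  by rewrite /= actM.
- move=> y ny; apply/vstarE.
  have [h [nh /vstarE hy]] : (U n `&` [set h | vstar C (U w) (act h y)]) !=set0.
    apply/set0P; apply/eqP => e; apply: ny; rewrite e; exact: meager0.
  apply: meager_sub (meager_mulr H (h^-1) hy) => s [w's nC]; split => /=.
    apply: AB'; first by have [] := w'A _ w's.
    by have [] := nB _ nh.
  by rewrite -actM -tmulA tmulVl tmul1.
- move=> y /vstarE my; have w'k : U w' `<=` U j.
    by move=> t /w'A[_ /kj].
  move=> mj; apply: (@baire_nonmeager _ bT [set t | C (act t y)] (U w')) => //.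
    by exists v.
  by apply: meager_sub mj; exact: setSI.
Qed.

Variable E : nat -> set X.
Hypotheses (mE : forall k, measurable (E k)) (iE : forall x y, code E x = code E y -> x = y).

(** If no transform of the E k separates x from y, then for every k the sets of t
    with t x, resp. t y, in E k differ by a meager set. By the Baire category
    theorem, for some t no E k separates t x from t y. *)
Lemma vdelta_sep x y : (forall k j, vdelta (E k) (U j) x <-> vdelta (E k) (U j) y) ->
  x = y.
Proof.
move=> xy; apply: contrapT => nxy.
have diff t : exists k, ~ (E k (act t x) <-> E k (act t y)).
  apply: contrapT => /forallNP same; apply: nxy.
  suff /(congr1 (act (t^-1))) : act t x = act t y by rewrite !actV.
  by apply: iE; apply/funext => k; apply: asbool_equiv_eq; apply: contrapT; exact: same.
have sym k x' y' : (forall j, vdelta (E k) (U j) x' <-> vdelta (E k) (U j) y') ->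
    meager [set t | E k (act t x') /\ ~ E k (act t y')].
  move=> xy'; rewrite -[mkset _]setTI; apply: contrapT.
  set D := mkset _ => nD.
  have bD : baire_decided D.
    rewrite /D (_ : mkset _ = ~` (~` [set t | E k (act t x')] `|` [set t | E k (act t y')])).
      apply: baire_decidedC.
      have -> : ~` [set t | E k (act t x')] `|` [set t | E k (act t y')] =
          \bigcup_n (if n is 0%N then ~` [set t | E k (act t x')] else [set t | E k (act t y')]).
        apply/seteqP; split=> t; first by move=> [?|?]; [exists 0%N|exists 1%N].
        by move=> [[|n] _]; [left|right].
      apply: (baire_decided_bigcup bU) => -[|n].
        apply: baire_decidedC; exact: (act_vaught (mE k)).1.
      exact: (act_vaught (mE k)).1.
    by rewrite setCU setCK; apply/seteqP; split.
  have [j [j0 _ mj]] := nonmeager_decided bU bD openT nD.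
  have jx : vdelta (E k) (U j) x'.
    apply: (@baire_nonmeager _ bT) => //; apply: meager_sub mj => t [jt nE].
    by split => // -[].
  apply: (xy' j).1 jx _; apply: meager_sub mj => t [jt Et]; split => // -[_].
  exact.
have mT : meager [set: T].
  apply: (@meager_sub _ _ (\bigcup_k ([set t | E k (act t x) /\ ~ E k (act t y)] `|`
    [set t | E k (act t y) /\ ~ E k (act t x)]))).
    move=> t _; have [k Hk] := diff t; exists k => //.
    have [Ex|nEx] := pselect (E k (act t x)); have [Ey|nEy] := pselect (E k (act t y)).
    - by exfalso; apply: Hk.
    - by left.
    - by right.
    - by exfalso; apply: Hk.
  apply: meager_bigcup => k; apply: meagerU; apply: sym => j //.
  exact: iff_sym.
by apply: (bT openT _ mT); exists (tone H).
Qed.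

(** The closure of the family E under complements and the transforms vstar. Because of
    it, the transform vdelta (vstar C (U w)) (U n) of vdelta_reg and the complement
    of vstar C (U w'), which is vdelta (~` C) (U w'), are transforms of members of
    the family. *)
Let cset (a : nat * seq (option J)) : set X :=
  foldr (fun o C => if o is Some j then vstar C (U j) else ~` C) (E a.1) a.2.

Let measurable_cset a : measurable (cset a).
Proof.
case: a => k w; rewrite /cset /=; elim: w => [|[j|] w IH] //=.
  exact: measurable_vstar.
exact: measurableC.
Qed.

Let gen (a : nat * seq (option J) * J) : set X := vdelta (cset a.1) (U a.2).

Let vb (i : seq (seq (nat * seq (option J) * J))) : set X :=
  [set x | exists2 s, s \in i & forall a, a \in s -> gen a x].

Let vb0 : vb [::] = set0.
Proof. by apply/seteqP; split=> // x []. Qed.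

Let vbT : vb [:: [::]] = setT.
Proof. by apply/seteqP; split=> // x _; exists [::]; rewrite ?inE. Qed.

Let vbU i j : vb (i ++ j) = vb i `|` vb j.
Proof.
apply/seteqP; split=> x.
  by move=> [s + sx]; rewrite mem_cat => /orP[si|sj]; [left|right]; exists s.
by move=> [[s si sx]|[s si sx]]; exists s => //; rewrite mem_cat si ?orbT.
Qed.

Let vbI i j : vb [seq s ++ t | s <- i, t <- j] = vb i `&` vb j.
Proof.
apply/seteqP; split=> x.
  move=> [_ /allpairsP[[s t] [/= si tj ->]] stx].
  by split; [exists s|exists t] => // a ain; apply: stx; rewrite mem_cat ain ?orbT.
move=> [[s si sx] [t tj tx]]; exists (s ++ t); first by apply/allpairsP; exists (s, t).
by move=> a; rewrite mem_cat => /orP[/sx|/tx].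
Qed.

Let vb_gen a : vb [:: [:: a]] = gen a.
Proof.
apply/seteqP; split=> x.
  by move=> [s]; rewrite inE => /eqP->; apply; rewrite inE.
by move=> ax; exists [:: a]; rewrite ?inE// => a'; rewrite inE => /eqP->.
Qed.

(** The basis consists of the finite unions of finite intersections of the sets
    vdelta C (U j), where C ranges over the closure of the E k under complements
    and Vaught transforms. *)
Theorem vaught_invariant_basis : exists (I : countType) (b : I -> set X),
  invariant_basis act b.
Proof.
exists (seq (seq (nat * seq (option J) * J)) : countType), vb; split.
- move=> i; elim: i => [|s i IH]; first by rewrite vb0.
  rewrite -cat1s vbU; apply: measurableU => //.
  elim: s => [|a s IHs]; first by rewrite vbT.
  have -> : vb [:: a :: s] = gen a `&` vb [:: s] by rewrite -vb_gen -vbI.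
  apply: measurableI => //; apply: measurable_vdelta; exact: measurable_cset.
- by exists [::].
- by exists [:: [::]].
- by move=> i j; exists (i ++ j).
- by move=> i j; exists [seq s ++ t | s <- i, t <- j].
- move=> g i x [s si sx].
  suff [j [jx jg]] : exists j, vb j x /\ forall z, vb j z ->
      forall a, a \in s -> gen a (act g z).
    by exists j; split=> // z /jg zs; exists s.
  elim: s sx {si} => [|a s IH] sx; first by exists [:: [::]]; rewrite vbT; split.
  have [|j [jx jg]] := IH; first by move=> c cs; apply: sx; rewrite inE cs orbT.
  have [k [kx kg]] := vdelta_act (sx a (mem_head _ _)).
  exists [seq u ++ t | u <- [:: [:: (a.1, k)]], t <- j]; rewrite vbI vb_gen; split=> //.
  move=> z [kz jz] c; rewrite inE => /orP[/eqP->|]; [exact: kg|exact: jg].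
- move=> i x [s si sx].
  suff [j [k [jx jk ks]]] : exists j k, [/\ vb j x, vb j `<=` ~` vb k &
      forall z, ~ vb k z -> forall a, a \in s -> gen a z].
    by exists j, k; split=> // z /ks zs; exists s.
  elim: s sx {si} => [|a s IH] sx.
    by exists [:: [::]], [::]; rewrite vbT vb0 setC0; split.
  have [|j [k [jx jk ks]]] := IH; first by move=> c cs; apply: sx; rewrite inE cs orbT.
  have [w [n [w' [wx ww' w'a]]]] :=
    vdelta_reg (measurable_cset a.1) (sx a (mem_head _ _)).
  exists [seq u ++ t | u <- [:: [:: (a.1.1, Some w :: a.1.2, n)]], t <- j],
    ([:: [:: (a.1.1, None :: a.1.2, w')]] ++ k).
  rewrite vbI vbU !vb_gen; split => //.
    by move=> z [/ww' zw' /jk zk] [|//].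
  move=> z /not_orP[/contrapT zw' nk] c; rewrite inE => /orP[/eqP->|].
    exact: w'a.
  exact: ks.
- move=> x y xy; apply: vdelta_sep => k j.
  have := xy [:: [:: (k, [::], j)]]; by rewrite vb_gen.
Qed.

End vaught_basis.

(** * Sequences that meet the basis *)

Section basis_measure.
Context (R : realType) d (X : measurableType d) (mu : probability X R).
Context (T : Type) (act : T -> X -> X) (I : countType) (b : I -> set X).
Hypotheses (ib : invariant_basis act b)
  (mp : forall t, measure_preserving mu (act t)).

Let mb i : measurable (b i). Proof. exact: ib_meas ib i. Qed.

Let mact t A : measurable A -> measurable (act t @^-1` A).
Proof. by move=> mA; rewrite -[X in measurable X]setTI; exact: (mp t).1. Qed.

Let pr_act t A : measurable A -> pr mu (act t @^-1` A) = pr mu A.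
Proof. by move=> mA; rewrite /pr (mp t).2. Qed.

(** A measurable set that is a union of basic sets is a countable union of them, so
    one basic set almost exhausts it. The predicate Q carries the additional
    property, stable under finite unions, that these basic sets have. *)
Lemma ib_inner (Q : I -> Prop) (B : set X) (e : R) : measurable B -> 0 < e ->
  (forall i, Q i -> b i `<=` B) -> (forall i, b i = set0 -> Q i) ->
  (forall i j k, Q i -> Q j -> b k = b i `|` b j -> Q k) ->
  (forall x, B x -> exists i, Q i /\ b i x) ->
  exists i, Q i /\ pr mu B < pr mu (b i) + e.
Proof.
move=> mB e0 QB Q0 QU BQ.
pose F n := if unpickle n is Some i then if `[< Q i >] then b i else set0 else set0.
have mF n : measurable (F n) by rewrite /F; case: unpickle => // i; case: ifP.
have [n] := pr_bigcup_approx mu mF e0.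
have -> : \bigcup_n F n = B.
  apply/seteqP; split=> x; last first.
    by move=> /BQ[i [Qi bx]]; exists (pickle i); rewrite // /F pickleK asboolT.
  by move=> [m _]; rewrite /F; case: unpickle => // i; case: asboolP => // /QB; exact.
have [i [Qi <-]] : exists i, Q i /\ b i = \bigcup_(k < n) F k.
  rewrite bigcup_mkord; elim: n => [|n [i [Qi bi]]].
    by have [i bi] := ib_0 ib; exists i; rewrite big_ord0; split => //; exact: Q0.
  rewrite big_ord_recr /= -bi /F; case: unpickle => [j|]; last by exists i; rewrite setU0.
  case: asboolP => Qj; last by exists i; rewrite setU0.
  by have [k bk] := ib_U ib i j; exists k; split => //; exact: QU bk.
by exists i.
Qed.

Lemma ib_act_approx t i e : 0 < e ->
  exists j, b j `<=` act t @^-1` b i /\ pr mu (b i) < pr mu (b j) + e.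
Proof.
move=> e0; rewrite -(pr_act t (mb i)).
apply: (@ib_inner (fun j => b j `<=` act t @^-1` b i)) => //.
- exact: mact.
- by move=> j ->.
- by move=> j k l jt kt ->; rewrite subUset.
- by move=> x /(ib_act ib)[j [jx ji]]; exists j.
Qed.

Lemma ib_reg_approx i e : 0 < e -> exists j k,
  [/\ b j `<=` ~` b k, ~` b k `<=` b i & pr mu (b i) < pr mu (b j) + e].
Proof.
move=> e0.
have [||||||j [[k [jk ki]] je]] := @ib_inner
  (fun j => exists k, b j `<=` ~` b k /\ ~` b k `<=` b i) (b i) e => //.
- by move=> j [k [jk ki]]; exact: subset_trans jk ki.
- by move=> j ->; have [k kT] := ib_T ib; exists k; rewrite kT setCT; split.
- move=> j k l [j' [jj' j'i]] [k' [kk' k'i]] ->.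
  have [l' lE] := ib_I ib j' k'; exists l'; rewrite lE; split.
    by rewrite setCI => x [/jj'|/kk']; [left|right].
  by rewrite setCI subUset.
- by move=> x /(ib_reg ib)[j [k [jx jk ki]]]; exists j; split => //; exists k.
by exists j, k.
Qed.

Lemma ib_hit_pos A t i j : A = b i `&` act t @^-1` b j -> 0 < pr mu A ->
  exists k, b k `<=` A /\ 0 < pr mu (b k).
Proof.
move=> AE A0; have mA : measurable A by rewrite AE; apply: measurableI => //; exact: mact.
have [||||k [kA]] := @ib_inner (fun k => b k `<=` A) A _ mA A0.
- by [].
- by move=> k ->.
- by move=> k l m kA lA ->; rewrite subUset.
- move=> x; rewrite {1}AE => -[ix /(ib_act ib)[k [kx kj]]].
  have [l lE] := ib_I ib i k; exists l; rewrite lE AE; split => //.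
  by move=> y [iy /kj].
by rewrite -[X in X < _]add0r ltrD2r; exists k.
Qed.

(** A set and its complement are approximated together by disjoint basic sets, since
    the complement of a basic set need not be basic. *)
Let ib_approximable A := forall e : R, 0 < e -> exists i j,
  [/\ b i `<=` ~` b j, pr mu (A `\` b i) < e & pr mu (~` A `\` b j) < e].

(** Regularity of the basis starts the induction: a basic set is approximated from
    inside by a basic set that is disjoint from some basic set containing the
    complement. *)
Let ib_approximable_sigma (A : set X) : <<s range b>> A -> ib_approximable A.
Proof.
suff : <<s range b>> `<=` [set A | measurable A /\ ib_approximable A].
  by move=> h /h[].
apply: sigma_ind.
- split=> // e e0; have [i i0] := ib_0 ib; have [j jT] := ib_T ib.
  by exists i, j; rewrite i0 jT setD0 setDT pr0; split.
- move=> {}A [mA hA]; split; first exact: measurableC.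
  move=> e e0; have [i [j [ij iA jA]]] := hA e e0.
  exists j, i; rewrite setCK; split => //.
  by move=> x jx ix; exact: (ij x ix).
- move=> F /all_and2[mF hF].
  have mUF : measurable (\bigcup_n F n) by exact: bigcupT_measurable.
  split=> // e e0.
  have [N HN] := pr_bigcup_approx mu mF (divr_gt0 e0 (ltr0n _ 2)).
  have e2 n : 0 < e / 2 / (2 ^ n.+2)%:R by rewrite !divr_gt0// ltr0n expn_gt0.
  have /choice[i /choice[j ij]] := fun n => hF n _ (e2 n).
  have [k kE] : exists k, b k = \bigcup_(n < N) b (i n).
    rewrite bigcup_mkord; elim: N {HN} => [|n [k IH]].
      by rewrite big_ord0; exact: ib_0 ib.
    by rewrite big_ord_recr /= -IH; exact: ib_U ib _ _.
  have [l lE] : exists l, b l = \bigcap_(n < N) b (j n).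
    rewrite bigcap_mkord; elim: N {HN kE} => [|n [l IH]].
      by rewrite big_ord0; exact: ib_T ib.
    by rewrite big_ord_recr /= -IH; exact: ib_I ib _ _.
  have mFi n : measurable (F n `\` b (i n)) by mset.
  have mFj n : measurable (~` F n `\` b (j n)) by mset.
  have mFN : measurable (\bigcup_(n < N) F n) by exact: bigcup_measurable.
  have small n : e / 2 / (2 ^ n.+2)%:R <= e / 2 / (2 ^ n.+1)%:R.
    rewrite ler_pM2l ?divr_gt0// lef_pV2 ?posrE ?ltr0n ?expn_gt0//.
    by rewrite ler_nat leq_exp2l.
  have e22 : e / 2 / 2 + e / 2 / 2 = e / 2 by rewrite -splitr.
  exists k, l; rewrite kE lE; split.
  + move=> x [n nN ix] /(_ n nN) jx.
    by have [+ _ _] := ij n; move=> /(_ x ix).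
  + have sub : \bigcup_n F n `\` \bigcup_(n < N) b (i n) `<=`
      (\bigcup_n F n `\` \bigcup_(n < N) F n) `|` \bigcup_n (F n `\` b (i n)).
      move=> x [[n _ Fx] nx].
      have [[m mN Fm]|nF] := pselect ((\bigcup_(n < N) F n) x).
        by right; exists m => //; split => // im; apply: nx; exists m.
      by left; split => //; exists n.
    have mD : measurable (\bigcup_n (F n `\` b (i n))) by exact: bigcupT_measurable.
    have mD' : measurable (\bigcup_n F n `\` \bigcup_(n < N) F n) by mset.
    have mD'' : measurable (\bigcup_n F n `\` \bigcup_(n < N) b (i n)).
      by apply: measurableD => //; apply: bigcup_measurable.
    apply: le_lt_trans (le_pr mu mD'' (measurableU _ _ mD' mD) sub) _.
    apply: le_lt_trans (prU_le mu mD' mD) _.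
    rewrite [ltRHS](splitr e); apply: ltr_leD.
      by rewrite prD//; [lra|move=> x [n _ Fx]; exists n].
    apply: pr_bigcup_le => // n; have [_ /ltW H _] := ij n.
    exact: le_trans H (small n).
  + have sub : ~` (\bigcup_n F n) `\` \bigcap_(n < N) b (j n) `<=`
      \bigcup_n (~` F n `\` b (j n)).
      move=> x [nF /existsNP[n /not_implyP[nN nj]]]; exists n => //.
      by split => // Fx; apply: nF; exists n.
    have mD : measurable (\bigcup_n (~` F n `\` b (j n))) by exact: bigcupT_measurable.
    have mD' : measurable (~` (\bigcup_n F n) `\` \bigcap_(n < N) b (j n)).
      by rewrite -lE; mset.
    apply: le_lt_trans (le_pr mu mD' mD sub) _.
    apply: (@le_lt_trans _ _ (e / 2)); last by lra.
    apply: pr_bigcup_le => // n; have [_ _ /ltW H] := ij n.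
    exact: le_trans H (small n).
- move=> _ [i _ <-]; split => // e e0.
  have [j [k [jk ki je]]] := ib_reg_approx i e0.
  exists j, k; split => //.
    by rewrite prD//; [lra|exact: subset_trans ki].
  rewrite (_ : _ `\` _ = set0) ?pr0//; apply/seteqP; split=> // x [ni nk].
  exact/ni/ki.
Qed.

(** The basis separates points, so the Boolean algebra that it generates is dense in
    the measure algebra, and the members of this algebra are approximated by
    basic sets. *)
Lemma ib_approx (G : nat -> set X) A e : tight_coding mu G -> measurable A ->
  0 < e -> exists i, md mu A (b i) < e.
Proof.
move=> tG mA e0; have e20 : 0 < e / 2 by rewrite divr_gt0.
have e40 : 0 < e / 2 / 2 by rewrite !divr_gt0.
pose B n := if unpickle n is Some i then b i else set0.
have mB n : measurable (B n) by rewrite /B; case: unpickle.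
have iB x y : code B x = code B y -> x = y.
  move=> xy; apply: (ib_sep ib) => i.
  by have := eq_code (congr1 (@^~ (pickle i)) xy); rewrite /B pickleK.
have [n [L]] := code_approx tG mB iB mA e20.
set C := mkset _ => AC.
have mC : measurable C by exact: (@measurable_mkseq_code _ _ B mB n (fun s => s \in L)).
have /ib_approximable_sigma /(_ _ e40)[i [j [ij Ci Cj]]] : <<s range b>> C.
  apply: (@measurable_mkseq_code _ (g_sigma_algebraType (range b)) B _ n
    (fun s => s \in L)) => k.
  rewrite /B; case: unpickle => [i|]; last exact: sigma_algebra0.
  by apply: sub_sigma_algebra; exists i.
exists i; apply: le_lt_trans (md_trans mu mA mC (mb i)) _.
rewrite [ltRHS](splitr e); apply: ltrD => //.
have m1 : measurable (C `\` b i) by mset.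
have m2 : measurable (~` C `\` b j) by mset.
apply: le_lt_trans (md_le mu mC (mb i) (measurableU _ _ m1 m2) _) _.
  move=> x; rewrite setY_def => -[Dx|[ix nC]]; first by left.
  by right; split => //; exact: ij.
apply: le_lt_trans (prU_le mu m1 m2) _.
by rewrite (splitr (e / 2)); exact: ltrD.
Qed.

Variable muN : probability (seq_space X) R.
Hypothesis muN_prod : is_product_measure mu muN.

Definition basis_dense : set (seq_space X) :=
  [set y | forall i, 0 < pr mu (b i) -> exists n, b i (y n)].

Lemma measurable_basis_dense : measurable basis_dense.
Proof.
rewrite (_ : basis_dense = ~` \bigcup_i (if 0 < pr mu (b i) then
    ~` \bigcup_n [set y : seq_space X | b i (y n)] else set0)).
  apply: measurableC; apply: measurable_bigcup_countType => i; case: ifP => // _.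
  by apply: measurableC; apply: bigcupT_measurable => n; exact: measurable_coord.
apply/seteqP; split=> y.
  by move=> Yy [i _]; case: ifP => // i0; apply; have [n ?] := Yy i i0; exists n.
move=> nU i i0; apply: contrapT => nn; apply: nU; exists i => //.
by rewrite i0 => -[n _ ?]; apply: nn; exists n.
Qed.

Let pr_avoid i : 0 < pr mu (b i) ->
  pr muN (~` \bigcup_n [set y : seq_space X | b i (y n)]) = 0.
Proof.
move=> i0; set V := ~` _.
have mV : measurable V.
  by apply: measurableC; apply: bigcupT_measurable => n; exact: measurable_coord.
pose q := pr mu (~` b i).
have q1 : q < 1 by rewrite /q prC//; lra.
have q0 : 0 <= q by exact: pr_ge0.
have Vq n : pr muN V <= q ^+ n.
  have mR := measurable_rect n (fun=> measurableC (mb i)).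
  apply: le_trans (le_pr muN mV mR _) _.
    by move=> y nU k _ iy; apply: nU; exists k.
  have := muN_prod n (fun=> measurableC (mb i)); rewrite /pr => ->.
  have -> : mu (~` b i) = q%:E := prE mu (measurableC (mb i)).
  by rewrite prodEFin /= prodr_const card_ord.
apply/eqP; rewrite eq_le pr_ge0 andbT.
have qq : q ^+ n @[n --> \oo] --> (0 : R) by apply: cvg_expr; rewrite ger0_norm.
apply: (closed_cvg (fun x => pr muN V <= x) _ _ _ qq).
  exact: closed_ge.
by exists 0%N => // n _; exact: Vq.
Qed.

Lemma basis_dense_conull : pr muN basis_dense = 1.
Proof.
have mY := measurable_basis_dense.
suff : pr muN (~` basis_dense) = 0 by rewrite prC//; lra.
pose F n := if unpickle n is Some i then if 0 < pr mu (b i) then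
   ~` \bigcup_n [set y : seq_space X | b i (y n)] else set0 else set0.
have mF n : measurable (F n).
  rewrite /F; case: unpickle => // i; case: ifP => // _; apply: measurableC.
  by apply: bigcupT_measurable => m; exact: measurable_coord.
apply/eqP; rewrite eq_le pr_ge0 andbT.
rewrite -(pr_bigcup0 (mu := muN) mF).
  apply: le_pr; [exact: measurableC|exact: bigcupT_measurable|].
  move=> y /existsNP[i /not_implyP[i0 ni]]; exists (pickle i) => //.
  by rewrite /F pickleK i0 => -[n _ ?]; apply: ni; exists n.
by move=> n; rewrite /F; case: unpickle => [i|]; rewrite ?pr0//; case: ifP => [/pr_avoid//|]; rewrite pr0.
Qed.

(** If y visits a basic set contained in the preimage of b i under t, then t y
    visits b i. *)
Lemma basis_dense_act t y : basis_dense y -> basis_dense (diag_act act t y).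
Proof.
move=> Yy i i0; have [j [ji]] := ib_act_approx t i i0.
rewrite -[X in X < _]add0r ltrD2r => /Yy[n jy].
by exists n; exact: ji.
Qed.

(** As t acts continuously, a nonnull intersection of b i with the preimage of b j
    contains a nonnull basic set, and y visits it. So the positions that y visits
    decide nullness. *)
Lemma basis_dense_miss t y i j : basis_dense y ->
  (forall n, ~ (b i (y n) /\ b j (act t (y n)))) ->
  pr mu (b i `&` act t @^-1` b j) = 0.
Proof.
move=> Yy miss; apply/eqP; rewrite eq_le pr_ge0 andbT leNgt; apply/negP.
move=> /(ib_hit_pos erefl)[k [kA /Yy[n ky]]].
exact: (miss n (kA _ ky)).
Qed.

(** A point and its image, if distinct, lie in disjoint basic sets b j and b k. As
    no y n lies in b j and, being fixed, in b k as well, the points separated in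
    this way form a null set for each of the countably many pairs. *)
Lemma basis_dense_fixed t y : basis_dense y -> diag_act act t y = y ->
  {ae mu, forall x, act t x = x}.
Proof.
move=> Yy ty; have tyn n : act t (y n) = y n by have := congr1 (@^~ n) ty.
pose F n := if unpickle n is Some (j, k) then
  if `[< b j `<=` ~` b k >] then b j `&` act t @^-1` b k else set0 else set0.
have mF n : measurable (F n).
  rewrite /F; case: unpickle => // -[j k]; case: ifP => // _.
  by apply: measurableI => //; exact: mact.
exists (\bigcup_n F n); split; first exact: bigcupT_measurable.
  rewrite prE; last exact: bigcupT_measurable.
  rewrite pr_bigcup0// => n; rewrite /F; case: unpickle => [[j k]|]; rewrite ?pr0//.
  case: asboolP => [jk|_]; rewrite ?pr0//; apply: basis_dense_miss Yy _ => n'.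
  by rewrite tyn => -[/jk].
move=> x /= ntx.
have [j [k [jk jx kx]]] : exists j k, [/\ b j `<=` ~` b k, b j x & b k (act t x)].
  have /existsNP[i nxi] : ~ forall i, b i (act t x) <-> b i x.
    by move=> h; apply: ntx; exact: (ib_sep ib h).
  have [ix|nix] := pselect (b i x).
    have [j [k [jx jk ki]]] := ib_reg ib ix; exists j, k; split => //.
    by apply: contrapT => nk; apply: nxi; split => // _; exact: ki.
  have itx : b i (act t x) by apply: contrapT => nt; apply: nxi.
  have [j [k [jx jk ki]]] := ib_reg ib itx; exists k, j; split => //.
    by move=> z kz jz; exact: (jk z jz).
  by apply: contrapT => nk; apply: nix; exact: ki.
by exists (pickle (j, k)) => //; rewrite /F pickleK asboolT.
Qed.

End basis_measure.

Section diag.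
Context (R : realType) d (X : measurableType d) (mu : probability X R)
  (muN : probability (seq_space X) R).
Hypothesis muN_prod : is_product_measure mu muN.
Context (T : Type) (act : T -> X -> X).

(** The preimage of a rectangle is a rectangle with sides of the same measure. *)
Lemma diag_preserving t : measure_preserving mu (act t) ->
  measure_preserving muN (diag_act act t).
Proof.
move=> [mt pt].
have mact A : measurable A -> measurable (act t @^-1` A).
  by move=> mA; rewrite -[X in measurable X]setTI; exact: mt.
pose rect n (A : nat -> set X) :=
  [set x : seq_space X | forall i, (i < n)%N -> A i (x i)].
apply: (@preserving_pi _ _ _ _ _
  [set C | exists n A, (forall i, measurable (A i)) /\ C = rect n A]).
- apply/seteqP; split.
  + apply: smallest_sub; first exact: smallest_sigma_algebra.
    move=> _ [n [A [mA ->]]]; apply: sub_sigma_algebra.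
    exists n.+1, (fun i => if i == n then A else setT); split.
      by move=> i; case: eqP.
    apply/seteqP; split=> x /=; last by move=> /(_ n (ltnSn n)); rewrite eqxx.
    by move=> Ax i _; case: eqP => // ->.
  + apply: smallest_sub; first exact: sigma_algebra_measurable.
    by move=> _ [n [A [mA ->]]]; exact: measurable_rect.
- move=> _ _ [n [A [mA ->]]] [m [B [mB ->]]].
  exists (maxn n m), (fun i => (if (i < n)%N then A i else setT) `&`
                               (if (i < m)%N then B i else setT)).
  split; first by move=> i; apply: measurableI; case: ifP.
  apply/seteqP; split=> x.
    by move=> [Ax Bx] i _; split; case: ifP => // im; [exact: Ax|exact: Bx].
  move=> ABx; split=> i im.
    by have [|+ _] := ABx i; rewrite ?leq_max im//; apply.
  by have [|_ +] := ABx i; rewrite ?leq_max im ?orbT//; apply.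
- move=> A; apply: (sigma_ind
    (K := fun A : set (seq_space X) => measurable (diag_act act t @^-1` A))).
  + by rewrite preimage_set0.
  + by move=> B mB; rewrite preimage_setC; exact: measurableC.
  + by move=> F mF; rewrite preimage_bigcup; exact: bigcupT_measurable.
  + move=> _ [n [B [mB ->]]]; exact: (measurable_coord n (mact B mB)).
- move=> _ [n [A [mA ->]]].
  have -> : diag_act act t @^-1` rect n A = rect n (fun i => act t @^-1` A i) by [].
  rewrite !muN_prod//; last by move=> i; exact: mact.
  by apply: eq_bigr => i _; exact: pt.
Qed.

End diag.

(** * A reduction to a countable relation gives a totally bounded neighborhood *)

Section counting.
Context (R : realType) d (X : measurableType d) (mu : probability X R)
  (muN : probability (seq_space X) R).
Hypothesis muN_prod : is_product_measure mu muN.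
Context (T : topologicalType) (H : topgroup T) (J : countType) (U : J -> set T).
Hypotheses (bU : countable_base U) (bT : baire T).
Context (act : T -> X -> X).
Hypotheses (act1 : forall x, act (tone H) x = x)
  (actM : forall s t x, act (tmul H s t) x = act s (act t x))
  (mp : forall t, measure_preserving mu (act t))
  (faithful : forall t, {ae mu, forall x, act t x = x} -> t = tone H).
Hypothesis act_vaught : forall C : set X, measurable C ->
  vaught U [set p : T * X | C (act p.1 p.2)].
Context (Ix : countType) (b : Ix -> set X).
Hypothesis ib : invariant_basis act b.
Context (G : nat -> set X).
Hypothesis tG : tight_coding mu G.
Local Notation "a * b" := (tmul H a b).
Local Notation "a ^-1" := (tinv H a).

Let oU j : open (U j). Proof. exact: bU.1. Qed.
Let da : T -> seq_space X -> seq_space X := diag_act act.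
Let Y := basis_dense mu b.

Let mY : measurable Y. Proof. exact: measurable_basis_dense ib. Qed.

Let da1 y : da (tone H) y = y. Proof. by apply/funext => n; exact: act1. Qed.
Let daM s t y : da (s * t) y = da s (da t y).
Proof. by apply/funext => n; exact: actM. Qed.
Let daV t y : da (t^-1) (da t y) = y. Proof. by rewrite -daM tmulVl da1. Qed.
Let daY t y : Y y -> Y (da t y). Proof. exact: (basis_dense_act ib mp). Qed.
Let da_pres t : measure_preserving muN (da t).
Proof. exact: (diag_preserving muN_prod (mp t)). Qed.

Lemma basis_dense_free t y : Y y -> da t y = y -> t = tone H.
Proof. by move=> Yy /(basis_dense_fixed ib mp Yy)/faithful. Qed.

Let free2 s t y : Y y -> da s y = da t y -> s = t.
Proof.
move=> Yy st; have : t^-1 * s = tone H.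
  by apply: (basis_dense_free Yy); rewrite daM st daV.
by move=> /(congr1 (tmul H t)); rewrite tmulA tmulV tmul1l tmul1.
Qed.

Let da_vaught (B : set (seq_space X)) : measurable B ->
  vaught U [set p : T * seq_space X | B (da p.1 p.2)].
Proof.
apply: (sigma_ind (K := fun B : set (seq_space X) =>
  vaught U [set p : T * seq_space X | B (da p.1 p.2)])).
- exact: vaught0.
- by move=> A /(vaughtC bU bT).
- move=> F vF; rewrite (_ : mkset _ =
    \bigcup_n [set p : T * seq_space X | F n (da p.1 p.2)]).
    exact: vaught_bigcup.
  by apply/seteqP; split.
- move=> _ [n [A [mA ->]]]; have [bA mvA] := act_vaught mA; split.
    by move=> y; exact: bA (y n).
  by move=> j; exact: (measurable_coord n (mvA j)).
Qed.

Section reduction.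
Context dZ (Z : measurableType dZ) (C : nat -> set Z).
Hypotheses (mC : forall k, measurable (C k))
  (iC : forall x y, code C x = code C y -> x = y).
Context (f : seq_space X -> Z) (F : Z -> Z -> Prop).
Hypotheses (mf : measurable_fun Y f) (Frefl : forall z, F z z)
  (Fcountable : forall z, countable [set z' | F z z']).
Hypothesis red : forall x y, Y x -> Y y ->
  ((exists t, y = da t x) <-> F (f x) (f y)).

Let B k := Y `&` f @^-1` C k.

Let mB k : measurable (B k). Proof. exact: mf. Qed.

Let BE k y : Y y -> (B k y <-> C k (f y)).
Proof. by move=> Yy; split=> [[]|]. Qed.

(** For comeagerly many t in W the value f (t y) lies in C k, resp. outside C k. *)
Let gen_in W k : set (seq_space X) :=
  [set y | meager (W `&` [set t | ~ B k (da t y)])].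
Let gen_out W k : set (seq_space X) :=
  [set y | meager (W `&` [set t | B k (da t y)])].
(** Every coordinate of the code of f (t y) is constant for comeagerly many t in W;
    the coordinates being countable in number, so is f (t y) itself. *)
Let gen_const W : set (seq_space X) :=
  Y `&` \bigcap_k (gen_in W k `|` gen_out W k).

Let measurable_gen_in j k : measurable (gen_in (U j) k).
Proof.
rewrite -[gen_in _ _]setCK; apply: measurableC.
by have [_] := da_vaught (measurableC (mB k)); exact.
Qed.

Let measurable_gen_out j k : measurable (gen_out (U j) k).
Proof.
rewrite -[gen_out _ _]setCK; apply: measurableC.
by have [_] := da_vaught (mB k); exact.
Qed.

Let measurable_gen_const j : measurable (gen_const (U j)).
Proof.
apply: measurableI => //; apply: bigcapT_measurable => k.
exact: measurableU.
Qed.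

(** The orbit of y is the union of countably many fibers of f. The Baire category
    theorem makes one of them nonmeager, and so comeager in a basic open set. *)
Let gen_const_cover y : Y y -> exists j, U j !=set0 /\ gen_const (U j) y.
Proof.
move=> Yy; have [F0|[z]] := pfcard_geP (Fcountable (f y)).
  have := Frefl (f y); rewrite -[F _ _]/([set z' | F (f y) z'] (f y)) F0.
  by [].
pose D n := [set t | f (da t y) = z n].
have [n nD] : exists n, ~ meager (setT `&` D n).
  apply: contrapT => /forallNP mD; apply: (bT openT); first by exists (tone H).
  apply: meager_sub (meager_bigcup (fun n => contrapT (mD n))) => t _.
  have Ft : F (f y) (f (da t y)) by apply/red => //; [exact: daY|exists t].
  by have [n _ zn] := 'surj_z Ft; exists n.
have bD : baire_decided (D n).
  rewrite (_ : D n = ~` \bigcup_k (if `[< C k (z n) >] then [set t | ~ B k (da t y)]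
      else [set t | B k (da t y)])).
    apply: baire_decidedC; apply: (baire_decided_bigcup bU) => k.
    case: ifP => _; last exact: (da_vaught (mB k)).1.
    exact: (da_vaught (measurableC (mB k))).1.
  apply/seteqP; split=> t.
    move=> tz [k _]; case: asboolP => Ck /=; rewrite BE ?tz//; exact: daY.
  move=> nU; apply: iC; apply/funext => k; apply: asbool_equiv_eq.
  rewrite -(BE k (daY t Yy)); apply: contrapT => nk; apply: nU; exists k => //.
  case: asboolP => Ck /=.
    by move=> Bk; apply: nk.
  by apply: contrapT => nB; apply: nk.
have [j [j0 _ mj]] := nonmeager_decided bU bD openT nD.
exists j; split => //; split => // k _.
have [Ck|nCk] := pselect (C k (z n)); [left|right]; apply: meager_sub mj => t [jt].
  by move=> nB; split=> // Dt; apply: nB; apply/(BE k (daY t Yy)); rewrite Dt.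
by move=> /(BE k (daY t Yy)) Bt; split=> // Dt; apply: nCk; rewrite -Dt.
Qed.

Let gen_in_out W k y : open W -> W !=set0 -> gen_in W k y -> ~ gen_out W k y.
Proof. by move=> oW W0; exact: baire_nonmeager. Qed.

(** If f (t x) and f (t y) have the same generic value along W, they agree for some
    common t, and then t x and t y are in the same orbit. *)
Let gen_orbit W x y : open W -> W !=set0 -> gen_const W x -> gen_const W y ->
  (forall k, gen_in W k x <-> gen_in W k y) -> exists t, y = da t x.
Proof.
move=> oW W0 [Yx cx] [Yy cy] xy.
have mbad : meager (\bigcup_k ((W `&` [set t | ~ (B k (da t x) <-> gen_in W k x)]) `|`
    (W `&` [set t | ~ (B k (da t y) <-> gen_in W k x)]))).
  apply: meager_bigcup => k; apply: meagerU.
    have [ik|ok] := cx k I.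
      by apply: meager_sub (ik) => t [Wt nB]; split=> // Bt; apply: nB; split.
    apply: meager_sub (ok) => t [Wt nB]; split => //=; apply: contrapT => nBt.
    by apply: nB; split=> // ik; exfalso; exact: gen_in_out ok.
  have [ik|ok] := cy k I.
    by apply: meager_sub (ik) => t [Wt nB]; split=> // Bt; apply: nB; split=> // _; exact/xy.
  apply: meager_sub (ok) => t [Wt nB]; split => //=; apply: contrapT => nBt.
  by apply: nB; split=> // ik; exfalso; apply: gen_in_out ok => //; exact/xy.
have [s [Ws good]] : exists s, W s /\ forall k, (B k (da s x) <-> gen_in W k x) /\
    (B k (da s y) <-> gen_in W k x).
  apply: contrapT => /forallNP none; apply: (bT oW W0); apply: meager_sub mbad => t Wt.
  have /not_andP[//|/existsNP[k /not_andP[nk|nk]]] := none t.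
    by exists k => //; left.
  by exists k => //; right.
have fxy : f (da s x) = f (da s y).
  apply: iC; apply/funext => k; apply: asbool_equiv_eq.
  rewrite -(BE k (daY s Yx)) -(BE k (daY s Yy)).
  by have [xk yk] := good k; rewrite xk yk.
have [t tE] : exists t, da s y = da t (da s x).
  by apply/red; [exact: daY|exact: daY|rewrite fxy].
by exists (s^-1 * (t * s)); rewrite !daM -tE daV.
Qed.

(** For t in N the translate W t is contained in V, and s -> s t preserves category,
    so the generic value of y along V is that of t y along W. *)
Let gen_shift V W (N : set T) t y : (forall w n, W w -> N n -> V (w * n)) -> N t ->
  gen_const V y ->
  gen_const W (da t y) /\ forall k, (gen_in V k y -> gen_in W k (da t y)) /\
    (gen_out V k y -> gen_out W k (da t y)).
Proof.
move=> WN Nt [Yy cy].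
have shift k : (gen_in V k y -> gen_in W k (da t y)) /\
    (gen_out V k y -> gen_out W k (da t y)).
  split=> /(@meager_mulr _ H t); apply: meager_sub => s [Ws]; rewrite /= -daM => Bs;
    by split => //; exact: WN.
split => //; split; first exact: daY.
by move=> k _; have [/(shift k).1|/(shift k).2] := cy k I; [left|right].
Qed.

(** For elements g of N, the translates g y of a point y of a fixed set of positive
    measure have the same generic value along U w as y along U j0, so they have
    the same representative s. The label of g y records, for k < m, a basic set
    close to the preimage of A k under the element t with g y = t (s y).
    Countably many labels cover a set of large measure, so finitely many almost
    do; among enough elements of N two, g i and g j, produce the same label for a
    common y, say with elements t and t'. Preimages under t and t' are then
    close, and these elements differ from g i and g j by the same right factor. *)
Theorem totally_bounded_nbhd : exists N : set T, [/\ open N, N (tone H) &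
  forall (A : nat -> set X) (m : nat) (e : R), (forall k, measurable (A k)) -> 0 < e ->
  exists M, forall g : nat -> T, (forall n, N (g n)) ->
  exists i j, (i < j < M)%N /\ forall k, (k < m)%N ->
    md mu (act (g i) @^-1` A k) (act (g j) @^-1` A k) < e].
Proof.
have [j0 [j0n j0pos]] : exists j, U j !=set0 /\ 0 < pr muN (gen_const (U j)).
  apply: contrapT => /forallNP none.
  pose Q n := if unpickle n is Some j then
    if `[< U j !=set0 >] then gen_const (U j) else set0 else set0.
  have mQ n : measurable (Q n) by rewrite /Q; case: unpickle => // j; case: ifP.
  have := basis_dense_conull ib muN_prod.
  suff -> : pr muN (basis_dense mu b) = 0 by lra.
  apply/eqP; rewrite eq_le pr_ge0 andbT -(pr_bigcup0 (mu := muN) mQ).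
    apply: le_pr => //; first exact: bigcupT_measurable.
    move=> y /gen_const_cover[j [jn jy]]; exists (pickle j) => //.
    by rewrite /Q pickleK asboolT.
  move=> n; rewrite /Q; case: unpickle => [j|]; last exact: pr0.
  case: asboolP => jn; last exact: pr0.
  apply/eqP; rewrite eq_le pr_ge0 andbT leNgt; apply/negP => jpos.
  exact: (none j).
have [v jv] := j0n; have jv1 : U j0 (v * tone H) by rewrite tmul1.
have [V1 [N [oV1 oN V1v N1 VN]]] := tmul_open (oU j0) jv1.
have [w [wv wV]] := bU.2 _ _ oV1 V1v.
have WN s t : U w s -> N t -> U j0 (s * t) by move=> /wV; exact: VN.
have w0 : U w !=set0 by exists v.
exists N; split => // A m e mA e0.
pose a := pr muN (gen_const (U j0)); have a0 : 0 < a / 4 by rewrite divr_gt0.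
(* With gen_const as coordinate 0, points with the same E-code as a point of
   gen_const (U w) are in gen_const (U w) as well. *)
pose E k := if k is k'.+1 then gen_in (U w) k' else gen_const (U w).
have mE k : measurable (E k) by case: k => [|k]; [exact: measurable_gen_const|exact: measurable_gen_in].
have [GN tGN] := product_coding muN_prod tG.
have [K0 [s [mK0 K0a sK0 sE ms]]] := code_section tGN mE a0.
pose K := K0 `&` gen_const (U w).
have mK : measurable K by exact: measurableI.
have EP x y : code E x = code E y ->
    (gen_const (U w) x <-> gen_const (U w) y) /\
    forall k, gen_in (U w) k x <-> gen_in (U w) k y.
  move=> xy; split=> [|k]; first exact: (eq_code (congr1 (@^~ 0%N) xy)).
  exact: (eq_code (congr1 (@^~ k.+1) xy)).
have sK y : K y -> gen_const (U w) (s y) /\ exists t, y = da t (s y).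
  move=> [K0y cy]; have [K0s sy] := sK0 y K0y.
  have [c1 c2] := EP _ _ sy; have csy : gen_const (U w) (s y) by apply/c1.
  by split => //; apply: gen_orbit => //.
have e8 : 0 < e / 8 by rewrite divr_gt0.
have e16 : 0 < e / 16 by rewrite divr_gt0.
have /choice[ap apP] k := ib_approx ib tG (mA k) e8.
have mb i : measurable (b i) := ib_meas ib i.
(* If b l misses b k' as tested by y and s y, then b l is almost contained in
   the preimage of b (ap k) by the element that takes s y to y. *)
pose miss k l : set (seq_space X) := \bigcup_k' (if `[< ~` b k' `<=` b (ap k) >] then
  \bigcap_n ~` (s @^-1` [set y | b l (y n)] `&` [set y | b k' (y n)]) else set0).
(* A basic set almost contained in that preimage, and of almost the same measure,
   is close to it. *)
pose lab k l : set (seq_space X) :=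
  if pr mu (b (ap k)) - e / 8 < pr mu (b l) then K `&` miss k l else set0.
have mlab k l : measurable (lab k l).
  rewrite /lab; case: ifP => // _; rewrite /K /miss -setIA (setIC (gen_const _)) setIA.
  apply: measurableI => //.
  rewrite setI_bigcupr; apply: measurable_bigcup_countType => k'.
  case: asboolP => _; last by rewrite setI0.
  rewrite (_ : _ `&` _ = \bigcap_n (K0 `\` ((K0 `&` s @^-1` [set y | b l (y n)]) `&`
      [set y | b k' (y n)]))).
    apply: bigcapT_measurable => n; apply: measurableD => //; apply: measurableI.
      by apply: ms; exact: measurable_coord.
    exact: measurable_coord.
  apply/seteqP; split=> y.
    by move=> [Ky ny] n _; split => // -[[_ sy] yn]; exact: (ny n).
  move=> ny; split; first by have [] := ny 0%N I.
  by move=> n _ [sy yn]; have [Ky +] := ny n I; apply.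
pose Lab (l : {ffun 'I_m -> Ix}) :=
  K `\` \bigcup_(k in [set: 'I_m]) ~` lab k (l k).
have mLab l : measurable (Lab l).
  apply: measurableD => //; apply: measurable_bigcup_countType => k.
  exact: measurableC.
have lab_ex k y : K y -> exists l, lab k l y.
  move=> Ky; have [csy [t yt]] := sK y Ky; have Ysy : Y (s y) by have [] := csy.
  have [j [k' [jk k'o jo]]] := ib_reg_approx mu ib (ap k) e16.
  have [l [lj jl]] := ib_act_approx ib mp t j e16.
  exists l; rewrite /lab ifT; last by lra.
  split=> //; exists k' => //; rewrite asboolT// => n _ [/= sy yn].
  by apply: (jk _ (lj _ sy)); rewrite yt in yn.
have Lab_ex y : K y -> exists l, Lab l y.
  move=> Ky; have /choice[l lP] := fun k => lab_ex k y Ky.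
  exists [ffun k : 'I_m => l k]; split=> // -[k _]; apply; rewrite ffunE; exact: lP.
have mact t (S : set X) : measurable S -> measurable (act t @^-1` S).
  by move=> mS; rewrite -[X in measurable X]setTI; exact: (mp t).1.
have lab_close k l y t : lab k l y -> y = da t (s y) ->
    md mu (act t @^-1` b (ap k)) (b l) < e / 8.
  rewrite /lab; case: ifP => // l_big [Ky [k' _]]; case: asboolP => // k'o nmiss yt.
  have [[Ysy _] _] := sK y Ky.
  have null : pr mu (b l `&` act t @^-1` b k') = 0.
    apply: (basis_dense_miss ib mp Ysy) => n [sy yn].
    by apply: (nmiss n I); split => //=; rewrite yt.
  set O := act t @^-1` b (ap k); have mO : measurable O by exact: mact.
  have prO : pr mu O = pr mu (b (ap k)) by rewrite /pr /O (mp t).2.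
  have mlk' : measurable (b l `&` act t @^-1` b k') by apply: measurableI => //; exact: mact.
  have lO : pr mu (b l `\` O) = 0.
    apply/eqP; rewrite eq_le pr_ge0 andbT -null; apply: le_pr => //.
      exact: measurableD.
    move=> x [lx nOx]; split=> //=; apply: contrapT => nk'; apply: nOx; exact: k'o.
  have lI : pr mu (b l) <= pr mu (O `&` b l).
    have := pr_le_D mu (mb l) (measurableI _ _ mO (mb l)).
    by rewrite setIC setDIr setDv set0U lO addr0 [b l `&` O]setIC.
  have mOl : measurable (O `\` b l) by exact: measurableD.
  have Ol : pr mu (O `\` b l) = pr mu O - pr mu (O `&` b l).
    have mI : measurable (O `&` b l) by exact: measurableI.
    by rewrite -prD//; congr pr; rewrite setDIr setDv set0U.
  rewrite /md setY_def.
  apply: le_lt_trans (prU_le mu mOl (measurableD (mb l) mO)) _.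
  by rewrite lO addr0 Ol; lra.
pose Ln p := if unpickle p is Some l then Lab l else set0.
have mLn p : measurable (Ln p) by rewrite /Ln; case: unpickle.
have [n0 n0P] := pr_bigcup_approx muN mLn a0.
have LnK : \bigcup_p Ln p = K.
  apply/seteqP; split=> y.
    by move=> [p _]; rewrite /Ln; case: unpickle => // l [].
  by move=> /Lab_ex[l ly]; exists (pickle l) => //; rewrite /Ln pickleK.
rewrite LnK in n0P; pose L := \bigcup_(p < n0) Ln p.
have mL : measurable L by exact: bigcup_measurable.
have LK : L `<=` K by move=> y [p _ Ly]; rewrite -LnK; exists p.
have mcw := measurable_gen_const w; have mcj := measurable_gen_const j0.
have cwL : pr muN (gen_const (U w) `\` L) < a / 2.
  have mD : measurable (~` K0 `|` (K `\` L)) by mset.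
  apply: (le_lt_trans (le_pr muN (measurableD mcw mL) mD _)).
    move=> y [cy nLy]; have [K0y|nK0y] := pselect (K0 y); last by left.
    by right.
  apply: le_lt_trans (prU_le muN (measurableC mK0) (measurableD mK mL)) _.
  rewrite prC// prD// -/L in n0P *; rewrite -/L in n0P; lra.
have mda t (S : set (seq_space X)) : measurable S -> measurable (da t @^-1` S).
  by move=> mS; rewrite -[X in measurable X]setTI; exact: (da_pres t).1.
(* Each g i sends a part of measure at least a / 2 of gen_const (U j0) into the
   first n0 labelled sets. *)
exists (Num.truncn (n0%:R / (a / 2))).+1; set M := _.+1 => g gN.
pose Q i p := gen_const (U j0) `&` da (g i) @^-1` Ln p.
have [|||i [j [p [y [ij jM pn [cy Liy] [_ Ljy]]]]]] := @pigeonhole_pr _ _ _ muN n0 M (a / 2) Q.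
- by move=> i p; apply: measurableI => //; exact: mda.
- move=> i _; have -> : \bigcup_(p < n0) Q i p = gen_const (U j0) `&` da (g i) @^-1` L.
    by rewrite /Q -setI_bigcupr preimage_bigcup.
  have mI : measurable (gen_const (U j0) `&` da (g i) @^-1` L).
    by apply: measurableI => //; exact: mda.
  have := pr_le_D muN mcj mI; rewrite -/a setDIr setDv set0U.
  suff : pr muN (gen_const (U j0) `\` da (g i) @^-1` L) < a / 2 by lra.
  have mcwL : measurable (gen_const (U w) `\` L) by exact: measurableD.
  apply: le_lt_trans cwL; rewrite -[leRHS]/(fine (muN _)) -(da_pres (g i)).2//.
  apply: le_pr; [by apply: measurableD => //; exact: mda|exact: mda|].
  move=> z [cz nLz]; split => //.
  by have [] := gen_shift WN (gN i) cz.
- have a2 : 0 < a / 2 by rewrite divr_gt0.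
  by rewrite -ltr_pdivrMr// /M truncnS_gt.
exists i, j; split; first by rewrite ij.
have Yy : Y y by have [] := cy.
move: Liy Ljy; rewrite /= /Ln; case: unpickle => // l [Ki li] [Kj lj] k km.
have labi : lab k (l (Ordinal km)) (da (g i) y).
  by apply: contrapT => h; apply: li; exists (Ordinal km).
have labj : lab k (l (Ordinal km)) (da (g j) y).
  by apply: contrapT => h; apply: lj; exists (Ordinal km).
have codeij : code E (da (g i) y) = code E (da (g j) y).
  have [ci1 ci2] := gen_shift WN (gN i) cy; have [cj1 cj2] := gen_shift WN (gN j) cy.
  apply/funext => -[|k']; apply: asbool_equiv_eq; first by split.
  have nio z : gen_in (U w) k' z -> ~ gen_out (U w) k' z by exact: gen_in_out.
  have [_ /(_ k' I)[ik|ok]] := cy.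
    by split=> _; [apply: (cj2 k').1|apply: (ci2 k').1].
  by split=> /nio h; exfalso; apply: h; [exact: (ci2 k').2|exact: (cj2 k').2].
have sij : s (da (g i) y) = s (da (g j) y).
  by apply: sE => //; [have [] := Ki|have [] := Kj].
have [[Ys _] [t ti]] := sK _ Ki; have [_ [t' tj]] := sK _ Kj.
have ci := lab_close _ _ _ _ labi ti; have cj := lab_close _ _ _ _ labj tj.
rewrite -sij in tj; have gij : g j = t' * (t^-1 * g i).
  apply: (free2 Yy); rewrite !daM tj; congr (da t' _).
  by rewrite [X in da (t^-1) X]ti daV.
have mAk := mA k.
have m1 := mact t _ mAk; have m2 := mact t' _ mAk.
have tt' : md mu (act t @^-1` A k) (act t' @^-1` A k) < e.
  have apk := apP k; have mbk := mb (ap k); have mbl := mb (l (Ordinal km)).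
  have At := md_preim (mp t) mAk mbk; have At' := md_preim (mp t') mAk mbk.
  have m3 := mact t _ mbk; have m4 := mact t' _ mbk.
  have d1 := md_trans mu m1 m3 m2; have d2 := md_trans mu m3 mbl m2.
  have d3 := md_trans mu mbl m4 m2.
  have s1 := mdC mu (b (l (Ordinal km))) (act t' @^-1` b (ap k)).
  have s2 := mdC mu (act t' @^-1` b (ap k)) (act t' @^-1` A k).
  rewrite s1 s2 in d3.
  lra.
rewrite (_ : md mu (act (g i) @^-1` A k) (act (g j) @^-1` A k) = md mu (act t @^-1` A k) (act t' @^-1` A k)); first exact: tt'.
have gi : act (g i) = act t \o act (t^-1 * g i).
  by apply/funext => x; rewrite /= -actM tmulA tmulV tmul1l.
have gj : act (g j) = act t' \o act (t^-1 * g i).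
  by apply/funext => x; rewrite gij /= actM.
by rewrite gi gj; exact: (md_preim (mp (t^-1 * g i)) m1 m2).
Qed.

End reduction.
End counting.

(** * Complete systems of balls *)

(** If dist is a complete metric inducing the topology, the relations
    dist s t <= 2^-n satisfy these axioms. *)
Record complete_balls (T : topologicalType) (cl : nat -> T -> T -> Prop) : Prop :=
  CompleteBalls {
  cl_refl : forall n t, cl n t t;
  cl_sym : forall n s t, cl n s t -> cl n t s;
  cl_mono : forall m n s t, (m <= n)%N -> cl n s t -> cl m s t;
  cl_trans : forall n r s t, cl n.+1 r s -> cl n.+1 s t -> cl n r t;
  cl_nbhs : forall n t, nbhs t (cl n t);
  nbhs_cl : forall t O, nbhs t O -> exists n, cl n t `<=` O;
  cl_complete : forall h : nat -> T, (forall n, cl n.+2 (h n) (h n.+1)) ->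
    exists t, forall n, cl n.+1 (h n) t }.

Section complete_balls.
Context (T : topologicalType) (cl : nat -> T -> T -> Prop).
Hypothesis cT : complete_balls cl.

Lemma complete_balls_baire : baire T.
Proof.
move=> W oW [t0 Wt0] [Q QP WQ].
(* A state (n, (t, m)) is the ball of index m around t, to be shrunk to a ball
   inside the n-th dense open set. *)
have step (x : nat * (T * nat)) : exists p : T * nat,
    (x.2.2 < p.2)%N /\ forall s, cl p.2 p.1 s -> Q x.1 s /\ cl x.2.2.+2 x.2.1 s.
  case: x => n [t m] /=; have [oQ dQ] := QP n.
  have [|s [clO Qs]] := dQ _ _ (open_interior (cl m.+2 t)).
    by exists t; apply: nbhs_singleton; apply: nbhs_interior; exact: cl_nbhs cT _ _.
  have nO : nbhs s ((cl m.+2 t)° `&` Q n).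
    by apply: open_nbhs_nbhs; split; [apply: openI => //; exact: open_interior|].
  have [k kO] := nbhs_cl cT nO.
  exists (s, maxn m.+1 k); split => /=; first by rewrite leq_maxl.
  move=> r /(cl_mono cT (leq_maxr m.+1 k)) /kO[clr Qr]; split=> //.
  exact: interior_subset clr.
have [next nextP] := choice step.
have [m0 m0W] := nbhs_cl cT (open_nbhs_nbhs (conj oW Wt0)).
pose x n := nat_rect _ (t0, m0) (fun n p => next (n, p)) n.
have xS n : ((x n).2 < (x n.+1).2)%N /\ forall s, cl (x n.+1).2 (x n.+1).1 s ->
    Q n s /\ cl (x n).2.+2 (x n).1 s := nextP (n, x n).
have xn n : (n <= (x n).2)%N.
  by elim: n => // n IH; exact: leq_ltn_trans IH (xS n).1.
have nested n j s : (n <= j)%N -> cl (x j.+1).2 (x j.+1).1 s ->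
    Q n s /\ cl (x n).2.+2 (x n).1 s.
  move=> /subnK <-; elim: (j - n)%N s => [|i IH] s; first exact: (xS n).2.
  rewrite addSn => /(xS _).2[_ +]; move=> c; apply: IH.
  by apply: cl_mono cT _ _ _ _ _ c; rewrite leqW// leqW.
have [n|t tP] := cl_complete cT (h := fun n => (x n).1).
  have [_ +] := (xS n).2 (x n.+1).1 (cl_refl cT _ _).
  by apply: (cl_mono cT); rewrite !ltnS.
have tC n : cl (x n).2 (x n).1 t.
  apply: (cl_mono cT (leqnSn _)); pose j := maxn n (x n).2.
  apply: (cl_trans cT) (nested n j (x j.+1).1 (leq_maxl _ _) (cl_refl cT _ _)).2 _.
  by apply: (cl_mono cT) (tP _); rewrite !ltnS leq_maxr.
have [n _] := WQ t (m0W t (tC 0%N)); apply.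
exact: ((xS n).2 t (tC n.+1)).1.
Qed.

(** A totally bounded closed set is compact: an ultrafilter on it contains a ball of
    every radius, and the centers form a Cauchy sequence. *)
Lemma complete_balls_compact (K : set T) : closed K ->
  (forall n, exists s : seq T, forall t, K t -> exists2 r, r \in s & cl n r t) ->
  compact K.
Proof.
move=> cK tb; rewrite compact_ultra => V UV VK.
have /choice[h hV] n : exists t, V (cl n.+3 t).
  have [s sK] := tb n.+3.
  apply: contrapT => /forallNP none.
  have : V (K `&` [set t | forall r, r \in s -> ~ cl n.+3 r t]).
    apply: filterI => //; elim: s {sK} => [|r s IH]; first exact: filterS filterT.
    have nr : V (~` cl n.+3 r) by have [/none|] := in_ultra_setVsetC (cl n.+3 r) UV.
    by apply: filterS2 IH nr => t st rt r'; rewrite inE => /orP[/eqP->|/st].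
  move=> /filter_ex[t [Kt tP]]; have [r rs rt] := sK t Kt.
  exact: tP rt.
have [n|t tP] := cl_complete cT (h := h).
  have [r [r1 r2]] : (cl n.+3 (h n) `&` cl n.+4 (h n.+1)) !=set0.
    by apply: (filter_ex (F := V)); exact: filterI.
  apply: (cl_trans cT) r1 _; apply: (cl_sym cT).
  by apply: (cl_mono cT) r2.
have Vt : V --> t.
  move=> O /(nbhs_cl cT)[n nO]; apply: filterS (hV n.+1) => r nr; apply: nO.
  apply: (cl_trans cT (s := h n.+1)).
    by apply: (cl_sym cT); apply: (cl_mono cT) (tP n.+1).
  by apply: (cl_mono cT) nr; rewrite -(addn3 n.+1) leq_addr.
by exists t; split => //; apply: (closed_cvg K cK _ _ Vt) => //; exact: VK.
Qed.

Lemma closure_cl n t : closure (cl n.+1 t) `<=` cl n t.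
Proof.
move=> r /(_ _ (cl_nbhs cT n.+1 r))[s [ts rs]].
exact: (cl_trans cT) ts (cl_sym cT rs).
Qed.

End complete_balls.

Section greedy.
Context (T : choiceType) (N : set T) (near : T -> T -> Prop).

(** If there were no finite net, points of N could be chosen one after another, each
    far from all the previous ones. *)
Lemma finite_net :
  (forall g : nat -> T, (forall n, N (g n)) -> exists i j, (i < j)%N /\ near (g i) (g j)) ->
  exists s : seq T, forall t, N t -> exists2 r, r \in s & near r t.
Proof.
move=> H; apply: contrapT => /forallNP none.
have /choice[next nextP] (s : seq T) : exists t, N t /\ forall r, r \in s -> ~ near r t.
  have /existsNP[t /not_implyP[Nt nt]] := none s.
  by exists t; split=> // r rs rt; apply: nt; exists r.
pose l n := iter n (fun s => next s :: s) [::].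
have lin i j : (i < j)%N -> next (l i) \in l j.
  elim: j => // j IH; rewrite ltnS leq_eqVlt => /orP[/eqP->|/IH ij] /=.
    by rewrite mem_head.
  by rewrite inE ij orbT.
have [n|i [j [ij]]] := H (fun n => next (l n)); first exact: (nextP _).1.
by apply: (nextP (l j)).2; exact: lin.
Qed.

End greedy.

Section locally_compact.
Context (T : topologicalType) (H : topgroup T) (cl : nat -> T -> T -> Prop).
Hypothesis cT : complete_balls cl.
Variable near : nat -> T -> T -> Prop.
Hypotheses (near_sym : forall n s t, near n s t -> near n t s)
  (near_trans : forall n r s t, near n.+1 r s -> near n.+1 s t -> near n r t)
  (cl_near : forall n s t, near n s t -> near n (tinv H s) (tinv H t) -> cl n s t).

(** The relations near are one-sided: total boundedness of N controls t alone. On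
    the intersection of N with its inverse it controls t and its inverse, which
    amounts to total boundedness for the complete relations cl. *)
Lemma locally_compact_nbhd (N : set T) : nbhs (tone H) N ->
  (forall n (g : nat -> T), (forall k, N (g k)) ->
    exists i j, (i < j)%N /\ near n (g i) (g j)) ->
  locally_compact [set: T].
Proof.
move=> nN tbN.
have inv1 : tinv H (tone H) = tone H by rewrite -[LHS](tmul1l H) tmulV.
have nN' : nbhs (tone H) (N `&` [set t | N (tinv H t)]).
  by apply: filterI => //; apply: (@tinv_cont _ H (tone H)); rewrite inv1.
have [n nNN] := nbhs_cl cT nN'.
pose C := closure (cl n.+1 (tone H)).
have CN t : C t -> N t /\ N (tinv H t) by move=> /(closure_cl cT) /nNN.
have cC : closed C by exact: closed_closure.
have Ccompact : compact C.
  apply: (complete_balls_compact cT) => // m.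
  have [s sP] := finite_net (tbN m.+1).
  pose P (p : T * T) t := [/\ C t, near m.+1 p.1 t & near m.+1 p.2 (tinv H t)].
  have /choice[f fP] p : exists t, forall t', P p t' -> P p t.
    have [[t Pt]|nP] := pselect (exists t, P p t); first by exists t.
    by exists p.1 => t' Pt'; exfalso; apply: nP; exists t'.
  exists [seq f p | p <- allpairs pair s s] => t Ct; have [Nt Nt'] := CN t Ct.
  have [r rs rt] := sP t Nt; have [r' rs' rt'] := sP _ Nt'.
  have [_ fr fr'] := fP (r, r') t (And3 Ct rt rt').
  exists (f (r, r')).
    by apply: map_f; apply/allpairsP; exists (r, r').
  by apply: cl_near; [exact: near_trans (near_sym fr) rt|exact: near_trans (near_sym fr') rt'].
move=> x _; pose K := [set t | C (tmul H t (tinv H x))].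
have rcont g : continuous ((tmul H)^~ g).
  by apply/continuousP => O; exact: tmulr_open.
exists K.
  apply: filterS (_ : nbhs x K); first by move=> t Kt _.
  apply: (rcont (tinv H x)); rewrite tmulV.
  by apply: filterS (cl_nbhs cT n.+1 (tone H)); exact: subset_closure.
split; last by apply: closed_comp => // t _; exact: rcont.
rewrite (_ : K = (tmul H)^~ x @` C).
  by apply: continuous_compact => //; apply: continuous_subspaceT; exact: rcont.
apply/seteqP; split=> [t Kt|_ [t Ct <-]]; last by rewrite /K/= tmulK.
by exists (tmul H t (tinv H x)) => //; rewrite tmulVK.
Qed.

End locally_compact.

(** * Limits of measure preserving maps *)

Section law.
Context (R : realType) d (X : measurableType d) (mu : probability X R).

Lemma md_mkseq_code (B C : nat -> set X) n (Q : seq bool -> Prop) :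
  (forall k, measurable (B k)) -> (forall k, measurable (C k)) ->
  md mu [set x | Q (mkseq (code B x) n)] [set x | Q (mkseq (code C x) n)] <=
  \sum_(k < n) md mu (B k) (C k).
Proof.
move=> mB mC; have mY k : measurable (B k `+` C k) by exact: measurableY.
have mU m : measurable (\bigcup_(k < m) (B k `+` C k)) by exact: bigcup_measurable.
apply: (@le_trans _ _ (pr mu (\bigcup_(k < n) (B k `+` C k)))).
  apply: md_le; [exact: measurable_mkseq_code|exact: measurable_mkseq_code|exact: mU|].
  move=> x BCx; apply: contrapT => nU.
  suff e : mkseq (code B x) n = mkseq (code C x) n.
    by rewrite setY_def in BCx; case: BCx => -[] /=; rewrite e.
  apply: (@eq_from_nth _ false); rewrite !size_mkseq// => k kn.
  rewrite !nth_mkseq//; apply: asbool_equiv_eq; apply: contrapT => nBC; apply: nU.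
  exists k => //; rewrite setY_def.
  have [Bx|nBx] := pselect (B k x); have [Cx|nCx] := pselect (C k x).
  - by exfalso; apply: nBC.
  - by left.
  - by right.
  - by exfalso; apply: nBC.
exact: (pr_bigcup_le_sum mu n mY).
Qed.

End law.

Section limit_map.
Context (R : realType) d (X : measurableType d) (mu : probability X R).
Variable G : nat -> set X.
Hypothesis tG : tight_coding mu G.
Variable f : nat -> X -> X.
Hypothesis mp : forall n, measure_preserving mu (f n).
Hypothesis fast : forall k, exists N, forall n, (N <= n)%N ->
  md mu (f n @^-1` G k) (f n.+1 @^-1` G k) <= (2 ^ n.+1)%:R^-1.

Let mG k : measurable (G k). Proof. exact: coding_meas tG k. Qed.

Let mf n A : measurable A -> measurable (f n @^-1` A).
Proof. by move=> mA; rewrite -[X in measurable X]setTI; exact: (mp n).1. Qed.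

(** The codes of f n x converge almost surely; C k is the k-th coordinate of the
    lower limit, which makes sense for all x. *)
Let C k := \bigcup_N \bigcap_(n in [set n | (N <= n)%N]) f n @^-1` G k.

Let mC k : measurable (C k).
Proof.
apply: bigcupT_measurable => N; apply: bigcap_measurableType => // n _.
exact: mf.
Qed.

(** The errors from n on are summable, by the Borel-Cantelli argument. *)
Let C_close k : exists N, forall n, (N <= n)%N ->
  md mu (C k) (f n @^-1` G k) <= (2 ^ n)%:R^-1.
Proof.
have [N HN] := fast k; exists N => n Nn.
pose D m := f (n + m)%N @^-1` G k `+` f (n + m).+1 @^-1` G k.
have mD m : measurable (D m) by apply: measurableY; exact: mf.
apply: (@le_trans _ _ (pr mu (\bigcup_m D m))).
  apply: md_le => //; [exact: mf|exact: bigcupT_measurable|].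
  move=> x CGx; apply: contrapT => nD.
  have sameE m : G k (f (n + m)%N x) <-> G k (f n x).
    elim: m => [|m IH]; first by rewrite addn0.
    apply: iff_trans IH; rewrite addnS.
    by split=> Gx; apply: contrapT => nG; apply: nD; exists m => //;
      rewrite /D setY_def; [right|left].
  rewrite setY_def in CGx; case: CGx => -[].
    move=> [M _ MP]; apply; apply/(sameE M); apply: MP => /=; exact: leq_addl.
  move=> Gx; apply; exists n => // m /= nm; rewrite -(subnKC nm); exact/sameE.
apply: pr_bigcup_le => // m.
rewrite -[leLHS]/(md mu (f (n + m)%N @^-1` G k) (f (n + m).+1 @^-1` G k)).
apply: le_trans (HN _ (leq_trans Nn (leq_addr _ _))) _.
by rewrite -invfM -natrM -expnD addnS.
Qed.

Let C_approx n (Q : seq bool -> Prop) (e : R) : 0 < e -> exists N, forall l, (N <= l)%N ->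
  md mu [set x | Q (mkseq (code C x) n)]
        (f l @^-1` [set x | Q (mkseq (code G x) n)]) < e.
Proof.
move=> e0; have [N HN] : exists N, forall k l, (k < n)%N -> (N <= l)%N ->
    md mu (C k) (f l @^-1` G k) <= (2 ^ l)%:R^-1.
  elim: n => [|n [N IH]]; first by exists 0%N.
  have [N' HN'] := C_close n; exists (maxn N N') => k l.
  rewrite ltnS geq_max leq_eqVlt => /orP[/eqP->|kn] /andP[Nl N'l]; first exact: HN'.
  exact: IH.
have [M Me] : exists M, forall l, (M <= l)%N -> n%:R * ((2 ^ l)%:R^-1 : R) < e.
  have n1 : 0 < n.+1%:R :> R by rewrite ltr0n.
  have [M HM] := ltr_add_invr (divr_gt0 e0 n1); rewrite add0r in HM.
  exists M => l Ml; apply: (@le_lt_trans _ _ (n.+1%:R * M.+1%:R^-1)); last first.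
    by rewrite mulrC -ltr_pdivlMr.
  apply: ler_pM => //; rewrite ?invr_ge0 ?ler0n ?ler_nat//.
  rewrite lef_pV2 ?posrE ?ltr0n ?expn_gt0// ler_nat.
  by apply: leq_trans (_ : l.+1 <= _)%N; rewrite // ltn_expl.
exists (maxn N M) => l; rewrite geq_max => /andP[Nl Ml].
have := @md_mkseq_code _ _ _ mu C (fun k => f l @^-1` G k) n Q mC (fun k => mf l (mG k)).
move=> /le_lt_trans; apply; apply: le_lt_trans (Me l Ml).
apply: (@le_trans _ _ (\sum_(k < n) (2 ^ l)%:R^-1)); first by apply: ler_sum => k _; exact: HN.
by rewrite sumr_const card_ord mulr_natl.
Qed.

Let mGQ n (Q : seq bool -> Prop) : measurable [set x | Q (mkseq (code G x) n)].
Proof. exact: measurable_mkseq_code. Qed.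

Let mCQ n (Q : seq bool -> Prop) : measurable [set x | Q (mkseq (code C x) n)].
Proof. exact: measurable_mkseq_code. Qed.

(** A code has the same law under C as under G, as each f n preserves mu and the
    codes of f n x approach those given by C. *)
Let C_law n (Q : seq bool -> Prop) :
  pr mu [set x | Q (mkseq (code C x) n)] = pr mu [set x | Q (mkseq (code G x) n)].
Proof.
apply/eqP; rewrite eq_le; apply/andP; split; apply/ler_addgt0Pr => e e0;
  have [N /(_ N (leqnn N)) HN] := C_approx n Q e0;
  have prf : pr mu (f N @^-1` [set x | Q (mkseq (code G x) n)]) =
    pr mu [set x | Q (mkseq (code G x) n)] by rewrite /pr (mp N).2.
  rewrite -prf; apply: le_trans (pr_le_md mu (mCQ n Q) (mf N (mGQ n Q))) _.
  by rewrite lerD2l ltW.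
rewrite -prf; apply: le_trans (pr_le_md mu (mf N (mGQ n Q)) (mCQ n Q)) _.
by rewrite lerD2l mdC ltW.
Qed.

(** The points to which C assigns a code that K realizes at every finite stage. *)
Let good_part (K : set X) :=
  \bigcap_n [set x | exists2 y, K y & mkseq (code G y) n = mkseq (code C x) n].

Let m_good_part K : measurable (good_part K).
Proof.
apply: bigcapT_measurable => n.
exact: (mCQ n (fun s => exists2 y, K y & mkseq (code G y) n = s)).
Qed.

Let pr_good_part K : measurable K -> pr mu K <= pr mu (good_part K).
Proof.
move=> mK; apply/ler_addgt0Pr => e e0.
pose W n := [set x | exists2 y, K y & mkseq (code G y) n = mkseq (code C x) n].
have mW n : measurable (W n).
  exact: (mCQ n (fun s => exists2 y, K y & mkseq (code G y) n = s)).
have niW : nonincreasing_seq W.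
  move=> m n mn; apply/subsetPset => x [y Ky yx]; exists y => //.
  have := congr1 (take m) yx; rewrite /mkseq -!map_take take_iota.
  by rewrite (minn_idPl mn).
have [n] := pr_ni_approx mu mW niW e0; rewrite -/(good_part K) => Wn.
apply: le_trans (ltW Wn); rewrite /W.
rewrite (C_law n (fun s => exists2 y, K y & mkseq (code G y) n = s)).
apply: le_pr => //; last by move=> x Kx; exists x.
exact: (mGQ n (fun s => exists2 y, K y & mkseq (code G y) n = s)).
Qed.

(** The codes given by C have the law of the codes of points, which is concentrated
    on the codes of code-compact sets. So almost every one of them is the code of
    a point. *)
Let good_conull : exists V : set X, [/\ measurable V, pr mu V = 1 &
  forall x, V x -> exists y, code G y = code C x].
Proof.
have m0 m : 0 < m.+1%:R^-1 :> R by rewrite invr_gt0 ltr0n.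
have /choice[K KP] m := coding_tight tG (m0 m).
have mK m : measurable (K m) by have [] := KP m.
have mV : measurable (\bigcup_m good_part (K m)) by exact: bigcupT_measurable.
exists (\bigcup_m good_part (K m)); split => //.
  apply/eqP; rewrite eq_le pr_le1//=.
  suff H (e : R) : 0 < e -> 1 <= pr mu (\bigcup_m good_part (K m)) + e.
    exact/ler_addgt0Pr.
  move=> e0; have [m me] := ltr_add_invr e0; rewrite add0r in me.
  have := le_pr mu (m_good_part (K m)) mV (fun x Gx => ex_intro2 _ _ m I Gx).
  move=> h2; have h1 := pr_good_part (mK m); have [_ _ h3] := KP m.
  rewrite -lerBlDr; apply: le_trans h2; apply: le_trans h1; apply/ltW.
  by apply: le_lt_trans h3; rewrite lerD2l lerN2 ltW.
move=> x [m _ gx]; have [_ cK _] := KP m; have [|y _ yx] := cK (code C x); last by exists y.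
move=> n; have [y Ky yx] := gx n I; exists y => // k kn.
by have := congr1 (fun s => nth false s k) yx; rewrite !nth_mkseq.
Qed.

(** The limit is constructed in the Cantor space, which is compact, and pulled back
    to X: for almost every x, F x is the point whose code is the limit of the codes of
    f n x. *)
Theorem limit_map : exists F : X -> X, measure_preserving mu F /\
  forall A (e : R), measurable A -> 0 < e -> exists N, forall n, (N <= n)%N ->
    md mu (f n @^-1` A) (F @^-1` A) < e.
Proof.
have [V [mV V1 VC]] := good_conull.
have /choice[F FP] x : exists y, (V x -> code G y = code C x) /\ (~ V x -> y = x).
  have [Vx|nVx] := pselect (V x); last by exists x.
  by have [y yx] := VC x Vx; exists y.
have FE A : F @^-1` A = (V `&` F @^-1` A) `|` (~` V `&` A).
  apply/seteqP; split=> x.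
    move=> Ax; have [Vx|nVx] := pselect (V x); first by left.
    by right; split=> //; rewrite -((FP x).2 nVx).
  by move=> [[]//|[nVx Ax]]; rewrite /preimage/= (FP x).2.
have mVF A : measurable A -> measurable (V `&` F @^-1` A).
  move=> mA; apply: (sigma_ind (K := fun A => measurable (V `&` F @^-1` A))
    _ _ _ _ (coding_gen tG mA)).
  - by rewrite preimage_set0 setI0.
  - move=> {mA}A mA; rewrite (_ : _ `&` _ = V `\` (V `&` F @^-1` A)); first by mset.
    by rewrite preimage_setC setDIr setDv set0U setDE.
  - move=> H mH; rewrite preimage_bigcup setI_bigcupr; exact: bigcupT_measurable.
  - move=> _ [k _ <-]; rewrite (_ : _ `&` _ = V `&` C k); first by mset.
    apply/seteqP; split=> x [Vx Gx]; split => //; have xe := (FP x).1 Vx.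
      by move: Gx => /codeP; rewrite xe => /codeP.
    by move: Gx => /codeP; rewrite -xe => /codeP.
have mF A : measurable A -> measurable (F @^-1` A).
  by move=> mA; rewrite FE; apply: measurableU; [exact: mVF|mset].
have FC n Q : md mu (F @^-1` [set x | Q (mkseq (code G x) n)])
    [set x | Q (mkseq (code C x) n)] = 0.
  apply: md_ae => //; first exact: mF.
  have V0 : pr mu (~` V) = 0 by rewrite prC// V1 subrr.
  apply: filterS (pr_eq0_ae (measurableC mV) V0) => x /contrapT Vx.
  by rewrite /preimage/= (FP x).1.
have Fp : measure_preserving mu F.
  apply: (@preserving_pi _ _ _ _ _
    [set A | exists n Q, A = [set x | Q (mkseq (code G x) n)]]) => //.
  - apply/seteqP; split.
      move=> A /(coding_gen tG); move: A.
      apply: smallest_sub; first exact: smallest_sigma_algebra.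
      move=> _ [k _ <-]; apply: sub_sigma_algebra.
      exists k.+1, (fun s => nth false s k); apply/seteqP; split=> x /=;
        by rewrite nth_mkseq// => /codeP.
    apply: smallest_sub; first exact: sigma_algebra_measurable.
    by move=> _ [n [Q ->]].
  - move=> _ _ [n [Q ->]] [m [P ->]].
    have takeE k l x : (k <= l)%N -> take k (mkseq (code G x) l) = mkseq (code G x) k.
      by move=> kl; rewrite /mkseq -map_take take_iota (minn_idPl kl).
    exists (maxn n m), (fun s => Q (take n s) /\ P (take m s)).
    by apply/seteqP; split=> x /=; rewrite !takeE ?leq_maxl ?leq_maxr.
  - move=> _ [n [Q ->]]; rewrite !prE//; last exact: mF.
    congr (_ %:E); rewrite -(C_law n Q).
    have := pr_le_md mu (mF _ (mGQ n Q)) (mCQ n Q); rewrite FC addr0 => le1.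
    have := pr_le_md mu (mCQ n Q) (mF _ (mGQ n Q)); rewrite mdC FC addr0 => le2.
    by apply/eqP; rewrite eq_le le1 le2.
exists F; split=> // A e mA e0; have e4 : 0 < e / 4 by rewrite divr_gt0.
have [n [L AL]] := code_approx tG mG (coding_inj tG) mA e4.
have [N HN] := C_approx n (fun s => s \in L) e4; exists N => l /HN {HN} Cl.
have mS := mGQ n (fun s => s \in L); have mCS := mCQ n (fun s => s \in L).
have FCL := FC n (fun s => s \in L).
set S := [set x | mkseq (code G x) n \in L] in AL mS Cl FCL.
set CS := [set x | mkseq (code C x) n \in L] in mCS Cl FCL.
have d1 := md_trans mu (mf l mA) (mf l mS) (mF _ mA).
have d2 := md_trans mu (mf l mS) mCS (mF _ mA).
have d3 := md_trans mu mCS (mF _ mS) (mF _ mA).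
have s1 := mdC mu (f l @^-1` S) CS; have s2 := mdC mu CS (F @^-1` S).
have s3 := mdC mu (F @^-1` S) (F @^-1` A).
have p1 := md_preim (mp l) mA mS; have p2 := md_preim Fp mA mS.
lra.
Qed.

End limit_map.

Section image.
Context (R : realType) d (X : measurableType d) (mu : probability X R).
Implicit Types (g h : Aut mu) (A B : set X).

Lemma measurable_preim (f : X -> X) A : measure_preserving mu f ->
  measurable A -> measurable (f @^-1` A).
Proof. by move=> [mf _] mA; rewrite -[X in measurable X]setTI; exact: mf. Qed.

Lemma preserving_comp_iter (f : X -> X) n : measure_preserving mu f ->
  measure_preserving mu (iter n f).
Proof.
move=> pf; elim: n => [|n IH]; first exact: measure_preserving_id.
exact: (measure_preserving_comp pf IH).
Qed.

Lemma imgE g A : g @` A = mpinv (repr g) @^-1` A.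
Proof.
apply/seteqP; split=> [_ [x Ax <-]|x Ax]; first by rewrite /preimage/= mpfunK.
by exists (mpinv (repr g) x) => //; exact: mpinvK.
Qed.

Lemma measurable_img g A : measurable A -> measurable (g @` A).
Proof. by move=> mA; rewrite imgE; apply: measurable_preim mA; exact: mpinv_preserving. Qed.

Lemma md_img g A B : measurable A -> measurable B ->
  md mu (g @` A) (g @` B) = md mu A B.
Proof. by move=> mA mB; rewrite !imgE; apply: md_preim => //; exact: mpinv_preserving. Qed.

Lemma preim_img g A : g @^-1` (g @` A) = A.
Proof.
by rewrite imgE; apply/seteqP; split=> x; rewrite /preimage/= mpfunK.
Qed.

Lemma md_preim_ae (f f' : X -> X) A : measurable_fun setT f -> measurable_fun setT f' ->
  {ae mu, forall x, f x = f' x} -> measurable A ->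
  md mu (f @^-1` A) (f' @^-1` A) = 0.
Proof.
move=> mf mf' ff' mA; apply: md_ae.
- by rewrite -[X in measurable X]setTI; exact: mf.
- by rewrite -[X in measurable X]setTI; exact: mf'.
- by apply: filterS ff' => x; rewrite /preimage /= => ->.
Qed.

Let mAut g : measurable_fun setT g. Proof. exact: (Aut_preserving g).1. Qed.

Lemma md_img_mul g h A : measurable A ->
  md mu (Aut_mul g h @` A) (g @` (h @` A)) = 0.
Proof.
move=> mA; have mhA := measurable_img h mA.
rewrite -(md_preim (Aut_preserving (Aut_mul g h))) ?preim_img; [|exact: measurable_img|exact: measurable_img].
rewrite mdC -[X in md _ _ X](preim_img h) -[X in md _ _ (h @^-1` X)](preim_img g).
apply: (@md_preim_ae _ (g \o h)); [exact: mAut|exact: measurableT_comp| |].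
  exact: Aut_mulE.
exact: measurable_img.
Qed.

Lemma md_img_one A : measurable A -> md mu ((Aut_one mu) @` A) A = 0.
Proof.
move=> mA; rewrite -(md_preim (Aut_preserving (Aut_one mu))) ?preim_img//; last exact: measurable_img.
rewrite mdC; exact: (md_preim_ae (mAut _) (@measurable_id _ _ _) (Aut_oneE mu) mA).
Qed.

Lemma md_img_inv g A : measurable A -> md mu (Aut_inv g @` A) (g @^-1` A) = 0.
Proof.
move=> mA; have pg := Aut_preserving g.
rewrite -(md_img g) ?(imgE g (g @^-1` A)); [|exact: measurable_img|exact: measurable_preim].
have -> : mpinv (repr g) @^-1` (g @^-1` A) = A.
  by apply/seteqP; split=> x; rewrite /preimage/= /Aut_to_fun mpinvK.
have mgA := measurable_img (Aut_inv g) mA.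
have m1 := measurable_img g mgA; have m2 := measurable_img (Aut_mul g (Aut_inv g)) mA.
have m3 := measurable_img (Aut_one mu) mA.
have e1 := md_img_mul g (Aut_inv g) mA; rewrite mdC in e1.
have e3 : Aut_mul g (Aut_inv g) = Aut_one mu := mulgV g.
have := md_trans mu m1 m2 mA; rewrite e1 add0r e3 md_img_one// => le0.
by apply/eqP; rewrite eq_le le0 md_ge0.
Qed.

End image.

Section inverse_limits.
Context (R : realType) d (X : measurableType d) (mu : probability X R).

(** Composition is jointly continuous for convergence of preimages in measure. *)
Lemma limit_comp (f f' : nat -> X -> X) (F F' : X -> X) :
  (forall n, cancel (f n) (f' n)) ->
  (forall n, measure_preserving mu (f n)) -> (forall n, measure_preserving mu (f' n)) ->
  measure_preserving mu F -> measure_preserving mu F' ->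
  (forall A (e : R), measurable A -> 0 < e -> exists N, forall n, (N <= n)%N ->
    md mu (f n @^-1` A) (F @^-1` A) < e) ->
  (forall A (e : R), measurable A -> 0 < e -> exists N, forall n, (N <= n)%N ->
    md mu (f' n @^-1` A) (F' @^-1` A) < e) ->
  forall A, measurable A -> md mu ((F' \o F) @^-1` A) A = 0.
Proof.
move=> ff' pf pf' pF pF' cF cF' A mA.
have mFA := measurable_preim pF' mA.
apply/eqP; rewrite eq_le md_ge0 andbT.
suff H (e : R) : 0 < e -> md mu ((F' \o F) @^-1` A) A <= 0 + e by exact/ler_addgt0Pr.
move=> e0; rewrite add0r; have e2 : 0 < e / 2 by rewrite divr_gt0.
have [N1 H1] := cF _ _ mFA e2; have [N2 H2] := cF' _ _ mA e2.
pose n := maxn N1 N2; have h1 := H1 n (leq_maxl _ _); have h2 := H2 n (leq_maxr _ _).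
have mf'A := measurable_preim (pf' n) mA.
have m1 := measurable_preim pF mFA; have m2 := measurable_preim (pf n) mFA.
rewrite -[X in md _ _ X](_ : f n @^-1` (f' n @^-1` A) = A); last first.
  by apply/seteqP; split=> x; rewrite /preimage/= ff'.
apply: le_trans (md_trans mu m1 m2 (measurable_preim (pf n) mf'A)) _.
rewrite (md_preim (pf n) mFA mf'A) [leRHS](splitr e); apply: lerD; apply: ltW.
  by rewrite mdC.
by rewrite mdC.
Qed.

Variable G : nat -> set X.
Hypothesis tG : tight_coding mu G.

(** Almost everywhere F and F' are inverse to each other, and one can discard all
    points whose forward or backward iterates meet the exceptional null set.
    What remains is invariant, and F is replaced by the identity elsewhere. *)
Lemma ae_inverse_bij (F F' : X -> X) :
  measure_preserving mu F -> measure_preserving mu F' ->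
  (forall A, measurable A -> md mu ((F' \o F) @^-1` A) A = 0) ->
  (forall A, measurable A -> md mu ((F \o F') @^-1` A) A = 0) ->
  exists g : mpbij mu, {ae mu, forall x, g x = F x} /\ {ae mu, forall x, mpinv g x = F' x}.
Proof.
move=> pF pF' FF FF'; have mG := coding_meas tG.
have pFF := measure_preserving_comp pF' pF; have pFF' := measure_preserving_comp pF pF'.
pose N k := ((F' \o F) @^-1` G k `+` G k) `|` ((F \o F') @^-1` G k `+` G k).
have mFFG k := measurable_preim pFF (mG k); have mFFG' k := measurable_preim pFF' (mG k).
have mN k : measurable (N k).
  by apply: measurableU; apply: measurableY.
pose E := ~` \bigcup_k N k.
have mE : measurable E by apply: measurableC; exact: bigcupT_measurable.
have E0 : pr mu (~` E) = 0.
  rewrite setCK; apply: pr_bigcup0 => // k; apply/eqP; rewrite eq_le pr_ge0 andbT.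
  have m1 : measurable ((F' \o F) @^-1` G k `+` G k).
    exact: measurableY.
  have m2 : measurable ((F \o F') @^-1` G k `+` G k).
    exact: measurableY.
  by apply: le_trans (prU_le mu m1 m2) _; have := FF _ (mG k); have := FF' _ (mG k);
    rewrite /md => -> ->; rewrite addr0.
have sepE (h : X -> X) x : (forall k, ~ (h @^-1` G k `+` G k) x) -> h x = x.
  move=> hx; apply: (coding_inj tG); apply/funext => k; apply: asbool_equiv_eq.
  apply: contrapT => nk; apply: (hx k); rewrite setY_def.
  have [hG|nhG] := pselect (G k (h x)); have [xG|nxG] := pselect (G k x).
  - by exfalso; apply: nk.
  - by left.
  - by right.
  - by exfalso; apply: nk.
have EF x : E x -> F' (F x) = x.
  by move=> Ex; apply: (sepE (F' \o F)) => k Yk; apply: Ex; exists k => //; left.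
have EF' x : E x -> F (F' x) = x.
  by move=> Ex; apply: (sepE (F \o F')) => k Yk; apply: Ex; exists k => //; right.
(* E is the conull set on which F and F' are inverse to each other; D is the part
   of it that is invariant under both. *)
pose D := \bigcap_n (iter n F @^-1` E `&` iter n F' @^-1` E).
have mDn n : measurable (iter n F @^-1` E `&` iter n F' @^-1` E).
  by apply: measurableI; [exact: (measurable_preim (preserving_comp_iter n pF) mE)|
    exact: (measurable_preim (preserving_comp_iter n pF') mE)].
have mD : measurable D by exact: bigcapT_measurable.
have D0 : pr mu (~` D) = 0.
  rewrite setC_bigcap; apply: pr_bigcup0 => n; first exact: measurableC.
  have piter (h : X -> X) : measure_preserving mu h -> pr mu (iter n h @^-1` (~` E)) = 0.
    by move=> ph; rewrite /pr (preserving_comp_iter n ph).2//; exact: measurableC.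
  apply/eqP; rewrite eq_le pr_ge0 andbT setCI.
  have m1 := measurable_preim (preserving_comp_iter n pF) (measurableC mE).
  have m2 := measurable_preim (preserving_comp_iter n pF') (measurableC mE).
  by apply: le_trans (prU_le mu m1 m2) _; rewrite !piter// addr0.
have DE x : D x -> E x by move=> /(_ 0%N I)[].
have DF x : D x -> D (F x).
  move=> Dx n _; split; first by have [+ _] := Dx n.+1 I; rewrite /preimage/= -iterSr.
  case: n => [|n]; first by have [+ _] := Dx 1%N I.
  by rewrite /preimage/= -iterS iterSr EF; [have [_ +] := Dx n I|exact: DE].
have DF' x : D x -> D (F' x).
  move=> Dx n _; split; last by have [_ +] := Dx n.+1 I; rewrite /preimage/= -iterSr.
  case: n => [|n]; first by have [_ +] := Dx 1%N I.
  by rewrite /preimage/= -iterS iterSr EF'; [have [+ _] := Dx n I|exact: DE].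
pose patch (h : X -> X) x := if `[< D x >] then h x else x.
have patchD h x : D x -> patch h x = h x by move=> Dx; rewrite /patch asboolT.
have patchN h x : ~ D x -> patch h x = x by move=> Dx; rewrite /patch asboolF.
have patchK h h' : (forall x, D x -> D (h x)) -> (forall x, D x -> h' (h x) = x) ->
    cancel (patch h) (patch h').
  move=> Dh hh' x; have [Dx|nDx] := pselect (D x).
    by rewrite (patchD h)// patchD ?hh'//; exact: Dh.
  by rewrite (patchN h)// patchN.
have patch_ae h : {ae mu, forall x, patch h x = h x}.
  by apply: filterS (pr_eq0_ae (measurableC mD) D0) => x /contrapT; exact: patchD.
have patchm h : measure_preserving mu h -> measurable_fun setT (patch h).
  move=> ph _ A mA; rewrite setTI.
  rewrite (_ : _ @^-1` _ = (D `&` h @^-1` A) `|` (~` D `&` A)).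
    by have mhA := measurable_preim ph mA; mset.
  apply/seteqP; split=> x.
    have [Dx|nDx] := pselect (D x); first by rewrite /preimage/= patchD//; left.
    by rewrite /preimage/= patchN//; right.
  by move=> [[Dx Ax]|[nDx Ax]]; rewrite /preimage/=; [rewrite patchD|rewrite patchN].
have patch_pres h : measure_preserving mu h -> measure_preserving mu (patch h).
  move=> ph; split=> [|A mA]; first exact: patchm.
  have mp : measurable (patch h @^-1` A).
    by rewrite -[X in measurable X]setTI; exact: patchm.
  have mh := measurable_preim ph mA.
  have e0 := md_preim_ae (patchm h ph) ph.1 (patch_ae h) mA.
  have : pr mu (patch h @^-1` A) = pr mu A.
    have <- : pr mu (h @^-1` A) = pr mu A by rewrite /pr ph.2.
    apply/eqP; rewrite eq_le; have := pr_le_md mu mp mh; rewrite e0 addr0 => ->.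
    by have := pr_le_md mu mh mp; rewrite mdC e0 addr0 => ->.
  by move=> e; have := congr1 EFin e; rewrite -!prE.
exists (@MPBij _ _ _ mu (patch F) (patch F')
  (patchK F F' DF (fun x Dx => EF x (DE x Dx)))
  (patchK F' F DF' (fun x Dx => EF' x (DE x Dx)))
  (patch_pres F pF) (patchm F' pF')).
by split; exact: patch_ae.
Qed.

(** Both the maps and their inverses are assumed to converge fast: the limit of the
    maps alone preserves mu but may fail to be invertible. *)
Theorem Aut_complete (h : nat -> Aut mu) :
  (forall k, exists N, forall n, (N <= n)%N ->
    md mu (h n @` G k) (h n.+1 @` G k) <= (2 ^ n.+1)%:R^-1) ->
  (forall k, exists N, forall n, (N <= n)%N ->
    md mu (h n @^-1` G k) (h n.+1 @^-1` G k) <= (2 ^ n.+1)%:R^-1) ->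
  exists g : Aut mu, forall A (e : R), measurable A -> 0 < e ->
    exists N, forall n, (N <= n)%N ->
      md mu (h n @` A) (g @` A) < e /\ md mu (h n @^-1` A) (g @^-1` A) < e.
Proof.
move=> fast_img fast.
have pf n : measure_preserving mu (h n) := Aut_preserving (h n).
pose f' n := mpinv (repr (h n)).
have pf' n : measure_preserving mu (f' n) := mpinv_preserving (repr (h n)).
have [F [pF cF]] := limit_map tG pf fast.
have [|F' [pF' cF']] := limit_map tG pf' (_ : forall k, exists N, forall n, (N <= n)%N ->
    md mu (f' n @^-1` G k) (f' n.+1 @^-1` G k) <= (2 ^ n.+1)%:R^-1).
  move=> k; have [N HN] := fast_img k; exists N => n /HN.
  by rewrite !imgE.
have FF := limit_comp (fun n => mpfunK (repr (h n))) pf pf' pF pF' cF cF'.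
have FF' := limit_comp (fun n => mpinvK (repr (h n))) pf' pf pF' pF cF' cF.
have [g0 [g0F g0F']] := ae_inverse_bij pF pF' FF FF'.
pose g : Aut mu := \pi_(Aut mu)%qT g0.
have gF : {ae mu, forall x, g x = F x}.
  by apply: filterS2 (pi_ae g0) g0F => x -> ->.
have mg A : measurable A -> md mu (g @^-1` A) (F @^-1` A) = 0.
  by move=> mA; apply: md_preim_ae => //; [exact: (Aut_preserving g).1|exact: pF.1].
have mg' A : measurable A -> md mu (g @` A) (F' @^-1` A) = 0.
  move=> mA; have mF'A := measurable_preim pF' mA; have mgA := measurable_img g mA.
  rewrite -(md_preim (Aut_preserving g) mgA mF'A) preim_img.
  have m1 := measurable_preim (Aut_preserving g) mF'A; have m2 := measurable_preim pF mF'A.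
  apply/eqP; rewrite eq_le md_ge0 andbT.
  apply: le_trans (md_trans mu mA m2 m1) _.
  by have := FF A mA; rewrite mdC => ->; rewrite add0r mdC mg.
exists g => A e mA e0; have [N HN] := cF A e mA e0; have [N' HN'] := cF' A e mA e0.
exists (maxn N N') => n; rewrite geq_max => /andP[Nn N'n]; split.
  have m1 := measurable_preim (pf' n) mA; have m2 := measurable_preim pF' mA.
  rewrite imgE; apply: le_lt_trans (HN' n N'n).
  apply: le_trans (md_trans mu m1 m2 (measurable_img g mA)) _.
  by rewrite (mdC _ (F' @^-1` A)) mg'// addr0.
have m1 := measurable_preim (pf n) mA; have m2 := measurable_preim pF mA.
apply: le_lt_trans (HN n Nn).
apply: le_trans (md_trans mu m1 m2 (measurable_preim (Aut_preserving g) mA)) _.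
by rewrite (mdC _ (F @^-1` A)) mg// addr0.
Qed.

End inverse_limits.

(** * Closed subgroups of the automorphism group *)

Section Aut_topology.
Context (R : realType) d (X : measurableType d) (mu : probability X R).
Implicit Types (g h : Aut mu) (A B : set X).

Lemma weak_subbaseE h A (e : R) : measurable A ->
  [set g : Aut mu | (mu ((g @` A) `+` (h @` A)) < e%:E)%E] =
  [set g : Aut mu | md mu (g @` A) (h @` A) < e].
Proof.
move=> mA; apply/seteqP; split=> g /=; rewrite prE ?lte_fin//;
  by apply: measurableY; exact: measurable_img.
Qed.

Lemma open_Aut_ball h A (e : R) : measurable A -> 0 < e ->
  open [set g : Aut mu | md mu (g @` A) (h @` A) < e].
Proof.
move=> mA e0; rewrite -weak_subbaseE//; set B := mkset _.
exists [set B]; last by apply/seteqP; split=> [x [_ ->]//|x Bx]; exists B.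
move=> _ ->; exists (finmap.fset1 B).
  move=> C; rewrite finmap.in_fset1 => /eqP->; apply/mem_set.
  by exists A, h, e.
apply/seteqP; split=> [x /(_ B)|x Bx C /=]; first by apply; rewrite /= finmap.in_fset1.
by rewrite finmap.in_fset1 => /eqP->.
Qed.

Lemma cvg_Aut (F : set_system (Aut mu)) g : Filter F ->
  (forall A (e : R), measurable A -> 0 < e -> F [set h : Aut mu | md mu (h @` A) (g @` A) < e]) ->
  F --> g.
Proof.
move=> FF Fg O /=; rewrite nbhsE => -[_ [[B sB <-] [C BC Cg] sUBA]].
rewrite nbhs_filterE; apply: filterS sUBA _; apply: (@filterS _ _ _ C).
  by move=> ? ?; exists C.
have /sB [D sD IDeC] := BC; rewrite -IDeC; apply: filter_bigI => E DE.
have Eg : E g by move: Cg; rewrite -IDeC => /(_ _ DE).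
have [A [h [e [mA e0 EE]]]] : weak_subbase E := set_mem (sD _ DE).
change (F E); rewrite EE weak_subbaseE//; move: Eg; rewrite EE weak_subbaseE// => Eg.
have eg : 0 < e - md mu (g @` A) (h @` A) by rewrite subr_gt0.
apply: filterS (Fg A _ mA eg) => k /= kg.
have mimg (f : Aut mu) : measurable (f @` A) := measurable_img f mA.
apply: (le_lt_trans (md_trans mu (mimg k) (mimg g) (mimg h))).
by rewrite -ltrBrDr.
Qed.

End Aut_topology.

Definition aut_of (R : realType) d (X : measurableType d) (mu : probability X R)
  (G : set (Aut mu)) (t : set_type G) : Aut mu := set_val t.

Section subgroup.
Context (R : realType) d (X : measurableType d) (mu : probability X R).
Variable G : set (Aut mu).
Hypothesis hG : closed_subgroup G.
Local Notation T := (set_type G).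
Implicit Types (s t : T) (A B : set X).

Local Notation v := (@aut_of R d X mu G).

Lemma nbhs_subgroup t A (e : R) : measurable A -> 0 < e ->
  nbhs t [set s : T | md mu (v s @` A) (v t @` A) < e].
Proof.
move=> mA e0.
have nt : nbhs (v t) [set g : Aut mu | md mu (g @` A) (v t @` A) < e].
  by apply: open_nbhs_nbhs; split; [exact: open_Aut_ball|rewrite /= mdxx].
exact: (@initial_continuous T (Aut mu) (fun s : T => set_val s) t _ nt).
Qed.

Lemma cvg_subgroup (F : set_system T) t : Filter F ->
  (forall A (e : R), measurable A -> 0 < e ->
    F [set s : T | md mu (v s @` A) (v t @` A) < e]) -> F --> t.
Proof.
move=> FF Ft O /=; rewrite nbhsE => -[_ [[W oW <-] Wt] WO].
rewrite nbhs_filterE; apply: filterS WO _.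
have : (fmap v F) --> v t by apply: cvg_Aut => A e mA e0; exact: Ft.
by apply; exact: open_nbhs_nbhs.
Qed.

Let G1 : G 1%g. Proof. by have [_ [+ _]] := hG => /set_mem. Qed.

Let GM g h : G g -> G h -> G (g * h)%g.
Proof.
move=> Gg Gh; have [_ hG'] := hG.
exact: set_mem (group_closedM hG' (mem_set Gg) (mem_set Gh)).
Qed.

Let GV g : G g -> G g^-1%g.
Proof.
move=> Gg; have [_ hG'] := hG.
exact: set_mem (group_closedV hG' (mem_set Gg)).
Qed.

Let Tmul s t : T := SigSub (mem_set (GM (set_valP s) (set_valP t))).
Let Tinv t : T := SigSub (mem_set (GV (set_valP t))).
Let Tone : T := SigSub (mem_set G1).

Let Tinj s t : v s = v t -> s = t. Proof. exact: val_inj. Qed.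

Let mimg t A : measurable A -> measurable (v t @` A).
Proof. exact: measurable_img. Qed.

Let mul_cont : continuous (fun p : T * T => Tmul p.1 p.2).
Proof.
move=> [s t]; apply: cvg_subgroup => A e mA e0 /=.
have e2 : 0 < e / 2 by rewrite divr_gt0.
exists ([set s' : T | md mu (v s' @` (v t @` A)) (v s @` (v t @` A)) < e / 2],
        [set t' : T | md mu (v t' @` A) (v t @` A) < e / 2]).
  by split; apply: nbhs_subgroup => //; exact: mimg.
move=> [s' t'] [/= s's t't].
have m1 := mimg (Tmul s' t') mA; have m2 := mimg s' (mimg t' mA).
have m3 := mimg s' (mimg t mA); have m4 := mimg s (mimg t mA).
have m5 := mimg (Tmul s t) mA.
have e1 : md mu (v (Tmul s' t') @` A) (v s' @` (v t' @` A)) = 0 := md_img_mul (v s') (v t') mA.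
have e3 : md mu (v (Tmul s t) @` A) (v s @` (v t @` A)) = 0 := md_img_mul (v s) (v t) mA.
have e4 := md_img (v s') (mimg t' mA) (mimg t mA).
have d1 := md_trans mu m1 m2 m5; have d2 := md_trans mu m2 m3 m5.
have d3 := md_trans mu m3 m4 m5; have s1 := mdC mu (v s @` (v t @` A)) (v (Tmul s t) @` A).
rewrite /mkset /=; lra.
Qed.

Let img_inv t A : measurable A -> md mu (v (Tinv t) @` A) (v t @^-1` A) = 0.
Proof. exact: md_img_inv. Qed.

Let md_inv s t A : measurable A -> md mu (v (Tinv s) @` A) (v (Tinv t) @` A) =
  md mu (v s @^-1` A) (v t @^-1` A).
Proof.
move=> mA; apply: mdE0; try exact: img_inv; try exact: mimg;
  by apply: (measurable_preim (Aut_preserving _)).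
Qed.

Let inv_cont : continuous Tinv.
Proof.
move=> t; have FF : Filter (Tinv @ t).
  by apply: fmap_filter; exact: nbhs_filter.
apply: cvg_subgroup => A e mA e0.
pose B := v t @^-1` A; have mB : measurable B := measurable_preim (Aut_preserving _) mA.
apply: filterS (nbhs_subgroup t mB e0) => s /=; rewrite md_inv//.
have ms := measurable_preim (Aut_preserving (v s)) mA.
rewrite -(md_img (v s) ms mB) mdC.
have -> : v t @` B = A.
  apply/seteqP; split=> [_ [x Bx <-]//|x Ax].
  exists (mpinv (repr (v t)) x); last exact: mpinvK.
  by rewrite /B /preimage/= [v t _]mpinvK.
have -> : v s @` (v s @^-1` A) = A; last by rewrite mdC.
apply/seteqP; split=> [_ [x Bx <-]//|x Ax].
exists (mpinv (repr (v s)) x); last exact: mpinvK.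
by rewrite /preimage/= [v s _]mpinvK.
Qed.

Let TmulA : associative Tmul.
Proof. by move=> r s t; apply: Tinj; exact: mulgA. Qed.
Let Tmul1 : right_id Tone Tmul.
Proof. by move=> t; apply: Tinj; exact: mulg1. Qed.
Let TmulV : right_inverse Tone Tinv Tmul.
Proof. by move=> t; apply: Tinj; exact: mulgV. Qed.
Let Tmul1l : left_id Tone Tmul.
Proof. by move=> t; apply: Tinj; exact: mul1g. Qed.
Let TmulVl : left_inverse Tone Tinv Tmul.
Proof. by move=> t; apply: Tinj; exact: mulVg. Qed.

Definition subgroup_topgroup : topgroup T :=
  TopGroup TmulA Tmul1 TmulV Tmul1l TmulVl mul_cont inv_cont.

End subgroup.

Section dense_sequence.
Context (R : realType) d (X : measurableType d) (mu : probability X R).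
Variable C : nat -> set X.
Hypothesis tC : tight_coding mu C.

(** Finite Boolean combinations of the C k are dense by code_approx. The C k are
    included themselves so that a Cauchy condition on the A k gives one on them. *)
Lemma dense_sequence : exists A : nat -> set X, [/\ forall k, measurable (A k),
  (forall B (e : R), measurable B -> 0 < e -> exists k, md mu B (A k) < e) &
  (forall k, exists j, A j = C k)].
Proof.
pose D j : set X :=
  if (unpickle j : option (nat * seq (seq bool))) is Some nL then
  [set x | mkseq (code C x) nL.1 \in nL.2] else set0.
exists (mix C D); split.
- move=> k; rewrite /mix; case: odd; last exact: coding_meas tC _.
  rewrite /D; case: unpickle => // -[n L] /=.
  exact: (@measurable_mkseq_code _ _ C (coding_meas tC) n (fun s => s \in L)).
- move=> B e mB e0.
  have [n [L BL]] := code_approx tC (coding_meas tC) (coding_inj tC) mB e0.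
  exists (pickle (n, L)).*2.+1; rewrite /mix oddS odd_double /= uphalf_double.
  by rewrite /D pickleK.
- by move=> k; exists k.*2; rewrite /mix odd_double doubleK.
Qed.

End dense_sequence.

Section subgroup_balls.
Context (R : realType) d (X : measurableType d) (mu : probability X R).
Variable G : set (Aut mu).
Hypothesis hG : closed_subgroup G.
Local Notation T := (set_type G).
Implicit Types (s t : T) (B : set X).
Variable C : nat -> set X.
Hypothesis tC : tight_coding mu C.
Variable A : nat -> set X.
Hypotheses (mA : forall k, measurable (A k))
  (dA : forall B (e : R), measurable B -> 0 < e -> exists k, md mu B (A k) < e)
  (AC : forall k, exists j, A j = C k).

Local Notation H := (subgroup_topgroup hG).
Local Notation v := (@aut_of R d X mu G).
Let mimg t B : measurable B -> measurable (v t @` B).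
Proof. exact: measurable_img. Qed.
Let mpre t B : measurable B -> measurable (v t @^-1` B).
Proof. by apply: measurable_preim; exact: Aut_preserving. Qed.

Lemma md_img_tinv s t B : measurable B ->
  md mu (v (tinv H s) @` B) (v (tinv H t) @` B) =
  md mu (v s @^-1` B) (v t @^-1` B).
Proof.
move=> mB; apply: mdE0; try exact: (md_img_inv _ mB); try exact: mpre;
  exact: (mimg (tinv H _)).
Qed.

Lemma md_preim_tinv s t B : measurable B ->
  md mu (v (tinv H s) @^-1` B) (v (tinv H t) @^-1` B) =
  md mu (v s @` B) (v t @` B).
Proof.
move=> mB; rewrite -md_img_tinv//.
have tinvK r : tinv H (tinv H r) = r.
  by rewrite -[LHS](tmul1 H) -(tmulVl H r) tmulA tmulVl tmul1l.
by rewrite !tinvK.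
Qed.

(** Invariant under right multiplication; its image under inversion is the
    corresponding condition on images. *)
Definition pre_close n s t := forall k, (k < n.+1)%N ->
  md mu (v s @^-1` A k) (v t @^-1` A k) <= (2 ^ n)%:R^-1.

Definition two_sided_close n s t := forall k, (k < n.+1)%N ->
  md mu (v s @` A k) (v t @` A k) <= (2 ^ n)%:R^-1 /\
  md mu (v s @^-1` A k) (v t @^-1` A k) <= (2 ^ n)%:R^-1.

Lemma pre_close_sym n s t : pre_close n s t -> pre_close n t s.
Proof. by move=> st k kn; rewrite mdC; exact: st. Qed.

Lemma pre_close_trans n r s t :
  pre_close n.+1 r s -> pre_close n.+1 s t -> pre_close n r t.
Proof.
move=> rs st k kn; rewrite -halve_pow.
apply: le_trans (md_trans mu (mpre r (mA k)) (mpre s (mA k)) (mpre t (mA k))) _.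
by apply: lerD; [apply: rs|apply: st]; rewrite ltnW.
Qed.

Lemma pre_close_two_sided n s t : pre_close n s t ->
  pre_close n (tinv H s) (tinv H t) -> two_sided_close n s t.
Proof.
move=> st st' k kn; split; last exact: st.
by rewrite -md_preim_tinv//; exact: st'.
Qed.

(** The sets A k being dense, closeness of finitely many images v s @` A k bounds
    that of the image of any Borel set. *)
Lemma nbhs_img_base t (O : set T) : nbhs t O -> exists n,
  [set s : T | forall k, (k < n.+1)%N ->
     md mu (v t @` A k) (v s @` A k) <= (2 ^ n)%:R^-1] `<=` O.
Proof.
pose W n := [set s : T | forall k, (k < n.+1)%N ->
     md mu (v t @` A k) (v s @` A k) <= (2 ^ n)%:R^-1].
have pow_mono m n : (m <= n)%N -> (2 ^ n)%:R^-1 <= (2 ^ m)%:R^-1 :> R.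
  by move=> mn; rewrite lef_pV2 ?posrE ?ltr0n ?expn_gt0// ler_nat leq_exp2l.
have Wmono m n : (m <= n)%N -> W n `<=` W m.
  move=> mn s Ws k km; apply: le_trans (pow_mono _ _ mn); apply: Ws.
  exact: leq_trans km _.
pose F : set_system T := [set P | exists n, W n `<=` P].
have FF : Filter F.
  split; first by exists 0%N.
    move=> P Q [m mP] [n nQ]; exists (maxn m n) => s Ws.
    by split; [apply: mP; exact: Wmono (leq_maxl _ _) _ Ws|apply: nQ; exact: Wmono (leq_maxr _ _) _ Ws].
  by move=> P Q PQ [n nP]; exists n; exact: subset_trans PQ.
suff : F --> t by move=> /[apply].
apply: cvg_subgroup => B e mB e0.
have e4 : 0 < e / 4 by rewrite divr_gt0.
have [k kB] := dA mB e4; have [n nP] := inv_pow_lt e4.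
exists (maxn n k) => s /(_ k) Ws.
have kk : (k < (maxn n k).+1)%N by rewrite ltnS leq_maxr.
have h1 := le_lt_trans (Ws kk) (nP _ (leq_maxl _ _)).
have h2 := md_img (v s) mB (mA k); have h3 := md_img (v t) (mA k) mB.
have d1 := md_trans mu (mimg s mB) (mimg s (mA k)) (mimg t mB).
have d2 := md_trans mu (mimg s (mA k)) (mimg t (mA k)) (mimg t mB).
rewrite (mdC _ (v t @` _) (v s @` _)) in h1; rewrite (mdC _ (A k)) in h3.
rewrite /mkset; change (md mu (v s @` B) (v t @` B) < e); lra.
Qed.

(** Two-sided closeness defines the group topology because inversion is
    continuous, and it is complete because Aut is and G is closed in it. *)
Lemma subgroup_complete_balls : complete_balls two_sided_close.
Proof.
have pow_mono m n : (m <= n)%N -> (2 ^ n)%:R^-1 <= (2 ^ m)%:R^-1 :> R.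
  by move=> mn; rewrite lef_pV2 ?posrE ?ltr0n ?expn_gt0// ler_nat leq_exp2l.
have cl_trans n r s t : two_sided_close n.+1 r s -> two_sided_close n.+1 s t ->
    two_sided_close n r t.
  move=> rs st k kn; have kn' := ltnW kn : (k < n.+2)%N; rewrite -halve_pow; split.
    apply: le_trans (md_trans mu (mimg r (mA k)) (mimg s (mA k)) (mimg t (mA k))) _.
    by apply: lerD; [have [] := rs k kn'|have [] := st k kn'].
  apply: le_trans (md_trans mu (mpre r (mA k)) (mpre s (mA k)) (mpre t (mA k))) _.
  by apply: lerD; [have [] := rs k kn'|have [] := st k kn'].
have cl_mono m n s t : (m <= n)%N -> two_sided_close n s t -> two_sided_close m s t.
  move=> mn st k km; have [h1 h2] := st k (leq_trans km (mn : (m < n.+1)%N)).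
  by split; [exact: le_trans h1 (pow_mono _ _ mn)|exact: le_trans h2 (pow_mono _ _ mn)].
have cl_refl n t : two_sided_close n t t.
  by move=> k _; rewrite !mdxx; split; rewrite invr_ge0 ler0n.
split => //.
- by move=> n s t st k kn; rewrite mdC (mdC _ (v t @^-1` _)); exact: st.
- move=> n t; apply: nbhs_forall_lt => k.
  have p0 : 0 < (2 ^ n)%:R^-1 :> R by rewrite invr_gt0 ltr0n expn_gt0.
  have n1 := nbhs_subgroup t (mA k) p0.
  have n2 : nbhs t [set s | md mu (v (tinv H s) @` A k) (v (tinv H t) @` A k) < (2 ^ n)%:R^-1].
    exact: (@tinv_cont _ H t _ (nbhs_subgroup (tinv H t) (mA k) p0)).
  apply: filterS2 n1 n2 => s /= s1 s2; split; first by rewrite mdC ltW.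
  by rewrite mdC -md_img_tinv// ltW.
- move=> t O /nbhs_img_base[n nO]; exists n => s st; apply: nO => k kn.
  by have [] := st k kn.
- move=> h hP.
  have tail n m : (n <= m)%N -> two_sided_close n.+1 (h n) (h m).
    move=> /subnK <-; move: (m - n)%N => i; elim: i n => [|i IH] n.
      by rewrite add0n; exact: cl_refl.
    rewrite addSnnS; apply: cl_trans (hP n) _.
    exact: (IH n.+1).
  have fast k : exists N, forall n, (N <= n)%N ->
     md mu (v (h n) @` C k) (v (h n.+1) @` C k) <= (2 ^ n.+1)%:R^-1 /\
     md mu (v (h n) @^-1` C k) (v (h n.+1) @^-1` C k) <= (2 ^ n.+1)%:R^-1.
    have [j <-] := AC k; exists j => n jn.
    have [|h1 h2] := hP n j; first by rewrite ltnS leqW// leqW.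
    by split; [exact: le_trans h1 (pow_mono _ _ (leqnSn _))|
               exact: le_trans h2 (pow_mono _ _ (leqnSn _))].
  have [||g gP] := @Aut_complete _ _ _ mu C tC (fun n => v (h n)).
  + by move=> k; have [N NP] := fast k; exists N => n /NP[].
  + by move=> k; have [N NP] := fast k; exists N => n /NP[].
  have hg : (v (h n) @[n --> \oo]) --> g.
    apply: cvg_Aut => B e mB e0; have [N NP] := gP B e mB e0.
    by exists N => // n /= /NP[].
  have Gg : G g.
    apply: (closed_cvg G hG.1 _ _ hg); exists 0%N => // n _; exact: set_valP.
  pose t : T := SigSub (mem_set Gg).
  exists t => n k kn; split; [suff H1 (e : R) : 0 < e ->
      md mu (v (h n) @` A k) (g @` A k) <= (2 ^ n.+1)%:R^-1 + e by exact/ler_addgt0Pr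
    |suff H1 (e : R) : 0 < e ->
      md mu (v (h n) @^-1` A k) (g @^-1` A k) <= (2 ^ n.+1)%:R^-1 + e by exact/ler_addgt0Pr];
    move=> e0; have [N NP] := gP _ _ (mA k) e0;
    have [t1 t2] := tail n (maxn n N) (leq_maxl _ _) k kn;
    have [g1 g2] := NP (maxn n N) (leq_maxr _ _).
  + have mg := measurable_img g (mA k).
    apply: le_trans (md_trans mu (mimg (h n) (mA k)) (mimg (h (maxn n N)) (mA k)) mg) _.
    by apply: lerD => //; exact: ltW.
  + have mg := measurable_preim (Aut_preserving g) (mA k).
    apply: le_trans (md_trans mu (mpre (h n) (mA k)) (mpre (h (maxn n N)) (mA k)) mg) _.
    by apply: lerD => //; exact: ltW.
Qed.

Definition subgroup_base (l : seq (nat * nat * nat)) : set T :=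
  [set t | forall a, a \in l ->
     md mu (v t @` A a.1.1) (A a.1.2) < a.2.+1%:R^-1].

Lemma subgroup_countable_base : countable_base subgroup_base.
Proof.
split=> [l|t O oO Ot].
  rewrite openE => t tl; apply: nbhs_singleton; apply: nbhs_interior.
  elim: l tl => [|a l IH] tl; first exact: filterS filterT.
  have ta := tl a (mem_head _ _).
  have ea : 0 < a.2.+1%:R^-1 - md mu (v t @` A a.1.1) (A a.1.2) by rewrite subr_gt0.
  have tl' : subgroup_base l t by move=> c cl; apply: tl; rewrite inE cl orbT.
  apply: filterS2 (nbhs_subgroup t (mA a.1.1) ea) (IH tl') => s /= sa sl c.
  rewrite inE => /orP[/eqP->|]; last exact: sl.
  apply: le_lt_trans (md_trans mu (mimg s (mA _)) (mimg t (mA a.1.1)) (mA _)) _.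
  by rewrite -ltrBrDr.
have [n nO] := nbhs_img_base (open_nbhs_nbhs (conj oO Ot)).
have p0 : 0 < (2 ^ n.+1)%:R^-1 :> R by rewrite invr_gt0 ltr0n expn_gt0.
have [m mp] := ltr_add_invr p0; rewrite add0r in mp.
have m0 : 0 < m.+1%:R^-1 :> R by rewrite invr_gt0 ltr0n.
have /choice[j jP] k := dA (mimg t (mA k)) m0.
exists [seq (k, j k, m) | k <- iota 0 n.+1]; split.
  by move=> a /mapP[k _ ->] /=; exact: jP.
move=> s sl; apply: nO => k kn; rewrite -halve_pow.
apply: le_trans (md_trans mu (mimg t (mA k)) (mA (j k)) (mimg s (mA k))) _.
have kin : (k, j k, m) \in [seq (k, j k, m) | k <- iota 0 n.+1].
  by apply: (map_f (fun k => (k, j k, m))); rewrite mem_iota.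
have /= sk := sl _ kin.
apply: lerD; first by apply: ltW; exact: lt_trans (jP k) mp.
by rewrite mdC; apply: ltW; exact: lt_trans sk mp.
Qed.

End subgroup_balls.

(** * Spatial actions *)

Section spatial.
Context (R : realType) d (X : measurableType d) (mu : probability X R)
  (G : set (Aut mu)) (act : Aut mu -> X -> X).
Hypotheses (hG : closed_subgroup G) (sr : spatial_realization G act).
Local Notation T := (set_type G).
Local Notation H := (subgroup_topgroup hG).
Local Notation v := (@aut_of R d X mu G).

Definition sub_act (t : T) : X -> X := act (v t).

Lemma sub_act1 x : sub_act (tone H) x = x.
Proof. by have [[act1 _] _ _ _] := sr; exact: act1. Qed.

Lemma sub_actM s t x : sub_act (tmul H s t) x = sub_act s (sub_act t x).
Proof. by have [[_ actM] _ _ _] := sr; apply: actM; exact: set_valP. Qed.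

Lemma sub_act_preserving t : measure_preserving mu (sub_act t).
Proof. by have [_ _ mp _] := sr; apply: mp; exact: set_valP. Qed.

Lemma sub_act_ae t : {ae mu, forall x, sub_act t x = v t x}.
Proof. by have [_ _ _ ae] := sr; apply: ae; exact: set_valP. Qed.

(** In Aut, automorphisms that agree almost everywhere are equal. *)
Lemma sub_act_faithful t : {ae mu, forall x, sub_act t x = x} -> t = tone H.
Proof.
move=> tx; apply: val_inj; apply/Aut_eqP.
apply: filterS3 tx (sub_act_ae t) (Aut_oneE mu) => x h1 h2 h3.
by rewrite [RHS]h3; exact: etrans (esym h2) h1.
Qed.

Context (J : countType) (U : J -> set T).
Hypotheses (bU : countable_base U) (bT : baire T).

Lemma vaughtI d' (Z : measurableType d') (S S' : set (T * Z)) :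
  vaught U S -> vaught U S' -> vaught U (S `&` S').
Proof.
move=> vS vS'; rewrite -[S `&` S']setCK setCI; apply: (vaughtC bU bT).
rewrite -bigcup2E; apply: (vaught_bigcup bU) => -[|[|n]] /=.
- exact: vaughtC.
- exact: vaughtC.
- exact: vaught0.
Qed.

(** The Borel sets of the product are generated by rectangles, for which category
    quantification is trivial, and the class is a sigma-algebra. *)
Lemma sub_act_vaught (C : set X) : measurable C ->
  vaught U [set p : T * X | C (sub_act p.1 p.2)].
Proof.
move=> mC; have [_ mact _ _] := sr.
have mG : measurable (G : set (borel (Aut mu))).
  rewrite -[G]setCK; apply: measurableC; apply: sub_sigma_algebra.
  by apply: closed_openC; exact: hG.1.
have mGX : measurable ((G : set (borel (Aut mu))) `*` [set: X]).
  exact: measurableX.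
have mS := mact mGX C mC.
have vS (S : set (borel (Aut mu) * X)) : measurable S ->
    vaught U [set p : T * X | S (v p.1, p.2)].
  rewrite measurable_prod_measurableType.
  apply: (sigma_ind (K := fun S : set (borel (Aut mu) * X) =>
    vaught U [set p : T * X | S (v p.1, p.2)])).
  - exact: vaught0.
  - by move=> A vA; exact: (vaughtC bU bT vA).
  - move=> F vF; rewrite (_ : mkset _ = \bigcup_n [set p : T * X | F n (v p.1, p.2)]).
      exact: vaught_bigcup.
    by apply/seteqP; split.
  - move=> _ [A mA [B mB <-]].
    rewrite (_ : mkset _ = [set p : T * X | A (v p.1)] `&` [set p | B p.2]); last first.
      by apply/seteqP; split.
    apply: vaughtI; last first.
      rewrite (_ : mkset _ = setT `*` B); first by apply: vaught_rect => //; exact: openT.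
      by apply/seteqP; split=> p //= -[].
    apply: (sigma_ind (K := fun A : set (borel (Aut mu)) =>
      vaught U [set p : T * X | A (v p.1)])) mA.
    + exact: vaught0.
    + by move=> D vD; exact: (vaughtC bU bT vD).
    + move=> F vF; rewrite (_ : mkset _ = \bigcup_n [set p : T * X | F n (v p.1)]).
        exact: vaught_bigcup.
      by apply/seteqP; split.
    + move=> O oO; rewrite (_ : mkset _ = (v @^-1` O) `*` setT).
        by apply: vaught_rect => //; exists O.
      by apply/seteqP; split=> p //= -[].
rewrite (_ : mkset _ = [set p : T * X |
  ((G `*` [set: X]) `&` (fun q : borel (Aut mu) * X => act q.1 q.2) @^-1` C) (v p.1, p.2)]).
  exact: vS.
apply/seteqP; split=> p /=; last by move=> [].
by move=> Cp; split=> //; split=> //; exact: set_valP.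
Qed.

End spatial.

Theorem theorem2p3 (R : realType) (d : measure_display) (X : measurableType d)
    (mu : probability X R) (muN : probability (seq_space X) R)
    (G : set (Aut mu)) (act : Aut mu -> X -> X) :
  standard_borel R X ->
  non_atomic mu ->
  closed_subgroup G ->
  spatial_realization G act ->
  is_product_measure mu muN ->
  (forall g, G g -> measure_preserving muN (diag_act act g)) /\
  exists Y : set (seq_space X),
    [/\ measurable Y,
        invariant_under G (diag_act act) Y,
        muN Y = 1%E,
        free_on G (diag_act act) Y &
        ~ locally_compact [set: set_type G] ->
        ~ essentially_countable_on R Y (orbit_rel_on G (diag_act act))].
Proof.
move=> sX _ hG sr prod; split.
  by move=> g Gg; have [_ _ mp _] := sr; exact: (diag_preserving prod (mp g Gg)).
have [C /(_ mu) tC] := standard_coding sX.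
have [A [mA dA AC]] := dense_sequence tC.
have balls := subgroup_complete_balls hG tC mA dA AC.
have bT := complete_balls_baire balls.
have bU := @subgroup_countable_base _ _ _ _ G _ mA dA.
have act1 := sub_act1 hG sr; have actM := sub_actM hG sr.
have mp := sub_act_preserving sr.
have vact := sub_act_vaught hG sr bU bT.
have [I [b ib]] := vaught_invariant_basis bU bT act1 actM vact
  (coding_meas tC) (coding_inj tC).
exists (basis_dense mu b); split.
- exact: (measurable_basis_dense mu ib).
- move=> g y Gg Yy.
  exact: (basis_dense_act ib mp (SigSub (mem_set Gg)) Yy).
- have mY := measurable_basis_dense mu ib.
  by rewrite prE// (basis_dense_conull ib prod).
- move=> g y Gg g1 Yy gy; apply: g1.
  pose t : set_type G := SigSub (mem_set Gg).
  have /(congr1 (@aut_of _ _ _ _ _)) := basis_dense_free (H := subgroup_topgroup hG) mp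
    (sub_act_faithful hG sr) ib (t := t) Yy gy.
  by [].
- move=> nlc [d' [Z [F [sZ [Frefl _ _ _ Fcount] [f mf red]]]]]; apply: nlc.
  (* From the coding of Z only its countable separating sequence is used, so any
     probability on Z will do. *)
  have [Cz /(_ (dirac point)) tZ] := standard_coding sZ.
  have [x y Yx Yy|N [oN N1 tbN]] := totally_bounded_nbhd prod bU bT act1 actM mp
    (sub_act_faithful hG sr) vact ib tC (coding_meas tZ) (coding_inj tZ) mf Frefl Fcount.
    rewrite -red//; split=> [[t ->]|[g Gg ->]].
      by exists (aut_of t) => //; exact: set_valP.
    by exists (SigSub (mem_set Gg)).
  apply: (@locally_compact_nbhd _ (subgroup_topgroup hG) _ balls (@pre_close _ _ _ _ G A)
    _ _ _ N).
  + by move=> n s t; exact: pre_close_sym.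
  + by move=> n r s t; exact: pre_close_trans.
  + by move=> n s t; exact: pre_close_two_sided.
  + exact: open_nbhs_nbhs.
  + move=> n g gN.
    have p0 : 0 < (2 ^ n)%:R^-1 :> R by rewrite invr_gt0 ltr0n expn_gt0.
    have [M /(_ g gN)[i [j [/andP[ij _] ijA]]]] := tbN A n.+1 _ mA p0.
    exists i, j; split=> // k kn; apply: ltW; apply: le_lt_trans (ijA k kn).
    have ae0 (t : set_type G) : md mu (aut_of t @^-1` A k) (sub_act act t @^-1` A k) = 0.
      rewrite mdC.
      exact: (md_preim_ae (mp t).1 (Aut_preserving (aut_of t)).1 (sub_act_ae sr t) (mA k)).
    rewrite (mdE0 _ _ _ _ (ae0 (g i)) (ae0 (g j)))//; apply: measurable_preim => //;
      exact: Aut_preserving.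
Qed.
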